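(* Let $C\subset\mathbb{R}^4$ be a closed cone (centered at the origin) which has the same topology as $Y\times Y$ (i.e. is homeomorphic to $Y\times Y$) and which satisfies the following condition: the set $X=C\cap\partial B(0,1)$ is a finite union of great circles and arcs of great circles of $\partial B(0,1)$, where the great circles are at positive distance from the rest of $X$, the arcs meet each other only at their endpoints, and at their endpoints the arcs meet in sets of three, with $120^\circ$ angles (there are no free ends). Then $C$ is the image of $Y\times Y$ under a linear isometry of $\mathbb{R}^4$. In other words, $Y\times Y$ is, modulo isometry, the only cone in $\mathbb{R}^4$ with the same topology as $Y\times Y$ that satisfies this condition.
   Context: Write $\mathbb{R}^4=\mathbb{R}^2_1\times\mathbb{R}^2_2$ (orthogonal product of two Euclidean planes). A 1-dimensional $\mathbb{Y}$ set is the union of three half lines with a common endpoint (its center) meeting there with $120^\circ$ angles. For $i=1,2$, $Y_i\subset\mathbb{R}^2_i$ is a 1-dimensional $\mathbb{Y}$ set centered at the origin of $\mathbb{R}^2_i$, and $Y\times Y:=Y_1\times Y_2$. $B(0,1)$ is the open unit ball of $\mathbb{R}^4$. A great circle is the intersection of the unit sphere $\partial B(0,1)$ with a 2-dimensional linear subspace. *)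

(* Defs.v *)
From HB Require Import structures.
From mathcomp Require Import all_boot all_order all_algebra.
From mathcomp Require Import all_classical all_reals all_analysis.
Export numFieldNormedType.Exports.

Set Implicit Arguments.
Unset Strict Implicit.
Unset Printing Implicit Defensive.

Import Order.TTheory GRing.Theory Num.Theory.

Local Open Scope classical_set_scope.
Local Open Scope ring_scope.

(* R^n is 'rV[R]_n. The library norm on matrices is the sup norm: it gives the
   Euclidean topology, but the Euclidean length and angles are defined here. *)
Definition dotp (R : realType) (n : nat) (u v : 'rV[R]_n) : R :=
  \sum_(i < n) u 0 i * v 0 i.

Definition enorm (R : realType) (n : nat) (u : 'rV[R]_n) : R :=
  Num.sqrt (dotp u u).

Definition angle (R : realType) (n : nat) (u v : 'rV[R]_n) : R :=
  acos (dotp u v / (enorm u * enorm v)).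

Definition angle120 (R : realType) : R := 2 * pi / 3.

Definition unit_sphere (R : realType) (n : nat) : set 'rV[R]_n :=
  [set x | enorm x = 1].

Definition half_line (R : realType) (n : nat) (p u : 'rV[R]_n) :
    set 'rV[R]_n :=
  [set p + t *: u | t in [set t : R | 0 <= t]].

Definition is_Yset (R : realType) (n : nat) (p : 'rV[R]_n)
    (Y : set 'rV[R]_n) : Prop :=
  exists u : 'I_3 -> 'rV[R]_n,
    [/\ forall i, u i != 0,
        forall i j, i != j -> angle (u i) (u j) = angle120 R
      & Y = \bigcup_i half_line p (u i)].

(* Concatenation of coordinates identifies R^2 x R^2 with R^4, orthogonally. *)
Definition prod_set (R : realType) (Y1 Y2 : set 'rV[R]_2) : set 'rV[R]_4 :=
  [set x : 'rV[R]_(2 + 2) | exists y1 y2,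
    [/\ Y1 y1, Y2 y2 & x = row_mx y1 y2]].

Definition is_cone (R : realType) (n : nat) (C : set 'rV[R]_n) : Prop :=
  forall (t : R) (x : 'rV[R]_n), 0 < t -> C x -> C (t *: x).

(* The two sets carry their subspace topologies. *)
Definition homeomorphic (T U : topologicalType) (A : set T) (B : set U) :
    Prop :=
  exists (f : T -> U) (g : U -> T),
    [/\ {within A, continuous f} /\ {within B, continuous g},
        f @` A `<=` B, g @` B `<=` A,
        {in A, cancel f g} & {in B, cancel g f}].

Definition is_great_circle (R : realType) (n : nat) (G : set 'rV[R]_n) :
    Prop :=
  exists P : {vspace 'rV[R]_n},
    \dim P = 2%N /\ G = @unit_sphere R n `&` [set x | x \in P].

(* An arc is given by its arc length parametrization on [0, len]; it is neither
   reduced to a point nor does it close up into the whole great circle. *)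
Record great_arc (R : realType) (n : nat) := GreatArc {
  arc_src : 'rV[R]_n;
  arc_dir : 'rV[R]_n;
  arc_len : R;
  arc_src_unit : enorm arc_src = 1;
  arc_dir_unit : enorm arc_dir = 1;
  arc_src_dir : dotp arc_src arc_dir = 0;
  arc_len_gt0 : 0 < arc_len;
  arc_len_lt : arc_len < 2 * pi }.

Definition arc_pt (R : realType) (n : nat) (a : great_arc R n) (t : R) :
    'rV[R]_n :=
  cos t *: arc_src a + sin t *: arc_dir a.

Definition arc_set (R : realType) (n : nat) (a : great_arc R n) :
    set 'rV[R]_n :=
  [set arc_pt a t | t in [set t : R | 0 <= t <= arc_len a]].

(* The two ends are indexed by bool; [true] is the end at parameter len. *)
Definition arc_end (R : realType) (n : nat) (a : great_arc R n) (b : bool) :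
    'rV[R]_n :=
  arc_pt a (if b then arc_len a else 0).

Definition arc_ends (R : realType) (n : nat) (a : great_arc R n) :
    set 'rV[R]_n :=
  [set arc_end a b | b in [set: bool]].

(* Unit tangent vector at an end, pointing into the arc: the derivative of
   [arc_pt a] at 0, resp. the opposite of its derivative at len. *)
Definition arc_tangent (R : realType) (n : nat) (a : great_arc R n)
    (b : bool) : 'rV[R]_n :=
  if b then sin (arc_len a) *: arc_src a - cos (arc_len a) *: arc_dir a
  else arc_dir a.

Definition at_positive_distance (R : realType) (n : nat)
    (A B : set 'rV[R]_n) : Prop :=
  exists2 e : R, 0 < e & forall x y, A x -> B y -> e <= enorm (x - y).

Definition is_net120 (R : realType) (n : nat) (X : set 'rV[R]_n) : Prop :=
  exists (k m : nat) (G : 'I_k -> set 'rV[R]_n) (a : 'I_m -> great_arc R n),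
    [/\ (forall i, is_great_circle (G i)) /\
        X = (\bigcup_i G i) `|` (\bigcup_i arc_set (a i)),
        forall i, at_positive_distance (G i) (X `\` G i),
        forall i j, i != j ->
          arc_set (a i) `&` arc_set (a j) `<=` arc_ends (a i) `&` arc_ends (a j),
        forall i b,
          #|[pred e : 'I_m * bool | arc_end (a e.1) e.2 == arc_end (a i) b]|
            = 3%N
      & forall i b j c, (i, b) != (j, c) ->
          arc_end (a i) b = arc_end (a j) c ->
          angle (arc_tangent (a i) b) (arc_tangent (a j) c) = angle120 R].

Definition is_linear_isometry (R : realType) (n : nat)
    (f : 'rV[R]_n -> 'rV[R]_n) : Prop :=
  linear f /\ forall x, enorm (f x) = enorm x.

(* Main.v *)
Require Import Defs.
From mathcomp Require Import all_boot all_order all_algebra.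
From mathcomp Require Import all_classical all_reals all_analysis.
From mathcomp Require Import ring lra.
Local Open Scope classical_set_scope.
Local Open Scope ring_scope.

(** The proof has a topological and a metric part.

   Topology. A cone over a network [X] is a surface near the points over the
   circles and the interiors of the arcs, and a union of three half-planes with
   a common edge near the points over the vertices. A homeomorphism respects
   this distinction ([planar_not_triple]): among three circle-valued maps on an
   annulus, two have a product with a square root, because the monodromy modulo
   2 takes two values only; but near a triple edge this fails for the three
   projections that fold two of the sheets onto each other. So a homeomorphism
   between two such cones matches their singular rays, once it is known to match
   their origins ([origin_fixed]: six singular rays end at the origin of the
   product, and a tripod does not embed in a line). Then it matches the connected
   components of the regular part, and their closures. As the product of two
   planar stars is itself the cone over a network, with six vertices and nine
   quarters of great circles, it follows that [X] has no circle and consists of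
   nine arcs that join three vertices [A i] to three vertices [B k], one for each
   pair ([K33_structure]).

   Metric. The oriented plane of the arc from [A i] to [B k] has a self-dual and
   an anti-self-dual part, two unit vectors of euclidean 3-spaces. The 120 degree
   condition says that the rows and the columns of both 3 by 3 arrays have sum
   zero. In dimension 3 this leaves two possibilities only: an array is constant
   along its diagonals or along its antidiagonals ([balanced_array]). If the two
   arrays had the same symmetry, all the [A i] would be on one line; hence they
   have opposite symmetries, and then each [A i] is orthogonal to each [B k]
   ([net_orthogonal]; quaternions serve as the algebra of self-dual forms). The
   arcs thus have length [pi / 2] or [3 * pi / 2]; a sign argument shows that, if
   some arc were long, two long arcs would start from the same vertex and cross
   at its antipode ([sin_len]). So all the arcs are quarters of great circles,
   the direction of an arc at one of its ends is its other end, the [A i] and the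
   [B k] form two orthogonal 120 degree stars, and the linear map that sends the
   standard stars to them is an isometry. *)

Import Order.TTheory GRing.Theory Num.Theory.

Set Implicit Arguments.
Unset Strict Implicit.
Unset Printing Implicit Defensive.

(** * Inner product *)

Section Dot.
Variables (R : realType) (n : nat).
Implicit Types (x y z : 'rV[R]_n) (a : R).

Lemma dotpC x y : dotp x y = dotp y x.
Proof. by apply: eq_bigr => i _; rewrite mulrC. Qed.

Lemma dotpDl x y z : dotp (x + y) z = dotp x z + dotp y z.
Proof. by rewrite -big_split; apply: eq_bigr => i _; rewrite !mxE mulrDl. Qed.

Lemma dotpDr x y z : dotp z (x + y) = dotp z x + dotp z y.
Proof. by rewrite !(dotpC z) dotpDl. Qed.

Lemma dotpZl a x y : dotp (a *: x) y = a * dotp x y.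
Proof.
by rewrite /dotp mulr_sumr; apply: eq_bigr => i _; rewrite !mxE mulrA.
Qed.

Lemma dotpZr a x y : dotp x (a *: y) = a * dotp x y.
Proof. by rewrite dotpC dotpZl dotpC. Qed.

Lemma dotpNl x y : dotp (- x) y = - dotp x y.
Proof. by rewrite -scaleN1r dotpZl mulN1r. Qed.

Lemma dotpNr x y : dotp x (- y) = - dotp x y.
Proof. by rewrite dotpC dotpNl dotpC. Qed.

Lemma dotp0l x : dotp 0 x = 0.
Proof. by rewrite -(scale0r 0) dotpZl mul0r. Qed.

Lemma dotp0r x : dotp x 0 = 0.
Proof. by rewrite dotpC dotp0l. Qed.

Lemma dotp_ge0 x : 0 <= dotp x x.
Proof. by apply: sumr_ge0 => i _; rewrite -expr2 sqr_ge0. Qed.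

Lemma dotp_eq0 x : dotp x x = 0 -> x = 0.
Proof.
move=> /eqP; rewrite psumr_eq0 => [|i _]; last by rewrite -expr2 sqr_ge0.
move=> /allP h; apply/rowP => i; rewrite mxE; apply/eqP.
by have := h i (mem_index_enum i); rewrite /= mulf_eq0 orbb.
Qed.

Lemma dotp_suml (I : Type) (r : seq I) (P : pred I) (F : I -> 'rV[R]_n) y :
  dotp (\sum_(i <- r | P i) F i) y = \sum_(i <- r | P i) dotp (F i) y.
Proof.
by elim/big_rec2: _ => [|i u v _ <-]; rewrite ?dotp0l // dotpDl.
Qed.

Lemma dotp_sumr (I : Type) (r : seq I) (P : pred I) (F : I -> 'rV[R]_n) y :
  dotp y (\sum_(i <- r | P i) F i) = \sum_(i <- r | P i) dotp y (F i).
Proof. by rewrite dotpC dotp_suml; apply: eq_bigr => i _; rewrite dotpC. Qed.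

Lemma enorm_ge0 x : 0 <= enorm x.
Proof. exact: sqrtr_ge0. Qed.

Lemma enorm_sqr x : enorm x ^+ 2 = dotp x x.
Proof. exact/sqr_sqrtr/dotp_ge0. Qed.

Lemma enorm1P x : enorm x = 1 <-> dotp x x = 1.
Proof. by split=> h; rewrite -?enorm_sqr ?h ?expr1n // /enorm h sqrtr1. Qed.

Lemma enormZ a x : enorm (a *: x) = `|a| * enorm x.
Proof.
rewrite /enorm dotpZl dotpZr mulrA -expr2 sqrtrM ?sqr_ge0 //.
by rewrite sqrtr_sqr.
Qed.

Lemma enorm_eq0 x : enorm x = 0 -> x = 0.
Proof. by move=> h; apply: dotp_eq0; rewrite -enorm_sqr h expr0n. Qed.

Lemma enorm_gt0 x : x != 0 -> 0 < enorm x.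
Proof.
move=> x0; rewrite lt0r enorm_ge0 andbT; apply: contra x0 => /eqP h.
exact/eqP/enorm_eq0.
Qed.

Lemma enorm0 : enorm (0 : 'rV[R]_n) = 0.
Proof. by rewrite /enorm dotp0l sqrtr0. Qed.

(** The discriminant argument, applied to the vector itself. *)
Lemma cauchy_schwarz x y : dotp x y <= enorm x * enorm y.
Proof.
have [->|x0] := eqVneq x 0; first by rewrite dotp0l enorm0 mul0r.
have [->|y0] := eqVneq y 0; first by rewrite dotp0r enorm0 mulr0.
have hx := enorm_gt0 x0; have hy := enorm_gt0 y0.
have := dotp_ge0 (enorm y *: x - enorm x *: y).
rewrite dotpDl !dotpDr !dotpNl !dotpNr !dotpZl !dotpZr -!enorm_sqr (dotpC y x).
set a := enorm x in hx *; set b := enorm y in hy *; set d := dotp x y.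
move=> h; have : 0 <= (2 * a * b) * (a * b - d) by lra.
by rewrite pmulr_rge0 ?subr_ge0 // !mulr_gt0.
Qed.

Lemma unit_eq x y : dotp x x = 1 -> dotp y y = 1 -> dotp x y = 1 -> x = y.
Proof.
move=> hx hy h; apply/eqP; rewrite -subr_eq0; apply/eqP/dotp_eq0.
by rewrite dotpDl !dotpDr !dotpNl !dotpNr hx hy (dotpC y x) h; lra.
Qed.

Lemma enormD x y : enorm (x + y) <= enorm x + enorm y.
Proof.
rewrite -(@ler_pXn2r _ 2) ?nnegrE ?addr_ge0 ?enorm_ge0 // enorm_sqr.
rewrite dotpDl !dotpDr (dotpC y x) -!enorm_sqr.
have := cauchy_schwarz x y; lra.
Qed.

Lemma enormN x : enorm (- x) = enorm x.
Proof. by rewrite /enorm dotpNl dotpNr opprK. Qed.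

(** The squared norm of the sum is [3 - 6 / 2]. *)
Lemma sum120 (u v w : 'rV[R]_n) :
  dotp u u = 1 -> dotp v v = 1 -> dotp w w = 1 ->
  dotp u v = - 2^-1 -> dotp u w = - 2^-1 -> dotp v w = - 2^-1 ->
  u + v + w = 0.
Proof.
move=> uu vv ww uv uw vw; apply: dotp_eq0.
by rewrite !dotpDl !dotpDr uu vv ww uv uw vw (dotpC v u) (dotpC w u)
  (dotpC w v) uv uw vw; lra.
Qed.

End Dot.

(** * Quaternions *)

Section Quaternion.
Variable R : realType.
Implicit Types (x y z a t : 'rV[R]_4).

(** Vectors of 4-space are read as quaternions, the first coordinate being the
   real part. *)
Definition quat (a b c d : R) : 'rV[R]_4 :=
  \row_(k < 4) nth 0 [:: a; b; c; d] k.

Notation "x .< k >" := (x 0 (inord k%N : 'I_4)) (at level 1, k at level 0, format "x .< k >").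

Lemma quatE (a b c d : R) :
  (((quat a b c d).<0> = a) * ((quat a b c d).<1> = b) *
   ((quat a b c d).<2> = c) * ((quat a b c d).<3> = d))%type.
Proof. by rewrite /quat !mxE !inordK. Qed.

Lemma quat_eta x : x = quat x.<0> x.<1> x.<2> x.<3>.
Proof.
apply/rowP => k; rewrite mxE.
by case: k => [[|[|[|[|]]]] //= h]; congr (x 0 _); apply: val_inj;
  rewrite /= inordK.
Qed.

Lemma dotp4 x y :
  dotp x y = x.<0> * y.<0> + x.<1> * y.<1> + x.<2> * y.<2> + x.<3> * y.<3>.
Proof.
rewrite /dotp !big_ord_recl big_ord0 addr0 !addrA.
by congr (_ + _ + _ + _); congr (x 0 _ * y 0 _); apply: val_inj;
  rewrite /= inordK.
Qed.

Definition qmul x y : 'rV[R]_4 :=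
  quat (x.<0> * y.<0> - x.<1> * y.<1> - x.<2> * y.<2> - x.<3> * y.<3>)
       (x.<0> * y.<1> + x.<1> * y.<0> + x.<2> * y.<3> - x.<3> * y.<2>)
       (x.<0> * y.<2> - x.<1> * y.<3> + x.<2> * y.<0> + x.<3> * y.<1>)
       (x.<0> * y.<3> + x.<1> * y.<2> - x.<2> * y.<1> + x.<3> * y.<0>).

Definition qconj x : 'rV[R]_4 := quat x.<0> (- x.<1>) (- x.<2>) (- x.<3>).

Definition qone : 'rV[R]_4 := quat 1 0 0 0.

Lemma quat_eqP x y :
  x.<0> = y.<0> -> x.<1> = y.<1> -> x.<2> = y.<2> -> x.<3> = y.<3> -> x = y.
Proof. by rewrite (quat_eta x) (quat_eta y) !quatE => -> -> -> ->. Qed.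

Ltac qring := apply: quat_eqP; rewrite /qmul /qconj /qone ?(quatE, mxE); ring.

Lemma qmulA x y z : qmul x (qmul y z) = qmul (qmul x y) z.
Proof. qring. Qed.

Lemma qmulDl x y z : qmul (x + y) z = qmul x z + qmul y z.
Proof. qring. Qed.

Lemma qmulDr x y z : qmul z (x + y) = qmul z x + qmul z y.
Proof. qring. Qed.

Lemma qmulZl c x y : qmul (c *: x) y = c *: qmul x y.
Proof. qring. Qed.

Lemma qmulZr c x y : qmul x (c *: y) = c *: qmul x y.
Proof. qring. Qed.

Lemma qmul0l x : qmul 0 x = 0.
Proof. qring. Qed.

Lemma qmul0r x : qmul x 0 = 0.
Proof. qring. Qed.

Lemma qmul1l x : qmul qone x = x.
Proof. qring. Qed.

Lemma qmul1r x : qmul x qone = x.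
Proof. qring. Qed.

Lemma qmul_conj x : qmul x (qconj x) = dotp x x *: qone.
Proof. rewrite dotp4; qring. Qed.

Lemma qconj_mul x : qmul (qconj x) x = dotp x x *: qone.
Proof. rewrite dotp4; qring. Qed.

Lemma dotp_qmulr x y n : dotp (qmul x n) (qmul y n) = dotp x y * dotp n n.
Proof. by rewrite !dotp4 /qmul !quatE; ring. Qed.

Lemma dotp_qmull x y n : dotp (qmul n x) (qmul n y) = dotp x y * dotp n n.
Proof. by rewrite !dotp4 /qmul !quatE; ring. Qed.

Lemma dotp_qconj x y : dotp (qconj x) (qconj y) = dotp x y.
Proof. by rewrite !dotp4 /qconj !quatE; ring. Qed.

(** The left and right quotients of [t] by [a]. For an orthonormal pair these are
   imaginary unit quaternions: the self-dual and the anti-self-dual part of the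
   oriented plane spanned by [a] and [t], that is of the 2-vector of the pair. *)
Definition sdual a t := qmul (qconj a) t.
Definition asdual a t := qmul t (qconj a).

Lemma sdual_pure a t : (sdual a t).<0> = dotp a t.
Proof. by rewrite dotp4 /sdual /qmul /qconj !quatE; ring. Qed.

Lemma asdual_pure a t : (asdual a t).<0> = dotp a t.
Proof. by rewrite dotp4 /asdual /qmul /qconj !quatE; ring. Qed.

Lemma dotp_sdual a t : dotp (sdual a t) (sdual a t) = dotp t t * dotp a a.
Proof. by rewrite /sdual dotp_qmull dotp_qconj. Qed.

Lemma dotp_asdual a t : dotp (asdual a t) (asdual a t) = dotp t t * dotp a a.
Proof. by rewrite /asdual dotp_qmulr dotp_qconj. Qed.

Lemma sdualK a t : dotp a a = 1 -> qmul a (sdual a t) = t.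
Proof. by move=> h; rewrite /sdual qmulA qmul_conj h scale1r qmul1l. Qed.

Lemma asdualK a t : dotp a a = 1 -> qmul (asdual a t) a = t.
Proof. by move=> h; rewrite /asdual -qmulA qconj_mul h scale1r qmul1r. Qed.

(** The frame of an arc at its far end, with the tangent pointing back into the
   arc, spans the same plane with the opposite orientation. *)
Lemma sdual_reverse a t c s : dotp a a = 1 -> dotp t t = 1 -> dotp a t = 0 ->
  c ^+ 2 + s ^+ 2 = 1 ->
  sdual (c *: a + s *: t) (s *: a - c *: t) = - sdual a t.
Proof.
move=> /eqP; rewrite dotp4 => /eqP ha /eqP; rewrite dotp4 => /eqP ht /eqP.
rewrite dotp4 => /eqP hat hcs.
have e0 : sdual (c *: a + s *: t) (s *: a - c *: t) =
   (c * s * dotp a a - c * s * dotp t t + s ^+ 2 *+ 2 * dotp a t) *: qone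
   - (c ^+ 2 + s ^+ 2) *: sdual a t.
  rewrite !dotp4 /sdual; qring.
by rewrite e0 !dotp4 ha ht hat hcs scale1r !mulr1 mulr0 addr0 subrr scale0r
  add0r.
Qed.

Lemma asdual_reverse a t c s : dotp a a = 1 -> dotp t t = 1 -> dotp a t = 0 ->
  c ^+ 2 + s ^+ 2 = 1 ->
  asdual (c *: a + s *: t) (s *: a - c *: t) = - asdual a t.
Proof.
move=> /eqP; rewrite dotp4 => /eqP ha /eqP; rewrite dotp4 => /eqP ht /eqP.
rewrite dotp4 => /eqP hat hcs.
have e0 : asdual (c *: a + s *: t) (s *: a - c *: t) =
   (c * s * dotp a a - c * s * dotp t t + s ^+ 2 *+ 2 * dotp a t) *: qone
   - (c ^+ 2 + s ^+ 2) *: asdual a t.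
  rewrite !dotp4 /asdual; qring.
by rewrite e0 !dotp4 ha ht hat hcs scale1r !mulr1 mulr0 addr0 subrr scale0r
  add0r.
Qed.

Lemma unit_eq_sub0 (p v : 'rV[R]_4) :
  dotp p p = 1 -> dotp v v = 1 -> 1 - dotp p v = 0 -> v = p.
Proof. by move=> hp hv h; rewrite (@unit_eq _ _ p v) //; lra. Qed.

(** In a 3-space a Gram determinant of two triples is the product of their
   volumes. *)
Lemma gram3_mixed (p q u v : 'rV[R]_4) :
  p.<0> = 0 -> q.<0> = 0 -> u.<0> = 0 -> v.<0> = 0 ->
  let g a b c d e f :=
    dotp a d * (dotp b e * dotp c f - dotp b f * dotp c e)
    - dotp a e * (dotp b d * dotp c f - dotp b f * dotp c d)
    + dotp a f * (dotp b d * dotp c e - dotp b e * dotp c d) in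
  g p q u p q v ^+ 2 = g p q u p q u * g p q v p q v.
Proof.
move=> p0 q0 u0 v0 /=.
pose D (a b c : 'rV[R]_4) := a.<1> * (b.<2> * c.<3> - b.<3> * c.<2>)
  - a.<2> * (b.<1> * c.<3> - b.<3> * c.<1>)
  + a.<3> * (b.<1> * c.<2> - b.<2> * c.<1>).
have gram (a b c d e f : 'rV[R]_4) : a.<0> = 0 -> b.<0> = 0 -> c.<0> = 0 ->
    dotp a d * (dotp b e * dotp c f - dotp b f * dotp c e)
    - dotp a e * (dotp b d * dotp c f - dotp b f * dotp c d)
    + dotp a f * (dotp b d * dotp c e - dotp b e * dotp c d)
    = D a b c * D d e f.
  move=> a0 b0 c0; rewrite !dotp4 a0 b0 c0 /D; ring.
by rewrite !gram //; ring.
Qed.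

(** Two rows [p, q, -p-q] and [u, v, -u-v] of a 3 by 3 array of unit vectors of
   a euclidean 3-space, all of whose lines balance. With [x] the product of [p]
   and [v] and [y] that of [q] and [u], one has [x + y = 1 / 2], and the identity
   [gram3_mixed] for the four vectors becomes [(1 - x)^2 * (1 - y)^2 = 0]. *)
Lemma balanced_rows (p q u v : 'rV[R]_4) :
  p.<0> = 0 -> q.<0> = 0 -> u.<0> = 0 -> v.<0> = 0 ->
  dotp p p = 1 -> dotp q q = 1 -> dotp u u = 1 -> dotp v v = 1 ->
  dotp p q = - 2^-1 -> dotp u v = - 2^-1 -> dotp p u = - 2^-1 ->
  dotp q v = - 2^-1 -> dotp p v + dotp q u = 2^-1 -> v = p \/ u = q.
Proof.
move=> p0 q0 u0 v0 pp qq uu vv pq uv pu qv xy.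
have := gram3_mixed p0 q0 u0 v0; cbv zeta beta.
rewrite pp qq uu vv pq pu qv (dotpC q p) pq (dotpC u p) pu uv (dotpC u q).
rewrite (dotpC v p) (dotpC v q) qv.
have -> : dotp q u = 2^-1 - dotp p v by lra.
set x := dotp p v => h.
have : ((1 - x) * (x + 2^-1)) ^+ 2 = 0 by lra.
move=> /eqP; rewrite sqrf_eq0 mulf_eq0 => /orP[/eqP h1|/eqP h1].
  by left; apply: unit_eq_sub0.
by right; apply: unit_eq_sub0 => //; rewrite /x in h1; lra.
Qed.

End Quaternion.

(** * Balanced arrays of imaginary quaternions *)

Section Rigidity.
Variable R : realType.
Local Notation V := 'rV[R]_4.

Lemma unit_sum0_dotp n (a b c : 'rV[R]_n) :
  dotp a a = 1 -> dotp b b = 1 -> dotp c c = 1 -> a + b + c = 0 ->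
  dotp a b = - 2^-1.
Proof.
move=> aa bb cc /eqP; rewrite addr_eq0 => /eqP h.
have : dotp (a + b) (a + b) = dotp c c by rewrite h dotpNl dotpNr opprK.
by rewrite dotpDl !dotpDr aa bb cc (dotpC b a); lra.
Qed.

Lemma sum0_third n (a b c : 'rV[R]_n) : a + b + c = 0 -> c = - (a + b).
Proof. by move=> /eqP; rewrite addrC addr_eq0 => /eqP. Qed.

(** The dichotomy of [balanced_rows] spread over a whole array whose rows and
   columns balance: either it is constant along the diagonals or along the
   antidiagonals. *)
Lemma balanced_array (n : 'I_3 -> 'I_3 -> V) :
  (forall i j, (n i j) 0 (inord 0) = 0) ->
  (forall i j, dotp (n i j) (n i j) = 1) ->
  (forall i, n i 0 + n i 1 + n i 2 = 0) ->
  (forall j, n 0 j + n 1 j + n 2 j = 0) ->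
  [/\ n 1 1 = n 0 0, n 2 2 = n 0 0, n 1 2 = n 0 1, n 2 0 = n 0 1 &
      (n 1 0 = n 0 2) /\ (n 2 1 = n 0 2)] \/
  [/\ n 1 0 = n 0 1, n 2 2 = n 0 1, n 1 1 = n 0 2, n 2 0 = n 0 2 &
      (n 1 2 = n 0 0) /\ (n 2 1 = n 0 0)].
Proof.
move=> pure U rows cols.
have e02 := sum0_third (rows 0); have e12 := sum0_third (rows 1).
have e20 := sum0_third (cols 0); have e21 := sum0_third (cols 1).
have e22 := sum0_third (cols 2).
have pq := unit_sum0_dotp (U 0 0) (U 0 1) (U 0 2)
  (rows 0).
have uv := unit_sum0_dotp (U 1 0) (U 1 1) (U 1 2)
  (rows 1).
have pu := unit_sum0_dotp (U 0 0) (U 1 0) (U 2 0)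
  (cols 0).
have qv := unit_sum0_dotp (U 0 1) (U 1 1) (U 2 1)
  (cols 1).
have rw := unit_sum0_dotp (U 0 2) (U 1 2) (U 2 2)
  (cols 2).
have diag : dotp (n 0 0) (n 1 1) + dotp (n 0 1) (n 1 0) = 2^-1.
  move: rw; rewrite e02 e12 dotpNl dotpNr opprK dotpDl !dotpDr pu qv; lra.
have [h|h] := balanced_rows (pure 0 0) (pure 0 1)
  (pure 1 0) (pure 1 1) (U 0 0) (U 0 1)
  (U 1 0) (U 1 1) pq uv pu qv diag.
- left; have hu : n 1 0 = n 0 2.
    rewrite e02; apply: sum0_third; apply: sum120 => //; try exact: U.
    by move: diag; rewrite h U //; lra.
  have e (k : 'I_4) := congr1 (fun v : V => v 0 k) e02.
  rewrite e22 e12 e20 e21 h hu.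
  by do ?split; apply/rowP => k;
    have := e k; rewrite !mxE; lra.
- right; have hv : n 1 1 = n 0 2.
    rewrite e02; apply: sum0_third; apply: sum120 => //; try exact: U.
    by move: diag; rewrite h U //; lra.
  have e (k : 'I_4) := congr1 (fun v : V => v 0 k) e02.
  rewrite e22 e12 e20 e21 h hv.
  by do ?split; apply/rowP => k;
    have := e k; rewrite !mxE; lra.
Qed.

Lemma pure_anticomm (x y : V) : x 0 (inord 0) = 0 -> y 0 (inord 0) = 0 ->
  qmul x y + qmul y x = (- (2 * dotp x y)) *: qone R.
Proof.
move=> x0 y0; apply: quat_eqP; rewrite dotp4 [LHS]mxE [RHS]mxE /qmul /qone !quatE x0 y0; ring.
Qed.

Lemma qmul_re (x y : V) : x 0 (inord 0) = 0 -> y 0 (inord 0) = 0 ->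
  dotp (qmul x y) (qone R) = - dotp x y.
Proof.
by move=> x0 y0; rewrite !dotp4 /qmul /qone !quatE x0 y0; ring.
Qed.

(** The imaginary part of [q] is parallel to every imaginary unit that commutes
   with [q], hence to both [n] and [n'], which are not parallel. *)
Lemma pure_commute_real (q n n' : V) :
  n 0 (inord 0) = 0 -> n' 0 (inord 0) = 0 -> dotp n n = 1 -> dotp n' n' = 1 ->
  dotp n n' = - 2^-1 -> qmul q n = qmul n q -> qmul q n' = qmul n' q ->
  q = q 0 (inord 0) *: qone R.
Proof.
pose m : V := quat 0 (q 0 (inord 1)) (q 0 (inord 2)) (q 0 (inord 3)).
have along (k : V) : k 0 (inord 0) = 0 -> dotp k k = 1 ->
    qmul q k = qmul k q -> m = dotp m k *: k.
  move=> k0 kk h.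
  have c i := congr1 (fun v : V => v 0 (inord i)) h.
  have c1 := c 1%N; have c2 := c 2%N; have c3 := c 3%N.
  move: kk c1 c2 c3; rewrite /= /qmul !quatE dotp4 k0.
  set b1 := k 0 (inord 1); set b2 := k 0 (inord 2); set b3 := k 0 (inord 3).
  set a1 := q 0 (inord 1); set a2 := q 0 (inord 2); set a3 := q 0 (inord 3).
  move=> kk c1 c2 c3.
  have e a : a = a * (b1 * b1 + b2 * b2 + b3 * b3).
    by rewrite -[LHS]mulr1 -kk; ring.
  have c1' : a2 * b3 = a3 * b2 by lra.
  have c2' : a3 * b1 = a1 * b3 by lra.
  have c3' : a1 * b2 = a2 * b1 by lra.
  apply: quat_eqP; rewrite [RHS]mxE dotp4 /m !quatE ?k0 -/b1 -/b2 -/b3 -/a1 -/a2 -/a3.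
  - by ring.
  - rewrite [LHS]e.
    have : a1 * b2 * b2 = a2 * b1 * b2 by rewrite c3'.
    have : a3 * b1 * b3 = a1 * b3 * b3 by rewrite c2'.
    lra.
  - rewrite [LHS]e.
    have : a1 * b2 * b1 = a2 * b1 * b1 by rewrite c3'.
    have : a2 * b3 * b3 = a3 * b2 * b3 by rewrite c1'.
    lra.
  - rewrite [LHS]e.
    have : a3 * b1 * b1 = a1 * b3 * b1 by rewrite c2'.
    have : a2 * b3 * b2 = a3 * b2 * b2 by rewrite c1'.
    lra.
move=> n0 n0' nn nn' nn2 h h'.
have e1 := along n n0 nn h; have e2 := along n' n0' nn' h'.
have f1 : dotp m n = dotp m n' * - 2^-1.
  by rewrite {1}e2 dotpZl (dotpC n') nn2.
have f2 : dotp m n' = dotp m n * - 2^-1 by rewrite {1}e1 dotpZl nn2.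
have m0 : m = 0.
  by rewrite e1 (_ : dotp m n = 0) ?scale0r //; lra.
have c k := congr1 (fun v : V => v 0 (inord k)) m0.
have c1 := c 1%N; have c2 := c 2%N; have c3 := c 3%N.
move: c1 c2 c3; rewrite /= /m !quatE ![(0 : V) _ _]mxE => c1 c2 c3.
by apply: quat_eqP; rewrite [RHS]mxE /qone quatE ?(c1, c2, c3)
  ?mulr1 ?mulr0.
Qed.

(** Such an [a] and [b] differ by a quaternion that commutes with [n] and [n'],
   hence by a real number. In geometric terms, two planes given by their
   self-dual and anti-self-dual parts meet in at most one line. *)
Lemma intertwine_unique (a b n n' m m' : V) :
  dotp a a = 1 -> dotp b b = 1 ->
  n 0 (inord 0) = 0 -> n' 0 (inord 0) = 0 -> dotp n n = 1 -> dotp n' n' = 1 ->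
  dotp n n' = - 2^-1 ->
  qmul a n = qmul m a -> qmul a n' = qmul m' a ->
  qmul b n = qmul m b -> qmul b n' = qmul m' b -> b = a \/ b = - a.
Proof.
move=> aa bb n0 n0' nn nn' nn2 an an' bn bn'.
have comm k l : qmul a k = qmul l a -> qmul b k = qmul l b ->
    qmul (qmul (qconj a) b) k = qmul k (qmul (qconj a) b).
  move=> ak bk; rewrite -qmulA bk !qmulA; congr qmul.
  transitivity (qmul (qmul (qconj a) (qmul l a)) (qconj a)).
    by rewrite -!qmulA qmul_conj aa scale1r qmul1r.
  by rewrite -ak qmulA qconj_mul aa scale1r qmul1l.
have := pure_commute_real n0 n0' nn nn' nn2 (comm _ _ an bn) (comm _ _ an' bn').
set r := (qmul _ _) _ _ => e.
have eb : b = r *: a.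
  by rewrite -[a]qmul1r -qmulZr -e qmulA qmul_conj aa scale1r qmul1l.
have /eqP : r ^+ 2 = 1 by rewrite -bb eb dotpZl dotpZr aa; ring.
by rewrite sqrf_eq1 eb => /orP[]/eqP ->; [left|right]; rewrite ?scale1r ?scaleN1r.
Qed.

(** Let [N] and [M] be the imaginary parts of [p * q] and of [y]; that of [q * p]
   is [- N]. Then [a * N = M * a] and [b * N = - M * b]; as right multiplication
   by [N] and left multiplication by [M] are similitudes of the same ratio, the
   inner product of [a] and [b] equals its opposite. *)
Lemma intertwine_orthogonal (a b p q y : V) :
  dotp a a = 1 -> p 0 (inord 0) = 0 -> q 0 (inord 0) = 0 ->
  dotp p p = 1 -> dotp q q = 1 -> dotp p q = - 2^-1 ->
  qmul a (qmul p q) = qmul y a -> qmul b (qmul q p) = qmul y b ->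
  dotp a b = 0.
Proof.
move=> aa p0 q0 pp qq pq ha hb.
have hpq := pure_anticomm p0 q0; rewrite pq in hpq.
pose N := qmul p q - 2^-1 *: qone R; pose M := y - 2^-1 *: qone R.
have NN : dotp N N = 3 / 4.
  rewrite /N dotpDl !dotpDr !dotpNl !dotpNr !dotpZl !dotpZr (dotpC (qone R)).
  by rewrite qmul_re // dotp_qmull pp qq pq dotp4 /qone !quatE; lra.
have aN : qmul a N = qmul M a.
  by rewrite /N /M qmulDl qmulDr ha -!scaleNr qmulZl qmulZr qmul1l qmul1r.
have bN : qmul b N = - qmul M b.
  have -> : N = - (qmul q p - 2^-1 *: qone R).
    apply/rowP => k; have := congr1 (fun v : V => v 0 k) hpq.
    by rewrite !mxE; lra.
  rewrite -scaleN1r qmulZr scaleN1r; congr (- _).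
  by rewrite /M qmulDl qmulDr hb -!scaleNr qmulZl qmulZr qmul1l qmul1r.
have MM : dotp M M = dotp N N.
  have := dotp_qmulr M M a; rewrite -aN dotp_qmull aa; lra.
have := dotp_qmulr a b N; rewrite aN bN dotpNr dotp_qmull MM NN; lra.
Qed.

(** [p * q + q * p] is real, and so are [p * p] and [q * q]; eliminate [r]. *)
Lemma balanced_cycle (p q r : V) :
  p 0 (inord 0) = 0 -> q 0 (inord 0) = 0 -> dotp p p = 1 -> dotp q q = 1 ->
  dotp p q = - 2^-1 -> p + q + r = 0 ->
  qmul q r = qmul p q /\ qmul r p = qmul p q.
Proof.
move=> p0 q0 pp qq pq /sum0_third ->.
have h1 := pure_anticomm p0 q0.
have h2 := pure_anticomm p0 p0; have h3 := pure_anticomm q0 q0.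
rewrite pq in h1; rewrite pp in h2; rewrite qq in h3.
rewrite -scaleN1r qmulZr qmulZl !qmulDr !qmulDl scaleN1r.
split; apply/rowP => k; have := congr1 (fun v : V => v 0 k) h1;
  have := congr1 (fun v : V => v 0 k) h2;
  have := congr1 (fun v : V => v 0 k) h3; rewrite !mxE; lra.
Qed.
End Rigidity.

(** * Orthogonality of the two halves of a K(3,3) network *)

Section Orthogonality.
Variable R : realType.
Local Notation V := 'rV[R]_4.

Lemma ord3_ind (P : 'I_3 -> Prop) : P 0 -> P 1 -> P 2 -> forall i, P i.
Proof.
move=> h0 h1 h2 [[|[|[|//]]] h]; [move: h0|move: h1|move: h2];
  by congr P; apply: val_inj.
Qed.

Variables (A B : 'I_3 -> V) (t s : 'I_3 -> 'I_3 -> V) (c d : 'I_3 -> 'I_3 -> R).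
Hypothesis A_inj : injective A.
Hypothesis A_unit : forall i, dotp (A i) (A i) = 1.
Hypothesis t_unit : forall i j, dotp (t i j) (t i j) = 1.
Hypothesis At : forall i j, dotp (A i) (t i j) = 0.
Hypothesis cd1 : forall i j, c i j ^+ 2 + d i j ^+ 2 = 1.
Hypothesis BE : forall i j, B j = c i j *: A i + d i j *: t i j.
Hypothesis sE : forall i j, s i j = d i j *: A i - c i j *: t i j.
Hypothesis t120 : forall i j k, j != k -> dotp (t i j) (t i k) = - 2^-1.
Hypothesis s120 : forall i k j, i != k -> dotp (s i j) (s k j) = - 2^-1.

Let s_unit i j : dotp (s i j) (s i j) = 1.
Proof.
rewrite sE dotpDl !dotpDr !dotpNl !dotpNr !dotpZl !dotpZr A_unit t_unit.
by rewrite (dotpC (t i j)) At; have := cd1 i j; lra.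
Qed.

Let B_unit (j : 'I_3) : dotp (B j) (B j) = 1.
Proof.
rewrite (BE 0) dotpDl !dotpDr !dotpZl !dotpZr A_unit t_unit.
by rewrite (dotpC (t 0 j)) At; have := cd1 0 j; lra.
Qed.

Let np i j := sdual (A i) (t i j).
Let nm i j := asdual (A i) (t i j).

Let rows i : t i 0 + t i 1 + t i 2 = 0.
Proof. by apply: sum120; rewrite ?t_unit ?t120. Qed.

Let cols j : s 0 j + s 1 j + s 2 j = 0.
Proof. by apply: sum120; rewrite ?s_unit ?s120. Qed.

Let npB i j : sdual (B j) (s i j) = - np i j.
Proof. by rewrite (BE i) sE sdual_reverse. Qed.

Let nmB i j : asdual (B j) (s i j) = - nm i j.
Proof. by rewrite (BE i) sE asdual_reverse. Qed.

Let opp_sum0 (x y z : V) : - x + - y + - z = 0 -> x + y + z = 0.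
Proof. by rewrite -!opprD => /eqP; rewrite oppr_eq0 => /eqP. Qed.

Let np_array := @balanced_array R np.
Let nm_array := @balanced_array R nm.

Let np_rows i : np i 0 + np i 1 + np i 2 = 0.
Proof. by rewrite /np /sdual -!qmulDr rows qmul0r. Qed.

Let nm_rows i : nm i 0 + nm i 1 + nm i 2 = 0.
Proof. by rewrite /nm /asdual -!qmulDl rows qmul0l. Qed.

Let np_cols j : np 0 j + np 1 j + np 2 j = 0.
Proof.
by apply: opp_sum0; rewrite -!npB /sdual -!qmulDr cols qmul0r.
Qed.

Let nm_cols j : nm 0 j + nm 1 j + nm 2 j = 0.
Proof.
by apply: opp_sum0; rewrite -!nmB /asdual -!qmulDl cols qmul0l.
Qed.

Let np0 i j : (np i j) 0 (inord 0) = 0.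
Proof. by rewrite /np sdual_pure At. Qed.
Let nm0 i j : (nm i j) 0 (inord 0) = 0.
Proof. by rewrite /nm asdual_pure At. Qed.
Let np1 i j : dotp (np i j) (np i j) = 1.
Proof. by rewrite /np dotp_sdual A_unit t_unit mulr1. Qed.
Let nm1 i j : dotp (nm i j) (nm i j) = 1.
Proof. by rewrite /nm dotp_asdual A_unit t_unit mulr1. Qed.

(** Both sides are the tangent vector [t i j]. *)
Let twistA i j : qmul (A i) (np i j) = qmul (nm i j) (A i).
Proof. by rewrite sdualK // asdualK. Qed.

Let twistB i j : qmul (B j) (np i j) = qmul (nm i j) (B j).
Proof.
have h1 : - qmul (B j) (np i j) = s i j.
  by rewrite -scaleN1r -qmulZr scaleN1r -npB sdualK.
have h2 : - qmul (nm i j) (B j) = s i j.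
  by rewrite -scaleN1r -qmulZl scaleN1r -nmB asdualK.
by apply: oppr_inj; rewrite h1 h2.
Qed.

Let p01 : dotp (np 0 0) (np 0 1) = - 2^-1.
Proof. exact: unit_sum0_dotp (np_rows 0). Qed.
Let m01 : dotp (nm 0 0) (nm 0 1) = - 2^-1.
Proof. exact: unit_sum0_dotp (nm_rows 0). Qed.

(** If both arrays had the same symmetry, the three vertices [A i] would lie on
   the intersection of the same two planes, which holds only two unit vectors. *)
Let same_symmetry :
  (forall i, qmul (A i) (np 0 0) = qmul (nm 0 0) (A i)) ->
  (forall i, qmul (A i) (np 0 1) = qmul (nm 0 1) (A i)) -> False.
Proof.
move=> h0 h1.
have u i : A i = A 0 \/ A i = - A 0.
  exact: (intertwine_unique (A_unit 0) (A_unit i) (np0 0 0) (np0 0 1)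
    (np1 0 0) (np1 0 1) p01 (h0 0) (h1 0) (h0 i) (h1 i)).
have [/A_inj//|u1] := u 1; have [/A_inj//|u2] := u 2.
by have /A_inj : A 1 = A 2 by rewrite u1 u2.
Qed.

Let cyc := balanced_cycle (nm0 0 0) (nm0 0 1) (nm1 0 0) (nm1 0 1) m01 (nm_rows 0).

Let orth i j y : qmul (A i) (qmul (np 0 0) (np 0 1)) = qmul y (A i) ->
  qmul (B j) (qmul (np 0 1) (np 0 0)) = qmul y (B j) -> dotp (A i) (B j) = 0.
Proof. exact: intertwine_orthogonal. Qed.

Let twist_mul (a p q m m' : V) : qmul a p = qmul m a -> qmul a q = qmul m' a ->
  qmul a (qmul p q) = qmul (qmul m m') a.
Proof. by move=> h h'; rewrite qmulA h -qmulA h' qmulA. Qed.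

(** The planes of the nine arcs, oriented from the [A] side, have self-dual parts
   [np] and anti-self-dual parts [nm]. The rows of these arrays balance because
   of the 120 degree condition at the vertices [A i]; so do their columns,
   because of the condition at the vertices [B j], seen from which the planes
   have the opposite orientation. By [balanced_array], each of the two arrays is
   constant along the diagonals or along the antidiagonals; the same symmetry
   for both is excluded by [same_symmetry], and opposite symmetries give the
   hypotheses of [intertwine_orthogonal]. *)
Lemma net_orthogonal i j : dotp (A i) (B j) = 0.
Proof.
case: cyc => m12 m20.
suff [hA hB] :
    (forall i, qmul (A i) (qmul (np 0 0) (np 0 1))
       = qmul (qmul (nm 0 0) (nm 0 1)) (A i)) /\
    (forall j, qmul (B j) (qmul (np 0 1) (np 0 0))
       = qmul (qmul (nm 0 0) (nm 0 1)) (B j)) by exact: orth.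
have [] := np_array np0 np1 np_rows np_cols;
have [] := nm_array nm0 nm1 nm_rows nm_cols.
- move=> [m11 m22 m_12 m_20 _] [p11 p22 p12 p20 _].
  exfalso; apply: same_symmetry; apply: ord3_ind.
  + exact: (twistA 0 0).
  + by have := twistA 1 1; rewrite p11 m11.
  + by have := twistA 2 2; rewrite p22 m22.
  + exact: (twistA 0 1).
  + by have := twistA 1 2; rewrite p12 m_12.
  + by have := twistA 2 0; rewrite p20 m_20.
- move=> [m10 m22 m11 m_20 [m_12 m21]] [p11 p22 p12 p20 [p10 p21]].
  split; apply: ord3_ind.
  + exact: (twist_mul (twistA 0 0) (twistA 0 1)).
  + by have := twist_mul (twistA 1 1) (twistA 1 2); rewrite p11 p12 m11 m_12 m20.
  + by have := twist_mul (twistA 2 2) (twistA 2 0); rewrite p22 p20 m22 m_20 m12.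
  + by have := twist_mul (twistB 2 0) (twistB 0 0); rewrite p20 m_20 m20.
  + by have := twist_mul (twistB 0 1) (twistB 1 1); rewrite p11 m11 m12.
  + by have := twist_mul (twistB 1 2) (twistB 2 2); rewrite p12 p22 m_12 m22.
- move=> [m11 m22 m_12 m_20 [m10 m21]] [p10 p22 p11 p20 [p12 p21]].
  split; apply: ord3_ind.
  + exact: (twist_mul (twistA 0 0) (twistA 0 1)).
  + by have := twist_mul (twistA 1 2) (twistA 1 0); rewrite p12 p10 m_12 m10 m12.
  + by have := twist_mul (twistA 2 1) (twistA 2 2); rewrite p21 p22 m21 m22 m20.
  + by have := twist_mul (twistB 1 0) (twistB 0 0); rewrite p10 m10 m20.
  + by have := twist_mul (twistB 0 1) (twistB 2 1); rewrite p21 m21 m12.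
  + by have := twist_mul (twistB 2 2) (twistB 1 2); rewrite p22 p12 m_12 m22.
- move=> [m10 m22 m11 m_20 [m_12 m21]] [p10 p22 p11 p20 [p12 p21]].
  exfalso; apply: same_symmetry; apply: ord3_ind.
  + exact: (twistA 0 0).
  + by have := twistA 1 2; rewrite p12 m_12.
  + by have := twistA 2 1; rewrite p21 m21.
  + exact: (twistA 0 1).
  + by have := twistA 1 0; rewrite p10 m10.
  + by have := twistA 2 2; rewrite p22 m22.
Qed.
End Orthogonality.

(** * Continuity on a set *)

Section ContOn.

(** Continuity of the restriction of [f] to [A], pointwise, so that the
   limit theorems apply directly. *)
Definition cont_on (T U : topologicalType) (A : set T) (f : T -> U) :=
  forall x, A x -> f @ within A (nbhs x) --> f x.

Lemma cont_onP (T U : topologicalType) (A : set T) (f : T -> U) :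
  {within A, continuous f} <-> cont_on A f.
Proof. exact: subspace_continuousP. Qed.

Lemma cont_on_sub (T U : topologicalType) (A B : set T) (f : T -> U) :
  A `<=` B -> cont_on B f -> cont_on A f.
Proof.
move=> AB h x Ax; apply: cvg_trans (h x (AB x Ax)).
move=> P; rewrite /= !nbhs_simpl /within /= => hP.
by apply: filterS hP => y /= hy /AB; exact: hy.
Qed.

Lemma continuous_cont_on (T U : topologicalType) (A : set T) (f : T -> U) :
  continuous f -> cont_on A f.
Proof. by move=> h x Ax; apply: cvg_within_filter; apply: h. Qed.

Lemma cont_on_comp (T U W : topologicalType) (A : set T) (B : set U)
    (f : T -> U) (g : U -> W) :
  (forall x, A x -> B (f x)) -> cont_on A f -> cont_on B g ->
  cont_on A (g \o f).
Proof.
move=> AB hf hg x Ax P /(hg _ (AB x Ax)) hP.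
have := hf x Ax _ hP; rewrite /= !nbhs_simpl /within /=.
move=> h; apply: filterS h => y /= h Ay; exact: h (AB y Ay).
Qed.

Lemma cont_on_eq (T U : topologicalType) (A : set T) (f g : T -> U) :
  (forall x, A x -> f x = g x) -> cont_on A f -> cont_on A g.
Proof.
move=> fg h x Ax; rewrite -(fg x Ax); apply: cvg_trans (h x Ax).
by apply: fmap_within_eq => y /set_mem /fg.
Qed.

Section Real.
Variables (R : realType) (T : topologicalType) (A : set T).
Implicit Types f g : T -> R.

Lemma cont_on_cst (U : topologicalType) (c : U) : cont_on A (fun=> c).
Proof. by move=> x Ax; exact: cvg_cst. Qed.

Lemma cont_onD f g : cont_on A f -> cont_on A g -> cont_on A (fun x => f x + g x).
Proof. by move=> hf hg x Ax; apply: cvgD; [exact: hf|exact: hg]. Qed.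

Lemma cont_onN f : cont_on A f -> cont_on A (fun x => - f x).
Proof. by move=> hf x Ax; apply: cvgN; exact: hf. Qed.

Lemma cont_onB f g : cont_on A f -> cont_on A g -> cont_on A (fun x => f x - g x).
Proof. by move=> hf hg; apply: cont_onD => //; exact: cont_onN. Qed.

Lemma cont_onM f g : cont_on A f -> cont_on A g -> cont_on A (fun x => f x * g x).
Proof. by move=> hf hg x Ax; apply: cvgM; [exact: hf|exact: hg]. Qed.

Lemma cont_onV f : (forall x, A x -> f x != 0) -> cont_on A f ->
  cont_on A (fun x => (f x)^-1).
Proof. by move=> h0 hf x Ax; apply: cvgV; [exact: h0|exact: hf]. Qed.

Lemma cont_on_sqrt f : cont_on A f -> cont_on A (fun x => Num.sqrt (f x)).
Proof.
by move=> hf x Ax; apply: continuous_cvg (hf x Ax); exact: sqrt_continuous.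
Qed.

Lemma cont_on_norm f : cont_on A f -> cont_on A (fun x => `|f x|).
Proof. by move=> hf x Ax; apply: cvg_norm; exact: hf. Qed.

Lemma cont_on_min f g : cont_on A f -> cont_on A g ->
  cont_on A (fun x => Num.min (f x) (g x)).
Proof.
move=> hf hg; apply: (@cont_on_eq _ _ _
  (fun x => (f x + g x - `|f x - g x|) / 2)) => [x _|]; first by rewrite minr_absE.
apply: cont_onM; last exact: cont_on_cst.
by apply: cont_onB; [exact: cont_onD|apply: cont_on_norm; exact: cont_onB].
Qed.

Lemma cont_on_max f g : cont_on A f -> cont_on A g ->
  cont_on A (fun x => Num.max (f x) (g x)).
Proof.
move=> hf hg; apply: (@cont_on_eq _ _ _
  (fun x => (f x + g x + `|f x - g x|) / 2)) => [x _|]; first by rewrite maxr_absE.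
apply: cont_onM; last exact: cont_on_cst.
by apply: cont_onD; [exact: cont_onD|apply: cont_on_norm; exact: cont_onB].
Qed.

Variable n : nat.
Implicit Types F G : T -> 'rV[R]_n.

Lemma cont_on_vecD F G : cont_on A F -> cont_on A G ->
  cont_on A (fun x => F x + G x).
Proof. by move=> hf hg x Ax; apply: cvgD; [exact: hf|exact: hg]. Qed.

Lemma cont_on_vecB F G : cont_on A F -> cont_on A G ->
  cont_on A (fun x => F x - G x).
Proof. by move=> hf hg x Ax; apply: cvgB; [exact: hf|exact: hg]. Qed.

Lemma cont_onZ f F : cont_on A f -> cont_on A F -> cont_on A (fun x => f x *: F x).
Proof. by move=> hf hg x Ax; apply: cvgZ; [exact: hf|exact: hg]. Qed.

Lemma cont_on_coord F i : cont_on A F -> cont_on A (fun x => F x 0 i).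
Proof.
move=> hF.
apply: (@cont_on_comp _ _ _ A setT F (fun M : 'rV[R]_n => M 0 i)) => //.
by apply: continuous_cont_on; exact: coord_continuous.
Qed.

Lemma cont_on_sum (I : Type) (r : seq I) (H : I -> T -> R) :
  (forall i, cont_on A (H i)) -> cont_on A (fun x => \sum_(i <- r) H i x).
Proof.
move=> h; elim: r => [|i r IH].
  apply: (@cont_on_eq _ _ A (fun=> 0)) => [x _|]; first by rewrite big_nil.
  exact: cont_on_cst.
apply: (@cont_on_eq _ _ A (fun x => H i x + \sum_(j <- r) H j x)) => [x _|].
  by rewrite big_cons.
exact: cont_onD.
Qed.

Lemma cont_on_dotp F G : cont_on A F -> cont_on A G ->
  cont_on A (fun x => dotp (F x) (G x)).
Proof.
move=> hF hG; apply: cont_on_sum => i.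
by apply: cont_onM; exact: cont_on_coord.
Qed.

Lemma cont_on_enorm F : cont_on A F -> cont_on A (fun x => enorm (F x)).
Proof. by move=> hF; apply: cont_on_sqrt; exact: cont_on_dotp. Qed.

Lemma cont_on_pair (U V : topologicalType) (f : T -> U) (g : T -> V) :
  cont_on A f -> cont_on A g -> cont_on A (fun x => (f x, g x)).
Proof. by move=> hf hg x Ax; apply: cvg_pair; [exact: hf|exact: hg]. Qed.

End Real.

Lemma cont_on_id (T : topologicalType) (A : set T) : cont_on A id.
Proof. by move=> x Ax; apply: cvg_within. Qed.

Lemma coord_le_enorm (R : realType) n (x : 'rV[R]_n) i : `|x 0 i| <= enorm x.
Proof.
rewrite -sqrtr_sqr ler_wsqrtr // /dotp (bigD1 i) //= -expr2 lerDl.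
by apply: sumr_ge0 => j _; rewrite -expr2 sqr_ge0.
Qed.

(** The euclidean balls form a basis of the topology, although the latter is
   defined by the sup norm. *)
Lemma near_enormP (R : realType) n (x : 'rV[R]_n) (P : set 'rV[R]_n) :
  nbhs x P <-> exists2 d : R, 0 < d & forall y, enorm (y - x) < d -> P y.
Proof.
split=> [/nbhs_ballP [d /= d0 h]|[d d0 h]].
  exists d => // y yx; apply: h; split=> // i j.
  rewrite /ball /= distrC; apply: le_lt_trans yx.
  by rewrite ord1; have := coord_le_enorm (y - x) j; rewrite !mxE.
have : cont_on setT (fun y : 'rV[R]_n => enorm (y - x)).
  by apply: cont_on_enorm; apply: cont_on_vecB; [exact: cont_on_id|exact: cont_on_cst].
move=> /(_ x I) /cvgrPdist_lt /(_ d d0); rewrite near_withinE.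
apply: filterS => y /(_ I).
rewrite /= subrr enorm0 sub0r normrN ger0_norm ?enorm_ge0 //.
exact: h.
Qed.

Lemma cont_on_epsP (R : realType) m n (A : set 'rV[R]_m) (f : 'rV[R]_m -> 'rV[R]_n)
    x (e : R) : cont_on A f -> A x -> 0 < e ->
  exists2 d : R, 0 < d &
    forall y, A y -> enorm (y - x) < d -> enorm (f y - f x) < e.
Proof.
move=> hf Ax e0.
have : nbhs (f x) [set z | enorm (z - f x) < e] by apply/near_enormP; exists e.
move=> /(hf x Ax); rewrite /= /within /= => /near_enormP [d d0 h].
by exists d => // y Ay yd; apply: h.
Qed.

End ContOn.

(** * Square roots of circle-valued maps *)

Section SquareRoot.
Variable R : realType.

(** [(a, b)] is a complex square root of [(p, q)]. *)
Definition csqrt_of (a b p q : R) := a ^+ 2 - b ^+ 2 = p /\ 2 * a * b = q.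

Lemma csqrt_unit (a b p q : R) : csqrt_of a b p q -> p ^+ 2 + q ^+ 2 = 1 ->
  a ^+ 2 + b ^+ 2 = 1.
Proof.
move=> [<- <-] h.
have : (a ^+ 2 + b ^+ 2) ^+ 2 = 1 by rewrite -h; ring.
move/eqP; rewrite sqrf_eq1 => /orP[/eqP //|/eqP e].
by have := addr_ge0 (sqr_ge0 a) (sqr_ge0 b); rewrite e; lra.
Qed.

(** For unit complex numbers [w] and [w'] that are not opposite,
   [(w + w')^2 = w * w' * |w + w'|^2]. So if [s] is a square root of [w], the
   conjugate of [s] times the unit vector along [w + w'] is one of [w']. *)
Lemma csqrt_step (p q p' q' a b : R) :
  p ^+ 2 + q ^+ 2 = 1 -> p' ^+ 2 + q' ^+ 2 = 1 ->
  0 < p * p' + q * q' -> csqrt_of a b p q ->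
  let m := Num.sqrt ((p + p') ^+ 2 + (q + q') ^+ 2) in
  csqrt_of (((p + p') * a + (q + q') * b) / m)
           (((q + q') * a - (p + p') * b) / m) p' q'.
Proof.
move=> h h' d [ap bq] m.
have s0 : 0 < (p + p') ^+ 2 + (q + q') ^+ 2 by lra.
have mm : m ^+ 2 = (p + p') ^+ 2 + (q + q') ^+ 2 by rewrite sqr_sqrtr // ltW.
have m0 : m != 0 by rewrite gt_eqF // sqrtr_gt0.
have mm0 : m ^+ 2 != 0 by rewrite expf_neq0.
split.
- apply: (mulIf mm0); rewrite mulrBl !expr_div_n !divfK // mm.
  have -> : ((p + p') * a + (q + q') * b) ^+ 2
      - ((q + q') * a - (p + p') * b) ^+ 2 =
    ((p + p') ^+ 2 - (q + q') ^+ 2) * (a ^+ 2 - b ^+ 2)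
    + 2 * (p + p') * (q + q') * (2 * a * b) by ring.
  rewrite ap bq.
  have -> : ((p + p') ^+ 2 - (q + q') ^+ 2) * p + 2 * (p + p') * (q + q') * q
    = p' * ((p + p') ^+ 2 + (q + q') ^+ 2)
    + (p + p') * (p ^+ 2 + q ^+ 2 - (p' ^+ 2 + q' ^+ 2))
     by ring.
  by rewrite h h' subrr mulr0 addr0.
- apply: (mulIf mm0).
  have -> : 2 * (((p + p') * a + (q + q') * b) / m) *
      (((q + q') * a - (p + p') * b) / m) * m ^+ 2 =
    2 * (p + p') * (q + q') * (a ^+ 2 - b ^+ 2)
    - ((p + p') ^+ 2 - (q + q') ^+ 2) * (2 * a * b) by field.
  rewrite ap bq mm.
  have -> : 2 * (p + p') * (q + q') * p - ((p + p') ^+ 2 - (q + q') ^+ 2) * q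
    = q' * ((p + p') ^+ 2 + (q + q') ^+ 2)
    + (q + q') * (p ^+ 2 + q ^+ 2 - (p' ^+ 2 + q' ^+ 2)) by ring.
  by rewrite h h' subrr mulr0 addr0.
Qed.

Section Homotopy.
Variables (T : topologicalType) (K : set T) (w1 w2 : R * T -> R).
Hypothesis K_compact : compact K.
Hypothesis w1_cont : continuous w1.
Hypothesis w2_cont : continuous w2.
Hypothesis w_unit : forall z, w1 z ^+ 2 + w2 z ^+ 2 = 1.

Let close (t t' : R) (x : T) :=
  0 < w1 (t, x) * w1 (t', x) + w2 (t, x) * w2 (t', x).

(** Uniform continuity in the time variable, from the compactness of
   [[0, 1] * K]. *)
Lemma homotopy_uniform : exists2 d : R, 0 < d &
  forall t t' x, 0 <= t <= 1 -> K x -> `|t' - t| < d -> close t t' x.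
Proof.
have cK : compact (`[0, 1] `*` K : set (R * T)).
  by apply: compact_setX => //; exact: segment_compact.
pose P (d : R) (z : R * T) := forall t', `|t' - z.1| < d -> close z.1 t' z.2.
suff hP : \forall d \near (0 : R)^'+, (`[0, 1] `*` K : set (R * T)) `<=` P d.
  have [d [d0 hd]] := filter_ex (filterI (nbhs_right_gt (0 : R)) hP).
  exists d => // t t' x t01 Kx; apply: (hd (t, x)).
  by split; rewrite //= in_itv.
apply: ((@compact_near_coveringP _ _).1 cK R (0^'+) P).
move=> [t0 x0] [/= _ Kx0].
  pose g z := w1 z * w1 (t0, x0) + w2 z * w2 (t0, x0).
  have g_cont : g z @[z --> (t0, x0)] --> (1 : R).
    rewrite -[X in _ --> X](w_unit (t0, x0)) !expr2.
    by apply: cvgD; apply: cvgM; [exact: w1_cont|exact: cvg_cst|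
      exact: w2_cont|exact: cvg_cst].
  have /cvgrPdist_lt /(_ 4^-1) := g_cont.
  have e4 : 0 < 4^-1 :> R by lra.
  move=> /(_ e4) [[/= U V] [/nbhs_ballP [e /= e0 hU] hV] UV].
  exists ([set z : R * T | ball t0 (e / 2) z.1 /\ V z.2], [set d : R | d < e / 2]).
    split=> /=.
      exists (ball t0 (e / 2), V); last by move=> [].
      by split=> //=; apply: nbhsx_ballx; lra.
    by apply: nbhs_right_lt; lra.
  move=> [[t x] d] [/= [tt0 Vx] de] t' /= t't.
  have gz s : `|s - t0| < e -> 3 / 4 < g (s, x).
    move=> st0; have : `|1 - g (s, x)| < 4^-1.
      apply: (UV (s, x)); split=> //=; apply: hU; rewrite /ball /=.
      by rewrite distrC.
    by rewrite ltr_norml => /andP[h1 h2]; lra.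
  move: tt0; rewrite /ball /= distrC => tt0.
  have h1 : 3 / 4 < g (t, x) by apply: gz; lra.
  have h2 : 3 / 4 < g (t', x).
    apply: gz; have := ler_normD (t' - t) (t - t0); rewrite addrA subrK; lra.
  rewrite /close; move: h1 h2 (w_unit (t0, x0)) (w_unit (t, x)) (w_unit (t', x)).
  rewrite /g; set a := w1 (t, x); set b := w2 (t, x).
  set a' := w1 (t', x); set b' := w2 (t', x).
  set c := w1 _; set c' := w2 _ => h1 h2 u0 u1 u2.
  have := sqr_ge0 (a + a' - 2 * c); have := sqr_ge0 (b + b' - 2 * c'); lra.
Qed.

(** Lifting through the squaring map along a homotopy: by uniform continuity
   finitely many applications of [csqrt_step] lead from time 0 to time 1. *)
Lemma csqrt_lift (s1 s2 : T -> R) : cont_on K s1 -> cont_on K s2 ->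
  (forall x, K x -> csqrt_of (s1 x) (s2 x) (w1 (0, x)) (w2 (0, x))) ->
  exists a b : T -> R, [/\ cont_on K a, cont_on K b &
    forall x, K x -> csqrt_of (a x) (b x) (w1 (1, x)) (w2 (1, x))].
Proof.
move=> hs1 hs2 hs; have [d d0 hd] := homotopy_uniform.
pose N := Num.bound d^-1; pose tk k : R := k%:R / N.+1%:R.
have N0 : 0 < N.+1%:R :> R by rewrite ltr0n.
have Nd : N.+1%:R^-1 < d.
  rewrite invf_plt ?posrE //; apply: lt_le_trans (archi_boundP _) _.
    by rewrite invr_ge0 ltW.
  by rewrite ler_nat.
have tkS k : tk k.+1 - tk k = N.+1%:R^-1.
  by rewrite /tk -mulrBl -natrB // subSnn mul1r.
have wc (w : R * T -> R) t : continuous w -> cont_on K (fun x => w (t, x)).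
  move=> hw; apply: (@cont_on_comp _ _ _ K setT (fun x => (t, x)) w) => //.
    by apply: cont_on_pair; [exact: cont_on_cst|exact: cont_on_id].
  exact: continuous_cont_on.
suff H k : (k <= N.+1)%N -> exists a b : T -> R, [/\ cont_on K a, cont_on K b &
    forall x, K x -> csqrt_of (a x) (b x) (w1 (tk k, x)) (w2 (tk k, x))].
  have [a [b [ha hb hab]]] := H _ (leqnn N.+1).
  exists a, b; split=> // x /hab; rewrite /tk divff ?gt_eqF //.
elim: k => [_|k IH kN]; first by exists s1, s2; rewrite /tk mul0r.
have [a [b [ha hb hab]]] := IH (ltnW kN).
have tk01 : 0 <= tk k <= 1.
  by rewrite divr_ge0 ?ler0n //= ler_pdivrMr // mul1r ler_nat ltnW.
have cl x : K x -> close (tk k) (tk k.+1) x.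
  by move=> Kx; apply: hd => //; rewrite tkS ger0_norm // invr_ge0 ltW.
pose p x := w1 (tk k, x); pose q x := w2 (tk k, x).
pose p' x := w1 (tk k.+1, x); pose q' x := w2 (tk k.+1, x).
have hp : cont_on K p by exact: wc. have hq : cont_on K q by exact: wc.
have hp' : cont_on K p' by exact: wc. have hq' : cont_on K q' by exact: wc.
pose m x := Num.sqrt ((p x + p' x) ^+ 2 + (q x + q' x) ^+ 2).
have hP := cont_onD hp hp'; have hQ := cont_onD hq hq'.
have hm : cont_on K (fun x => (m x)^-1).
  apply: cont_onV => [x Kx|].
    rewrite gt_eqF // sqrtr_gt0.
    have := cl x Kx; rewrite /close -/(p x) -/(p' x) -/(q x) -/(q' x).
    by have := w_unit (tk k, x); have := w_unit (tk k.+1, x);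
      rewrite -/(p x) -/(p' x) -/(q x) -/(q' x); lra.
  by apply: cont_on_sqrt; apply: cont_onD; apply: cont_onM.
exists (fun x => ((p x + p' x) * a x + (q x + q' x) * b x) / m x).
exists (fun x => ((q x + q' x) * a x - (p x + p' x) * b x) / m x).
split.
- by apply: cont_onM hm; apply: cont_onD; apply: cont_onM.
- by apply: cont_onM hm; apply: cont_onB; apply: cont_onM.
- by move=> x Kx; apply: csqrt_step; [exact: w_unit|exact: w_unit|
    exact: cl|exact: hab].
Qed.

End Homotopy.
End SquareRoot.

Section Annulus.
Variable R : realType.

Lemma cont_onT (T U : topologicalType) (f : T -> U) : cont_on setT f -> continuous f.
Proof.
move=> h x P hP; have := h x I P hP; rewrite /= !nbhs_simpl /within /=.
by apply: filterS => y; exact.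
Qed.

(** The form of the intermediate value theorem used to propagate signs. *)
Lemma ivt_sign (g : R -> R) (a b : R) : a <= b ->
  cont_on [set t | a <= t <= b] g -> (forall t, a <= t <= b -> g t != 0) ->
  0 < g a * g b.
Proof.
move=> ab cg g0.
have cg' : {within `[a, b], continuous g}.
  by apply/cont_onP; apply: cont_on_sub cg => t /=; rewrite in_itv.
have ga : g a != 0 by apply: g0; rewrite lexx.
have gb : g b != 0 by apply: g0; rewrite lexx andbT.
rewrite ltNge; apply/negP => h.
have [|c cab /eqP] := @IVT _ g a b 0 ab cg'; last first.
  by apply/negP; apply: g0; rewrite in_itv in cab.
rewrite ge_min le_max.
have [ga'|ga'|ga'] := ltgtP (g a) 0.
- by rewrite nmulr_rle0 // in h; rewrite h orbT.
- by rewrite pmulr_rle0 // in h; rewrite h.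
- by rewrite ga' eqxx in ga.
Qed.

Lemma csqrt_exists (p q : R) : p ^+ 2 + q ^+ 2 = 1 -> exists a b, csqrt_of a b p q.
Proof.
move=> h.
have hp : 0 <= (1 + p) / 2 by have := sqr_ge0 q; nra.
have hn : 0 <= (1 - p) / 2 by have := sqr_ge0 q; nra.
have hm : 2 * Num.sqrt ((1 + p) / 2) * Num.sqrt ((1 - p) / 2) = `|q|.
  rewrite -mulrA -sqrtrM // -[RHS]sqrtr_sqr.
  have -> : q ^+ 2 = 2 ^+ 2 * ((1 + p) / 2 * ((1 - p) / 2)) by lra.
  by rewrite [RHS]sqrtrM ?sqr_ge0 // sqrtr_sqr ger0_norm.
have [q0|q0] := leP 0 q.
  exists (Num.sqrt ((1 + p) / 2)), (Num.sqrt ((1 - p) / 2)).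
  by split; rewrite ?sqr_sqrtr // ?hm ?ger0_norm //; lra.
exists (Num.sqrt ((1 + p) / 2)), (- Num.sqrt ((1 - p) / 2)).
split; rewrite ?sqrrN ?sqr_sqrtr //; first lra.
by rewrite mulrN hm ltr0_norm // opprK.
Qed.

(** Contract the square to its center. *)
Lemma square_csqrt (w1 w2 : R * R -> R) (M : R) :
  continuous w1 -> continuous w2 -> (forall z, w1 z ^+ 2 + w2 z ^+ 2 = 1) ->
  let K := [set z : R * R | - M <= z.1 <= M /\ - M <= z.2 <= M] in
  exists a b : R * R -> R, [/\ cont_on K a, cont_on K b &
    forall z, K z -> csqrt_of (a z) (b z) (w1 z) (w2 z)].
Proof.
move=> c1 c2 hu K.
have cK : compact K.
  have -> : K = `[- M, M] `*` `[- M, M].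
    by apply/seteqP; split=> z /=; rewrite !in_itv.
  by apply: compact_setX; exact: segment_compact.
pose H (t : R * (R * R)) : R * R := (t.1 * t.2.1, t.1 * t.2.2).
have cH : continuous H.
  apply: cont_onT; apply: cont_on_pair; apply: cont_onM;
    try (by apply: continuous_cont_on => z; exact: cvg_fst);
  apply: (@cont_on_comp _ _ _ _ setT snd) => //; apply: continuous_cont_on => z;
    by [exact: cvg_snd|exact: cvg_fst].
have [a0 [b0 ab0]] := csqrt_exists (hu (0, 0)).
have [] := @csqrt_lift R _ K (w1 \o H) (w2 \o H) cK _ _ _ (fun=> a0) (fun=> b0).
- by move=> t; apply: continuous_comp; [exact: cH|exact: c1].
- by move=> t; apply: continuous_comp; [exact: cH|exact: c2].
- by move=> z; exact: hu.
- exact: cont_on_cst.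
- exact: cont_on_cst.
- by move=> x _; rewrite /H /= !mul0r.
move=> a [b [ca cb hab]]; exists a, b; split=> // z /hab.
by rewrite /H /= !mul1r -surjective_pairing.
Qed.

(** The inner product of two square roots tells whether they are equal or
   opposite. *)
Lemma csqrt_uniq (a b a' b' p q : R) : p ^+ 2 + q ^+ 2 = 1 ->
  csqrt_of a b p q -> csqrt_of a' b' p q ->
  (a * a' + b * b' == 1) || (a * a' + b * b' == -1).
Proof.
move=> h e e'; have u := csqrt_unit e h; have u' := csqrt_unit e' h.
rewrite -sqrf_eq1; apply/eqP; move: e e' => [e1 e2] [e1' e2'].
have ea : a ^+ 2 = a' ^+ 2 by lra.
have eb : b ^+ 2 = b' ^+ 2 by lra.
have eab : a * b = a' * b' by lra.
have -> : (a * a' + b * b') ^+ 2 =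
  a ^+ 2 * a' ^+ 2 + b ^+ 2 * b' ^+ 2 + 2 * (a * b) * (a' * b') by ring.
rewrite eab ea eb.
have -> : a' ^+ 2 * a' ^+ 2 + b' ^+ 2 * b' ^+ 2 + 2 * (a' * b') * (a' * b')
  = (a' ^+ 2 + b' ^+ 2) ^+ 2 by ring.
by rewrite u' expr1n.
Qed.

Lemma unit_pair_eq (a b a' b' c : R) : c ^+ 2 = 1 ->
  a ^+ 2 + b ^+ 2 = 1 -> a' ^+ 2 + b' ^+ 2 = 1 ->
  a * a' + b * b' = c -> a = c * a' /\ b = c * b'.
Proof.
move=> cc h h' e.
have : (a - c * a') ^+ 2 + (b - c * b') ^+ 2 = 0.
  have -> : (a - c * a') ^+ 2 + (b - c * b') ^+ 2 = a ^+ 2 + b ^+ 2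
    + c ^+ 2 * (a' ^+ 2 + b' ^+ 2) - 2 * c * (a * a' + b * b') by ring.
  by rewrite h h' e; lra.
move/eqP; rewrite paddr_eq0 ?sqr_ge0 // !sqrf_eq0 !subr_eq0.
by move=> /andP[/eqP h1 /eqP h2].
Qed.

(** Pasting along the zero set of [b]. *)
Lemma cont_on_if (T : topologicalType) (A : set T) (b f g : T -> R) :
  cont_on A b -> cont_on A f -> cont_on A g ->
  (forall x, A x -> b x = 0 -> f x = g x) ->
  cont_on A (fun x => if 0 <= b x then f x else g x).
Proof.
move=> cb cf cg fg x Ax P.
have [bx|bx|bx] := ltgtP (b x) 0.
- move=> hP; have hb : nbhs (b x) [set y | y < 0] by exact: lt_nbhsl.
  have h1 := cg x Ax _ hP; have h2 := cb x Ax _ hb.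
  rewrite /= !nbhs_simpl /within /= in h1 h2 *.
  by apply: filterS2 h1 h2 => y /= h k Ay; rewrite leNgt k //=; exact: h.
- move=> hP; have hb : nbhs (b x) [set y | 0 < y] by exact: lt_nbhsr.
  have h1 := cf x Ax _ hP; have h2 := cb x Ax _ hb.
  rewrite /= !nbhs_simpl /within /= in h1 h2 *.
  by apply: filterS2 h1 h2 => y /= h k Ay; rewrite ltW ?k //=; exact: h.
- move=> hP; have hP' := hP; rewrite (fg x Ax bx) in hP'.
  have h1 := cf x Ax _ hP; have h2 := cg x Ax _ hP'.
  rewrite /= !nbhs_simpl /within /= in h1 h2 *.
  by apply: filterS2 h1 h2 => y /= h k Ay; case: ifP => _; [exact: h|exact: k].
Qed.

End Annulus.

(** * Circle-valued maps on a planar annulus *)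

Section Pigeonhole.
Variable R : realType.
Variables (e rho : R).
Hypothesis e0 : 0 < e.
Hypothesis e_rho : e <= rho.

Definition annulus (e rho : R) : set (R * R) :=
  [set z | e <= Num.sqrt (z.1 ^+ 2 + z.2 ^+ 2) <= rho].

Definition clamp (a b x : R) : R := Num.max a (Num.min b x).

Lemma clamp_bound a b x : a <= b -> a <= clamp a b x <= b.
Proof. by move=> ab; rewrite /clamp le_max lexx /= ge_max ab ge_min lexx. Qed.

Lemma clamp_id a b x : a <= x <= b -> clamp a b x = x.
Proof. by move=> /andP[ax xb]; rewrite /clamp min_r // max_r. Qed.

(** The upper ([sg = 1]) or lower ([sg = -1]) closed half of the annulus,
   parametrized by the radius and the cosine of the angle. Clamping the
   parameters makes the map continuous on the whole plane. *)
Definition half_annulus (sg : R) (z : R * R) : R * R :=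
  (clamp e rho z.1 * clamp (-1) 1 z.2,
   sg * (clamp e rho z.1 * Num.sqrt (1 - clamp (-1) 1 z.2 ^+ 2))).

Lemma half_annulus_in sg z : sg ^+ 2 = 1 -> annulus e rho (half_annulus sg z).
Proof.
move=> sg1; rewrite /annulus /half_annulus /=.
have /andP[r1 r2] := @clamp_bound e rho z.1 e_rho.
have /andP[u1 u2] : -1 <= clamp (-1) 1 z.2 <= 1 by apply: clamp_bound; lra.
set r := clamp e rho z.1 in r1 r2 *; set u := clamp (-1) 1 z.2 in u1 u2 *.
have hu : 0 <= 1 - u ^+ 2 by nra.
rewrite !exprMn sg1 mul1r sqr_sqrtr //.
rewrite -mulrDr addrC subrK.
by rewrite mulr1 sqrtr_sqr ger0_norm ?r1 ?r2 // (le_trans (ltW e0)) .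
Qed.

Lemma half_annulus_cont sg : continuous (half_annulus sg).
Proof.
have cc (a b : R) (p : R * R -> R) : continuous p ->
    cont_on setT (fun z => clamp a b (p z)).
  move=> hp; apply: cont_on_max; first exact: cont_on_cst.
  by apply: cont_on_min; [exact: cont_on_cst|exact: continuous_cont_on].
have c1 : cont_on setT (fun z : R * R => clamp e rho z.1).
  by apply: cc => z; exact: cvg_fst.
have c2 : cont_on setT (fun z : R * R => clamp (-1) 1 z.2).
  by apply: cc => z; exact: cvg_snd.
apply: cont_onT; apply: cont_on_pair; first exact: cont_onM.
apply: cont_onM; first exact: cont_on_cst.
apply: cont_onM => //; apply: cont_on_sqrt; apply: cont_onB.
  exact: cont_on_cst.
exact: cont_onM.
Qed.

Let Q : set (R * R) := [set z | e <= z.1 <= rho /\ -1 <= z.2 <= 1].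

Lemma half_annulus_csqrt (w1 w2 : R * R -> R) (sg : R) : sg ^+ 2 = 1 ->
  cont_on (annulus e rho) w1 -> cont_on (annulus e rho) w2 ->
  (forall z, annulus e rho z -> w1 z ^+ 2 + w2 z ^+ 2 = 1) ->
  exists a b : R * R -> R, [/\ cont_on Q a, cont_on Q b &
    forall z, Q z -> csqrt_of (a z) (b z)
      (w1 (half_annulus sg z)) (w2 (half_annulus sg z))].
Proof.
move=> sg1 c1 c2 hu.
have in_ann z := half_annulus_in z sg1.
have cw (w : R * R -> R) : cont_on (annulus e rho) w ->
    continuous (w \o half_annulus sg).
  move=> cw; apply: cont_onT; apply: cont_on_comp cw => //.
  by apply: continuous_cont_on; exact: half_annulus_cont.
have [a [b [ca cb hab]]] := square_csqrt (rho + 1) (cw _ c1) (cw _ c2)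
  (fun z => hu _ (in_ann z)).
set K := [set z | _] in ca cb hab.
have QK : Q `<=` K.
  move=> z [/andP[h1 h2] /andP[h3 h4]]; have h5 := e0; have h6 := e_rho.
  by split; apply/andP; split; lra.
exists a, b; split; [exact: cont_on_sub ca|exact: cont_on_sub cb|].
by move=> z /QK; exact: hab.
Qed.

(** Square roots on the two halves, equal along the positive axis. The bit [d] is
   the sign by which they differ along the negative axis: the monodromy modulo
   2 of the circle-valued map [(w1, w2)]. *)
Definition halves_sqrt (w1 w2 : R * R -> R) (s : R -> (R * R -> R) * (R * R -> R))
    (d : bool) :=
  [/\ forall sg, sg ^+ 2 = 1 -> [/\ cont_on Q (s sg).1, cont_on Q (s sg).2 &
      forall z, Q z -> csqrt_of ((s sg).1 z) ((s sg).2 z)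
        (w1 (half_annulus sg z)) (w2 (half_annulus sg z))],
     forall r, e <= r <= rho -> (s 1).1 (r, 1) = (s (-1)).1 (r, 1) /\
                                (s 1).2 (r, 1) = (s (-1)).2 (r, 1)
   & forall r, e <= r <= rho ->
      (s 1).1 (r, -1) = (-1) ^+ d * (s (-1)).1 (r, -1) /\
      (s 1).2 (r, -1) = (-1) ^+ d * (s (-1)).2 (r, -1)].

Lemma half_annulus_axis sg u r : u ^+ 2 = 1 -> half_annulus sg (r, u) =
  (clamp e rho r * clamp (-1) 1 u, 0).
Proof.
move=> u1; rewrite /half_annulus /= [X in X ^+ 2]clamp_id.
  by rewrite u1 subrr sqrtr0 !mulr0.
by move/eqP: u1; rewrite sqrf_eq1 => /orP[]/eqP ->; apply/andP; split; lra.
Qed.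

(** Along one of the half axes, the two square roots agree up to a sign, which
   is constant by connectedness. *)
Lemma axis_sign (w1 w2 a b a' b' : R * R -> R) u : u ^+ 2 = 1 ->
  (forall z, annulus e rho z -> w1 z ^+ 2 + w2 z ^+ 2 = 1) ->
  cont_on Q a -> cont_on Q b -> cont_on Q a' -> cont_on Q b' ->
  (forall z, Q z -> csqrt_of (a z) (b z)
      (w1 (half_annulus 1 z)) (w2 (half_annulus 1 z))) ->
  (forall z, Q z -> csqrt_of (a' z) (b' z)
      (w1 (half_annulus (-1) z)) (w2 (half_annulus (-1) z))) ->
  exists d : bool, forall r, e <= r <= rho ->
    a (r, u) = (-1) ^+ d * a' (r, u) /\ b (r, u) = (-1) ^+ d * b' (r, u).
Proof.
move=> u1 hu ca cb ca' cb' h h'.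
have uQ : -1 <= u <= 1.
  by move/eqP: u1; rewrite sqrf_eq1 => /orP[]/eqP ->; apply/andP; split; lra.
pose I := [set r : R | e <= r <= rho].
have cu (f : R * R -> R) : cont_on Q f -> cont_on I (fun r => f (r, u)).
  move=> cf; apply: (@cont_on_comp _ _ _ I Q (fun r => (r, u)) f) => //.
  by apply: cont_on_pair; [exact: cont_on_id|exact: cont_on_cst].
pose g r := a (r, u) * a' (r, u) + b (r, u) * b' (r, u).
have cg : cont_on I g by apply: cont_onD; apply: cont_onM; exact: cu.
have unit r sg : sg ^+ 2 = 1 -> w1 (half_annulus sg (r, u)) ^+ 2 +
    w2 (half_annulus sg (r, u)) ^+ 2 = 1.
  by move=> sg1; apply: hu; exact: half_annulus_in.
have m1 : (-1 : R) ^+ 2 = 1 by rewrite sqrrN expr1n.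
have gpm r : I r -> (g r == 1) || (g r == -1).
  move=> Ir; pose P : R * R := (clamp e rho r * clamp (-1) 1 u, 0).
  have E sg : half_annulus sg (r, u) = P by exact: half_annulus_axis.
  apply: (@csqrt_uniq _ _ _ _ _ (w1 P) (w2 P)).
  - by rewrite -(E 1); apply: unit; rewrite expr1n.
  - by rewrite -(E 1); exact: (h (r, u) (conj Ir uQ)).
  - by rewrite -(E (-1)); exact: (h' (r, u) (conj Ir uQ)).
have same r : I r -> g r = g e.
  move=> /andP[er rr].
  have Ie : I e by apply/andP; split.
  have sub t : e <= t <= r -> I t.
    by move=> /andP[h1 h2]; apply/andP; split=> //; apply: le_trans h2 rr.
  have : 0 < g e * g r.
    apply: (ivt_sign er (cont_on_sub sub cg)) => t /sub /gpm.
    by move=> /orP[]/eqP ->; rewrite ?oppr_eq0 oner_eq0.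
  have /gpm : I r by apply/andP; split.
  by case/orP: (gpm e Ie) => /eqP ->; case/orP=> /eqP ->; rewrite ?mulN1r ?mul1r
    ?opprK ?ltr0N1 ?ltrN10.
have Ie : I e by apply/andP; split.
have un (x y : R * R -> R) sg : sg ^+ 2 = 1 -> (forall z, Q z ->
      csqrt_of (x z) (y z) (w1 (half_annulus sg z)) (w2 (half_annulus sg z))) ->
    forall r, I r -> x (r, u) ^+ 2 + y (r, u) ^+ 2 = 1.
  by move=> sg1 hh r Ir; apply: (csqrt_unit (hh (r, u) (conj Ir uQ))); exact: unit.
have /orP[/eqP ge|/eqP ge] := gpm e Ie.
- exists false => r Ir; rewrite expr0.
  apply: unit_pair_eq; rewrite ?expr1n //; last by rewrite -ge; exact: same.
    exact: (un _ _ 1 (expr1n _ _) h).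
  exact: (un _ _ (-1) m1 h').
- exists true => r Ir; rewrite expr1.
  apply: unit_pair_eq; rewrite ?m1 //; last by rewrite -ge; exact: same.
    exact: (un _ _ 1 (expr1n _ _) h).
  exact: (un _ _ (-1) m1 h').
Qed.

Lemma halves_sqrt_exists (w1 w2 : R * R -> R) :
  cont_on (annulus e rho) w1 -> cont_on (annulus e rho) w2 ->
  (forall z, annulus e rho z -> w1 z ^+ 2 + w2 z ^+ 2 = 1) ->
  exists s d, halves_sqrt w1 w2 s d.
Proof.
move=> c1 c2 hu.
have m1 : (-1 : R) ^+ 2 = 1 by rewrite sqrrN expr1n.
have p1 : (1 : R) ^+ 2 = 1 by rewrite expr1n.
have [a [b [ca cb h]]] := half_annulus_csqrt p1 c1 c2 hu.
have [a' [b' [ca' cb' h']]] := half_annulus_csqrt m1 c1 c2 hu.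
have [d hd] := axis_sign p1 hu ca cb ca' cb' h h'.
have [d' hd'] := axis_sign m1 hu ca cb ca' cb' h h'.
pose s (sg : R) : (R * R -> R) * (R * R -> R) := if 0 <= sg then (a, b)
  else ((fun z => (-1) ^+ d * a' z), (fun z => (-1) ^+ d * b' z)).
have s1 : s 1 = (a, b) by rewrite /s ler01.
have sm1 : s (-1) = ((fun z => (-1) ^+ d * a' z), (fun z => (-1) ^+ d * b' z)).
  by rewrite /s ler0N1.
exists s, (d (+) d'); split.
- move=> sg /eqP; rewrite sqrf_eq1 => /orP[]/eqP ->; rewrite ?s1 ?sm1 //=; split=> //.
  + by apply: cont_onM => //; exact: cont_on_cst.
  + by apply: cont_onM => //; exact: cont_on_cst.
  + move=> z /h' [<- <-]; split; rewrite ?exprMn ?sqrr_sign ?mul1r //.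
    transitivity (((-1) ^+ d) ^+ 2 * (2 * a' z * b' z)); first by ring.
    by rewrite sqrr_sign mul1r.
- by move=> r hr; rewrite s1 sm1 /=; exact: hd.
- move=> r hr; rewrite s1 sm1 /=; have [-> ->] := hd' r hr.
  by case: (d); case: (d'); rewrite /= ?expr0 ?expr1; split; ring.
Qed.
End Pigeonhole.

Section AnnulusSqrt.
Variable R : realType.
Variables (e rho : R).
Hypothesis e0 : 0 < e.
Hypothesis e_rho : e <= rho.

Lemma csqrtM (a b p q a' b' p' q' : R) :
  csqrt_of a b p q -> csqrt_of a' b' p' q' ->
  csqrt_of (a * a' - b * b') (a * b' + b * a')
    (p * p' - q * q') (p * q' + q * p').
Proof. by move=> [<- <-] [<- <-]; split; ring. Qed.

(** When the signs along the negative axis are the same, the products of the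
   square roots on the two halves agree along both half axes and can be
   glued. *)
Lemma same_sign_csqrt (w1 w2 w1' w2' : R * R -> R) s s' d :
  halves_sqrt e rho w1 w2 s d -> halves_sqrt e rho w1' w2' s' d ->
  exists T1 T2 : R * R -> R,
  [/\ cont_on (annulus e rho) T1, cont_on (annulus e rho) T2 &
    forall z, annulus e rho z -> csqrt_of (T1 z) (T2 z)
      (w1 z * w1' z - w2 z * w2' z) (w1 z * w2' z + w2 z * w1' z)].
Proof.
move=> [h hp hn] [h' hp' hn'].
set A := annulus e rho; set Q := [set z : R * R | e <= z.1 <= rho /\ -1 <= z.2 <= 1].
pose S1 sg z := (s sg).1 z * (s' sg).1 z - (s sg).2 z * (s' sg).2 z.
pose S2 sg z := (s sg).1 z * (s' sg).2 z + (s sg).2 z * (s' sg).1 z.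
have p1 : (1 : R) ^+ 2 = 1 by rewrite expr1n.
have m1 : (-1 : R) ^+ 2 = 1 by rewrite sqrrN expr1n.
have S1c sg : sg ^+ 2 = 1 -> cont_on Q (S1 sg).
  move=> sg1; have [c1 c2 _] := h sg sg1; have [c1' c2' _] := h' sg sg1.
  by apply: cont_onB; apply: cont_onM.
have S2c sg : sg ^+ 2 = 1 -> cont_on Q (S2 sg).
  move=> sg1; have [c1 c2 _] := h sg sg1; have [c1' c2' _] := h' sg sg1.
  by apply: cont_onD; apply: cont_onM.
pose r (z : R * R) := Num.sqrt (z.1 ^+ 2 + z.2 ^+ 2).
pose pol (z : R * R) : R * R := (r z, z.1 / r z).
have sq_ge0 (z : R * R) : 0 <= z.1 ^+ 2 + z.2 ^+ 2 by rewrite addr_ge0 ?sqr_ge0.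
have rr z : r z ^+ 2 = z.1 ^+ 2 + z.2 ^+ 2 by rewrite sqr_sqrtr.
have r0 z : A z -> 0 < r z by move=> /andP[h1 _]; apply: lt_le_trans h1.
have c1 : cont_on A (fun z : R * R => z.1).
  by apply: continuous_cont_on => z; exact: cvg_fst.
have c2 : cont_on A (fun z : R * R => z.2).
  by apply: continuous_cont_on => z; exact: cvg_snd.
have cr : cont_on A r by apply: cont_on_sqrt; apply: cont_onD; apply: cont_onM.
have cpol : cont_on A pol.
  apply: cont_on_pair => //; apply: cont_onM => //; apply: cont_onV => // z Az.
  by rewrite gt_eqF // r0.
have u_bound z : A z -> (z.1 / r z) ^+ 2 <= 1.
  move=> Az; rewrite expr_div_n ler_pdivrMr ?exprn_gt0 ?r0 //.
  by rewrite mul1r rr lerDl sqr_ge0.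
have polQ z : A z -> Q (pol z).
  move=> Az; split=> //=; have := u_bound z Az; set u := _ / _ => hu.
  by apply/andP; split; nra.
have axis z : A z -> z.2 = 0 -> z.1 / r z = 1 \/ z.1 / r z = -1.
  move=> Az z2; have /eqP : (z.1 / r z) ^+ 2 = 1.
    have e1 : z.1 ^+ 2 = r z ^+ 2 by rewrite rr z2 expr0n addr0.
    by rewrite expr_div_n e1 divff // expf_neq0 // gt_eqF // r0.
  by rewrite sqrf_eq1 => /orP[]/eqP; [left|right].
have halfK sg z : A z -> sg * `|z.2| = z.2 -> half_annulus e rho sg (pol z) = z.
  move=> Az hs; have [q1 q2] := polQ z Az; rewrite /half_annulus !clamp_id //=.
  rewrite mulrC divfK ?gt_eqF ?r0 // -[Num.sqrt _]/(Num.sqrt _).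
  have -> : r z * Num.sqrt (1 - (z.1 / r z) ^+ 2) = `|z.2|.
    rewrite -sqrtr_sqr -[X in X * _](ger0_norm (ltW (r0 z Az))) -[X in X * _]sqrtr_sqr.
    rewrite -sqrtrM ?sqr_ge0 //; congr Num.sqrt.
    rewrite mulrBr mulr1 expr_div_n mulrC divfK ?rr; first by ring.
    by rewrite -rr expf_neq0 // gt_eqF // r0.
  by rewrite hs -surjective_pairing.
have glue (S : R -> R * R -> R) :
    (forall t, e <= t <= rho -> S 1 (t, 1) = S (-1) (t, 1)) ->
    (forall t, e <= t <= rho -> S 1 (t, -1) = S (-1) (t, -1)) ->
    (forall sg, sg ^+ 2 = 1 -> cont_on Q (S sg)) ->
    cont_on A (fun z => if 0 <= z.2 then S 1 (pol z) else S (-1) (pol z)).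
  move=> g1 gm1 cS; apply: (@cont_on_if R _ A (fun z => z.2)
    (S 1 \o pol) (S (-1) \o pol)) => //.
  - by apply: cont_on_comp cpol (cS _ p1).
  - by apply: cont_on_comp cpol (cS _ m1).
  - by move=> z Az z2; rewrite /= /pol; case: (axis z Az z2) => ->; [apply: g1|apply: gm1].
exists (fun z => if 0 <= z.2 then S1 1 (pol z) else S1 (-1) (pol z)).
exists (fun z => if 0 <= z.2 then S2 1 (pol z) else S2 (-1) (pol z)).
split.
- apply: glue => // t ht; rewrite /S1.
    by have [-> ->] := hp t ht; have [-> ->] := hp' t ht.
  by have [-> ->] := hn t ht; have [-> ->] := hn' t ht; case: (d);
    rewrite /= ?expr0 ?expr1; ring.
- apply: glue => // t ht; rewrite /S2.
    by have [-> ->] := hp t ht; have [-> ->] := hp' t ht.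
  by have [-> ->] := hn t ht; have [-> ->] := hn' t ht; case: (d);
    rewrite /= ?expr0 ?expr1; ring.
move=> z Az; have Qz := polQ z Az.
have main sg : sg ^+ 2 = 1 -> sg * `|z.2| = z.2 ->
    csqrt_of (S1 sg (pol z)) (S2 sg (pol z))
      (w1 z * w1' z - w2 z * w2' z) (w1 z * w2' z + w2 z * w1' z).
  move=> sg1 hs; have [_ _ k] := h sg sg1; have [_ _ k'] := h' sg sg1.
  by have := csqrtM (k _ Qz) (k' _ Qz); rewrite halfK.
have [z0|z0] := leP 0 z.2; apply: main => //; first by rewrite mul1r ger0_norm.
by rewrite mulN1r ltr0_norm // opprK.
Qed.

(** The monodromy modulo 2 takes only two values, so it is the same for two of
   the three maps. *)
Lemma annulus_pigeonhole (w1 w2 : 'I_3 -> R * R -> R) :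
  (forall i, cont_on (annulus e rho) (w1 i)) ->
  (forall i, cont_on (annulus e rho) (w2 i)) ->
  (forall i z, annulus e rho z -> w1 i z ^+ 2 + w2 i z ^+ 2 = 1) ->
  exists i j (T1 T2 : R * R -> R),
  [/\ i != j, cont_on (annulus e rho) T1, cont_on (annulus e rho) T2 &
    forall z, annulus e rho z -> csqrt_of (T1 z) (T2 z)
      (w1 i z * w1 j z - w2 i z * w2 j z) (w1 i z * w2 j z + w2 i z * w1 j z)].
Proof.
move=> c1 c2 hu.
have [s0 [d0 h0]] := halves_sqrt_exists e0 e_rho (c1 0) (c2 0) (hu 0).
have [s1 [d1 h1]] := halves_sqrt_exists e0 e_rho (c1 1) (c2 1) (hu 1).
have [s2 [d2 h2]] := halves_sqrt_exists e0 e_rho (c1 2) (c2 2) (hu 2).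
suff [i [j [ij [s [s' [d [h h']]]]]]] : exists i j, i != j /\ exists s s' d,
    halves_sqrt e rho (w1 i) (w2 i) s d /\ halves_sqrt e rho (w1 j) (w2 j) s' d.
  by have [T1 [T2 [k1 k2 k3]]] := same_sign_csqrt h h'; exists i, j, T1, T2.
have [d01|d01] := eqVneq d0 d1.
  by exists 0, 1; split=> //; exists s0, s1, d0; split=> //; rewrite d01.
have [d02|d02] := eqVneq d0 d2.
  by exists 0, 2; split=> //; exists s0, s2, d0; split=> //; rewrite d02.
exists 1, 2; split=> //; exists s1, s2, d1; split=> //.
suff -> : d1 = d2 by [].
by move: d01 d02; case: (d0); case: (d1); case: (d2).
Qed.
End AnnulusSqrt.

(** * Topological invariance of the singular set *)

Section Invariance.
Variable R : realType.

Definition homeo_on m n (C : set 'rV[R]_m) (D : set 'rV[R]_n)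
    (f : 'rV[R]_m -> 'rV[R]_n) (g : 'rV[R]_n -> 'rV[R]_m) : Prop :=
  [/\ cont_on C f, cont_on D g, forall x, C x -> D (f x) /\ g (f x) = x &
      forall y, D y -> C (g y) /\ f (g y) = y].

Definition planar_at n (C : set 'rV[R]_n) (x : 'rV[R]_n) : Prop :=
  exists (e1 e2 : 'rV[R]_n) (d : R), [/\ 0 < d,
    dotp e1 e1 = 1, dotp e2 e2 = 1, dotp e1 e2 = 0 &
    forall y, enorm (y - x) < d ->
      C y <-> exists a b : R, y = x + (a *: e1 + b *: e2)].

Definition triple_at n (C : set 'rV[R]_n) (x : 'rV[R]_n) : Prop :=
  exists (v : 'rV[R]_n) (t : 'I_3 -> 'rV[R]_n) (d : R), [/\ 0 < d,
    dotp v v = 1, forall i, dotp v (t i) = 0,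
    forall i j, dotp (t i) (t j) = if i == j then 1 else - 2^-1 &
    forall y, enorm (y - x) < d ->
      C y <-> exists i (a b : R), 0 <= b /\ y = x + (a *: v + b *: t i)].

Lemma enorm_lt_sqr n (x : 'rV[R]_n) (d : R) : 0 < d ->
  (enorm x < d) = (dotp x x < d ^+ 2).
Proof. by move=> d0; rewrite -enorm_sqr ltr_pXn2r ?nnegrE ?enorm_ge0 ?ltW. Qed.

Lemma frame_dotp n (a b : 'rV[R]_n) (s t : R) : dotp a b = 0 ->
  dotp a a = 1 -> dotp b b = 1 ->
  dotp (s *: a + t *: b) (s *: a + t *: b) = s ^+ 2 + t ^+ 2.
Proof.
move=> ab aa bb; rewrite dotpDl !dotpDr !dotpZl !dotpZr aa bb (dotpC b) ab.
by ring.
Qed.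

Lemma third_index (i j : 'I_3) : i != j -> exists c, c != i /\ c != j.
Proof.
by move: i j; apply: ord3_ind; apply: ord3_ind => // _;
  [exists 2|exists 1|exists 2|exists 0|exists 1|exists 0].
Qed.

Lemma sign_clash (p q a b : R) : 0 < p -> 0 < q -> 0 < a * b ->
  0 < a * - p * (b * q) -> False.
Proof.
move=> p0 q0 ab; have -> : a * - p * (b * q) = - (a * b * (p * q)) by ring.
rewrite oppr_gt0 => h.
by have := lt_trans h (mulr_gt0 ab (mulr_gt0 p0 q0)); rewrite ltxx.
Qed.

Variables (m n : nat) (C : set 'rV[R]_m) (D : set 'rV[R]_n).
Variables (f : 'rV[R]_m -> 'rV[R]_n) (g : 'rV[R]_n -> 'rV[R]_m).
Hypothesis fg : homeo_on C D f g.

(** Let [w k] be the orthogonal projection to the plane of [v] and [t k], seen as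
   the complex plane with [v] on the imaginary axis. It is
   nonzero on [D] near [f x], except at [f x]; it turns once around 0 along a
   loop that crosses the sheet [t k] and another one, while the two sheets other
   than [t k] have the same image. Pull the three maps back to an annulus around
   [x] in the surface: two of them, [w i] and [w j], have a product with a square
   root [T] by [annulus_pigeonhole]. Let [c] be the third index, and follow [T]
   along the two half circles that join the points [f x + v] and [f x - v], up to
   scaling, in the sheets [t i] and [t c]. In [t c] the product is the square of
   [w i], so [T] is [w i] up to a constant sign and its imaginary part changes
   sign between the two end points; in [t i] the product is never a positive
   real, so the imaginary part of [T] does not change sign. *)
Lemma planar_not_triple (x : 'rV[R]_m) : C x -> planar_at C x ->
  triple_at D (f x) -> False.
Proof.
have [cf cg hf hg] := fg.
move=> Cx [e1 [e2 [d0 [d0_gt0 e11 e22 e12 hC]]]].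
move=> [v [t [d1 [d1_gt0 vv vt tt hD]]]].
set x' := f x in hD.
have gx' : g x' = x by have [] := hf x Cx.
have Dx' : D x' by have [] := hf x Cx.
have [d2 d2_gt0 hd2] := cont_on_epsP cf Cx d1_gt0.
pose rho := Num.min d0 d2 / 2.
have m02 : 0 < Num.min d0 d2 by rewrite lt_min d0_gt0.
have rho_gt0 : 0 < rho by rewrite divr_gt0.
have [rho_d0 rho_d2] : rho < d0 /\ rho < d2.
  have : rho < Num.min d0 d2 by rewrite /rho; lra.
  by rewrite lt_min => /andP.
have [d3 d3_gt0 hd3] := cont_on_epsP cg Dx' rho_gt0.
pose rho' := Num.min d1 d3 / 2.
have m13 : 0 < Num.min d1 d3 by rewrite lt_min d1_gt0.
have rho'_gt0 : 0 < rho' by rewrite divr_gt0.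
have [rho'_d1 rho'_d3] : rho' < d1 /\ rho' < d3.
  have : rho' < Num.min d1 d3 by rewrite /rho'; lra.
  by rewrite lt_min => /andP.
pose I := [set u : R | -1 <= u <= 1].
have leN11 : (-1 : R) <= 1 by exact: le_trans (lerN10 R) ler01.
have I1 : I 1 by rewrite /I /= lexx leN11.
have Im1 : I (-1) by rewrite /I /= lexx leN11.
pose sq (u : R) := Num.sqrt (1 - u ^+ 2).
have sqE u : I u -> sq u ^+ 2 = 1 - u ^+ 2.
  by move=> /andP[u1 u2]; rewrite sqr_sqrtr //; nra.
have sq_ge0 u : 0 <= sq u by exact: sqrtr_ge0.
have csq : cont_on I sq.
  apply: cont_on_sqrt; apply: cont_onB; first exact: cont_on_cst.
  by apply: cont_onM; exact: cont_on_id.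
(* the half circle around [x'] in the sheet [t k] *)
pose L k u := x' + rho' *: (u *: v + sq u *: t k).
have tk1 k : dotp (t k) (t k) = 1 by rewrite tt eqxx.
have LL k u : I u -> enorm (L k u - x') = rho'.
  move=> Iu; rewrite /L addrAC subrr add0r enormZ ger0_norm ?ltW //.
  by rewrite /enorm frame_dotp // sqE // addrC subrK sqrtr1 mulr1.
have LD k u : I u -> D (L k u).
  move=> Iu; apply/hD; rewrite ?LL //; exists k, (rho' * u), (rho' * sq u).
  split; first by apply: mulr_ge0; [exact: ltW|exact: sq_ge0].
  by rewrite /L scalerDr !scalerA.
have cL k : cont_on I (L k).
  apply: cont_on_vecD; first exact: cont_on_cst.
  apply: cont_onZ; first exact: cont_on_cst.
  by apply: cont_on_vecD; apply: cont_onZ => //;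
    [exact: cont_on_id|exact: cont_on_cst|exact: cont_on_cst].
have cgL k : cont_on I (g \o L k) by apply: cont_on_comp (cL k) cg => u; exact: LD.
have gLx k u : I u -> g (L k u) != x.
  move=> Iu; apply/eqP => e; have [_ fgL] := hg _ (LD k u Iu).
  have := LL k u Iu; rewrite -fgL e subrr enorm0 => r0.
  by rewrite -r0 ltxx in rho'_gt0.
have far k : exists2 e : R, 0 < e & forall u, I u -> e <= enorm (g (L k u) - x).
  have c1 : {within `[(-1), 1], continuous (fun u => enorm (g (L k u) - x))}.
    apply/cont_onP; apply: (@cont_on_sub _ _ _ I) => [u /=|]; first by rewrite in_itv.
    by apply: cont_on_enorm; apply: cont_on_vecB; [exact: cgL|exact: cont_on_cst].
  have [|c cI hc] := EVT_min _ c1; first by lra.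
  rewrite in_itv /= in cI; exists (enorm (g (L k c) - x)).
    by rewrite enorm_gt0 // subr_eq0 gLx.
  by move=> u Iu; apply: hc; rewrite in_itv.
have [e e_gt0 [e_rho he]] : exists2 e : R, 0 < e & e <= rho /\
    forall k u, I u -> e <= enorm (g (L k u) - x).
  have [a0 a0_gt0 h0] := far 0; have [a1 a1_gt0 h1] := far 1.
  have [a2 a2_gt0 h2] := far 2.
  exists (Num.min (Num.min rho a0) (Num.min a1 a2)).
    by rewrite !lt_min rho_gt0 a0_gt0 a1_gt0.
  split; first by rewrite !ge_min lexx.
  by apply: ord3_ind => u Iu; [apply: le_trans (h0 u Iu)|apply: le_trans (h1 u Iu)|
    apply: le_trans (h2 u Iu)]; rewrite !ge_min lexx ?orbT.
(* the annulus around [x], in the coordinates of the frame [e1], [e2] *)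
set A := annulus e rho.
pose E (z : R * R) := x + (z.1 *: e1 + z.2 *: e2).
pose Z y : R * R := (dotp (y - x) e1, dotp (y - x) e2).
have EE z : enorm (E z - x) = Num.sqrt (z.1 ^+ 2 + z.2 ^+ 2).
  by rewrite /E addrAC subrr add0r /enorm frame_dotp.
have AC z : A z -> C (E z) /\ enorm (E z - x) < d2 /\ E z != x.
  move=> /andP[h1 h2]; split.
    by apply/hC; [rewrite EE; apply: le_lt_trans h2 _|exists z.1, z.2].
  split; first by rewrite EE; apply: le_lt_trans h2 _.
  apply/eqP => h; move: h1; rewrite -EE h subrr enorm0 leNgt e_gt0 //.
have cE : cont_on A E.
  apply: cont_on_vecD; first exact: cont_on_cst.
  apply: cont_on_vecD; apply: cont_onZ; try exact: cont_on_cst.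
    by apply: continuous_cont_on => z; exact: cvg_fst.
  by apply: continuous_cont_on => z; exact: cvg_snd.
have cfE : cont_on A (f \o E) by apply: cont_on_comp cE cf => z /AC[].
have EZ y : C y -> enorm (y - x) < d0 -> E (Z y) = y.
  move=> Cy yd; have [a [b ->]] := (hC y yd).1 Cy.
  rewrite /E /Z addrAC subrr add0r !dotpDl !dotpZl e11 e22 e12 (dotpC e2) e12.
  by rewrite /= !mulr0 !mulr1 addr0 add0r.
have fE z : A z -> [/\ D (f (E z)), enorm (f (E z) - x') < d1 & f (E z) != x'].
  move=> /AC[CE [d2E Ex]]; split; [by have [] := hf _ CE|exact: hd2|].
  apply/eqP => h; have [_] := hf _ CE; rewrite h gx' => h'.
  by rewrite h' eqxx in Ex.
(* the maps [w k], normalized, as [(w1 k, w2 k)]; the second component is the one along [v] *)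
pose nu k y := Num.sqrt (dotp (y - x') (t k) ^+ 2 + dotp (y - x') v ^+ 2).
have nu_gt0 k y : D y -> enorm (y - x') < d1 -> y != x' -> 0 < nu k y.
  move=> Dy yd yx; rewrite sqrtr_gt0 lt0r addr_ge0 ?sqr_ge0 // andbT.
  apply: contra yx; rewrite paddr_eq0 ?sqr_ge0 // !sqrf_eq0.
  have [i [a [b [b0 ->]]]] := (hD y yd).1 Dy.
  rewrite addrAC subrr add0r !dotpDl !dotpZl vt vv (dotpC (t i) v) vt tt.
  rewrite !mulr0 !mulr1 addr0 add0r => /andP[h /eqP ->].
  have -> : b = 0 by case: (i == k) h => /eqP; lra.
  by rewrite !scale0r !addr0.
pose w1 k z := dotp (f (E z) - x') (t k) / nu k (f (E z)).
pose w2 k z := dotp (f (E z) - x') v / nu k (f (E z)).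
have cd (a : 'rV[R]_n) : cont_on A (fun z => dotp (f (E z) - x') a).
  apply: cont_on_dotp; last exact: cont_on_cst.
  by apply: cont_on_vecB; [exact: cfE|exact: cont_on_cst].
have cnu k : cont_on A (fun z => (nu k (f (E z)))^-1).
  apply: cont_onV => [z /fE[h1 h2 h3]|]; first by rewrite gt_eqF // nu_gt0.
  by apply: cont_on_sqrt; apply: cont_onD; apply: cont_onM.
have cw1 k : cont_on A (w1 k) by exact: cont_onM.
have cw2 k : cont_on A (w2 k) by exact: cont_onM.
have w_unit k z : A z -> w1 k z ^+ 2 + w2 k z ^+ 2 = 1.
  move=> /fE[h1 h2 h3]; rewrite /w1 /w2 !expr_div_n -mulrDl sqr_sqrtr.
    by rewrite divff // gt_eqF // -sqrtr_gt0 nu_gt0.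
  by rewrite addr_ge0 ?sqr_ge0.
have [i [j [T1 [T2 [ij cT1 cT2 hT]]]]] := annulus_pigeonhole e_gt0 e_rho cw1 cw2 w_unit.
have [c [ci cj]] := third_index ij.
(* the half circles, carried back to the annulus *)
pose z k u := Z (g (L k u)).
have gLd k u : I u -> enorm (g (L k u) - x) < rho.
  by move=> Iu; rewrite -[X in _ - X]gx'; apply: hd3; [exact: LD|rewrite LL].
have Ez k u : I u -> E (z k u) = g (L k u).
  move=> Iu; apply: EZ; first by have [] := hg _ (LD k u Iu).
  exact: lt_trans (gLd k u Iu) rho_d0.
have zA k u : I u -> A (z k u).
  by move=> Iu; apply/andP; rewrite -EE Ez // he // ltW ?gLd.
have fEz k u : I u -> f (E (z k u)) = L k u.
  by move=> Iu; rewrite Ez //; have [] := hg _ (LD k u Iu).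
have cz k : cont_on I (z k).
  have c1 : cont_on I (fun u => g (L k u) - x).
    by apply: cont_on_vecB; [exact: cgL|exact: cont_on_cst].
  by apply: cont_on_pair; apply: cont_on_dotp; [exact: c1|exact: cont_on_cst|
    exact: c1|exact: cont_on_cst].
have cTz (T : R * R -> R) k : cont_on A T -> cont_on I (T \o z k).
  by move=> cT; apply: cont_on_comp (cz k) cT => u; exact: zA.
have Lt k l u : dotp (L k u - x') (t l) = rho' * (sq u * if k == l then 1 else - 2^-1).
  by rewrite /L addrAC subrr add0r dotpZl dotpDl !dotpZl vt tt mulr0 add0r.
have Lv k u : dotp (L k u - x') v = rho' * u.
  by rewrite /L addrAC subrr add0r dotpZl dotpDl !dotpZl vv (dotpC (t k)) vt
    mulr0 addr0 mulr1.
have nuL k l u : I u -> 0 < nu l (L k u).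
  by move=> Iu; have [h1 h2 h3] := fE _ (zA k u Iu); rewrite -fEz // nu_gt0.
have ends k l u : u ^+ 2 = 1 -> z k u = z l u.
  by move=> u1; rewrite /z /L /sq u1 subrr sqrtr0 !scale0r.
(* on the sheet [t i], the product is never a positive real *)
have s1 : 0 < T2 (z i (-1)) * T2 (z i 1).
  apply: (@ivt_sign R (T2 \o z i) (-1) 1 leN11 (cTz _ _ cT2)) => u Iu.
  have [h _] := hT _ (zA i u Iu); apply/eqP => /= T20.
  have n1 := nuL i i u Iu; have n2 := nuL i j u Iu.
  move: h; rewrite T20 expr0n subr0 /w1 /w2 fEz // !Lt !Lv eqxx (negPf ij).
  move=> h; have := sqr_ge0 (T1 (z i u)); rewrite h.
  have -> : rho' * (sq u * 1) / nu i (L i u) *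
      (rho' * (sq u * - 2^-1) / nu j (L i u)) -
      rho' * u / nu i (L i u) * (rho' * u / nu j (L i u)) =
      - (rho' ^+ 2 * (sq u ^+ 2 / 2 + u ^+ 2) / (nu i (L i u) * nu j (L i u))).
    by field; rewrite ?gt_eqF.
  rewrite leNgt oppr_lt0 divr_gt0 ?mulr_gt0 ?exprn_gt0 // sqE //.
  by have := sqr_ge0 u; lra.
(* on the sheet [t c], it is a square *)
have s2 : 0 < (T1 (z c (-1)) * w1 i (z c (-1)) + T2 (z c (-1)) * w2 i (z c (-1)))
            * (T1 (z c 1) * w1 i (z c 1) + T2 (z c 1) * w2 i (z c 1)).
  pose h u := T1 (z c u) * w1 i (z c u) + T2 (z c u) * w2 i (z c u).
  apply: (@ivt_sign R h (-1) 1 leN11).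
    by apply: cont_onD; apply: cont_onM; exact: cTz.
  move=> u Iu; have Az := zA c u Iu.
  have w1E : w1 j (z c u) = w1 i (z c u).
    by rewrite /w1 /nu fEz // !Lt !Lv (negPf ci) (negPf cj).
  have w2E : w2 j (z c u) = w2 i (z c u).
    by rewrite /w2 /nu fEz // !Lt !Lv (negPf ci) (negPf cj).
  have := hT _ Az; rewrite w1E w2E => hT'.
  have hw : csqrt_of (w1 i (z c u)) (w2 i (z c u))
    (w1 i (z c u) * w1 i (z c u) - w2 i (z c u) * w2 i (z c u))
    (w1 i (z c u) * w2 i (z c u) + w2 i (z c u) * w1 i (z c u)) by split; ring.
  have := csqrt_uniq _ hT' hw; rewrite -/(h u).
  have wu := w_unit i _ Az.
  suff -> : (w1 i (z c u) * w1 i (z c u) - w2 i (z c u) * w2 i (z c u)) ^+ 2 +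
    (w1 i (z c u) * w2 i (z c u) + w2 i (z c u) * w1 i (z c u)) ^+ 2 = 1.
    by move=> /(_ erefl) /orP[]/eqP ->; rewrite ?oppr_eq0 oner_eq0.
  transitivity ((w1 i (z c u) ^+ 2 + w2 i (z c u) ^+ 2) ^+ 2); first by ring.
  by rewrite wu expr1n.
have sq1 : sq 1 = 0 by rewrite /sq expr1n subrr sqrtr0.
have sqm1 : sq (-1) = 0 by rewrite /sq sqrrN expr1n subrr sqrtr0.
have w1c u : I u -> w1 i (z c u) = rho' * (sq u * - 2^-1) / nu i (L c u).
  by move=> Iu; rewrite /w1 fEz // Lt (negPf ci).
have w2c u : I u -> w2 i (z c u) = u * (rho' / nu i (L c u)).
  by move=> Iu; rewrite /w2 fEz // Lv; ring.
move: s2; rewrite (w1c _ I1) (w1c _ Im1) (w2c _ I1) (w2c _ Im1) sq1 sqm1.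
rewrite (ends c i (-1)) ?sqrrN ?expr1n // (ends c i 1) ?expr1n //.
rewrite !mul0r !mulr0 !mul0r !mulr0 !add0r mul1r mulN1r.
have n1 := nuL c i _ I1; have n2 := nuL c i _ Im1.
exact: (sign_clash (divr_gt0 rho'_gt0 n2) (divr_gt0 rho'_gt0 n1) s1).
Qed.

End Invariance.

(** * Arcs of great circles *)

Section Arcs.
Variables (R : realType) (n : nat).
Local Notation V := 'rV[R]_n.
Implicit Types (v t x y : V) (a : great_arc R n).

(** [c] is a root of [4 * c^3 - 3 * c = 1], that is [(c - 1) * (2 * c + 1)^2 = 0]. *)
Lemma cos120 : cos (angle120 R) = - 2^-1.
Proof.
rewrite /angle120; set x := 2 * pi / 3; set c := cos x.
have pi0 := pi_gt0 R.
have x0 : 0 < x by rewrite /x; lra.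
have xpi : x < pi by rewrite /x; lra.
have c1 : c != 1.
  rewrite -cos0; apply/eqP => /cos_inj; rewrite !in_itv /= lexx !ltW // => /(_ isT isT).
  by move/eqP; rewrite gt_eqF.
have h : cos (x *+ 2 + x) = 1.
  by rewrite -[RHS]cos2pi; congr cos; rewrite /x; lra.
have s2 := sin2cos2 x; rewrite -/c in s2.
move: h; rewrite cosD cos_mulr2n sin_mulr2n -/c.
have -> : (c ^+ 2 *+ 2 - 1) * c - (c * sin x) *+ 2 * sin x =
   (c ^+ 2 *+ 2 - 1) * c - 2 * c * sin x ^+ 2 by ring.
rewrite s2 => h.
have /eqP : (c - 1) * (2 * c + 1) ^+ 2 = 0 by lra.
rewrite mulf_eq0 subr_eq0 (negPf c1) /= sqrf_eq0 => /eqP h2; lra.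
Qed.

Lemma dotp_unit_bound x y : dotp x x = 1 -> dotp y y = 1 -> -1 <= dotp x y <= 1.
Proof.
move=> xx yy; apply/andP; split.
- have := dotp_ge0 (x + y); rewrite dotpDl !dotpDr xx yy (dotpC y x); lra.
- have := dotp_ge0 (x - y).
  rewrite dotpDl !dotpDr !dotpNl !dotpNr xx yy (dotpC y x); lra.
Qed.

Lemma angle120P x y : dotp x x = 1 -> dotp y y = 1 ->
  angle x y = angle120 R -> dotp x y = - 2^-1.
Proof.
move=> xx yy; rewrite /angle (enorm1P x).2 // (enorm1P y).2 // mulr1 divr1 => h.
by rewrite -cos120 -h acosK // in_itv /=; exact: dotp_unit_bound.
Qed.

Lemma angle120_sym x y : dotp x x = 1 -> dotp y y = 1 ->
  dotp x y = - 2^-1 -> angle x y = angle120 R.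
Proof.
move=> xx yy h.
rewrite /angle (enorm1P x).2 // (enorm1P y).2 // mulr1 divr1 h -cos120 cosK //.
have pi0 := pi_gt0 R; rewrite in_itv /= /angle120; apply/andP; split; lra.
Qed.

Definition halfarc v t (l : R) : set V :=
  [set cos u *: v + sin u *: t | u in [set u : R | 0 <= u <= l]].

Lemma cos_lt_reflex (u l : R) : pi < u -> u <= l -> l < 2 * pi -> cos u <= cos l.
Proof.
move=> pu ul l2.
have E (w : R) : cos w = cos (pi *+ 2 - w) by rewrite cosB cos2pi sin2pi; ring.
rewrite (E u) (E l); case: (ltgtP u l) ul => // [ul _|-> //].
apply: ltW; rewrite ltr_cos; try lra.
- by rewrite in_itv /=; apply/andP; split; lra.
- by rewrite in_itv /=; apply/andP; split; lra.
Qed.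

(** Close enough to [v], no point of the arc has a negative sine and no point of
   the half circle is beyond the length [l]. *)
Lemma halfarc_local v t (l : R) y : dotp v v = 1 -> dotp t t = 1 ->
  dotp v t = 0 -> 0 < l -> l < 2 * pi -> dotp y y = 1 -> cos l < dotp y v ->
  halfarc v t l y <-> exists a b : R, 0 <= b /\ y = a *: v + b *: t.
Proof.
move=> vv tt vt l0 l2 yy hy; split.
- move=> [u /= /andP[u0 ul] e]; exists (cos u), (sin u); split=> //.
  have [upi|upi] := leP u pi; first by apply: sin_ge0_pi; rewrite u0.
  move: hy; rewrite -e dotpDl !dotpZl vv (dotpC t) vt mulr0 addr0 mulr1.
  by rewrite ltNge cos_lt_reflex.
- move=> [a [b [b0 e]]]; subst y.
  have hab : a ^+ 2 + b ^+ 2 = 1 by rewrite -yy frame_dotp.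
  have ha : -1 <= a <= 1.
    by have := sqr_ge0 b; move=> ?; apply/andP; split; nra.
  have ca : cos (acos a) = a by rewrite acosK // in_itv.
  exists (acos a); last first.
    rewrite /= ca sin_acos // (_ : 1 - a ^+ 2 = b ^+ 2); last by lra.
    by rewrite sqrtr_sqr ger0_norm.
  rewrite /= acos_ge0 //=; have hpi := acos_lepi ha; have [pil|lpi] := leP pi l.
    exact: le_trans pil.
  rewrite leNgt; apply/negP => hl.
  move: hy; rewrite dotpDl !dotpZl vv (dotpC t) vt mulr0 addr0 mulr1 -{1}ca.
  have li : l \in `[0, pi] by rewrite in_itv /= !ltW.
  have ai : acos a \in `[0, pi] by rewrite in_itv /= acos_ge0.
  by rewrite ltr_cos // => h; have := lt_trans h hl; rewrite ltxx.
Qed.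

Lemma arc_src1 a : dotp (arc_src a) (arc_src a) = 1.
Proof. by apply/enorm1P; exact: arc_src_unit. Qed.

Lemma arc_dir1 a : dotp (arc_dir a) (arc_dir a) = 1.
Proof. by apply/enorm1P; exact: arc_dir_unit. Qed.

Lemma arc_pt_dotp a (s u : R) :
  dotp (arc_pt a s) (arc_pt a u) = cos (s - u).
Proof.
rewrite /arc_pt dotpDl !dotpDr !dotpZl !dotpZr arc_src1 arc_dir1 (dotpC (arc_dir a)).
by rewrite arc_src_dir cosB; ring.
Qed.

Lemma arc_pt1 a s : dotp (arc_pt a s) (arc_pt a s) = 1.
Proof. by rewrite arc_pt_dotp subrr cos0. Qed.

Lemma cos_eq1 (u : R) : - (2 * pi) < u < 2 * pi -> cos u = 1 -> u = 0.
Proof.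
move=> hu; rewrite -[cos u]cos_norm => h.
have hu2 : `|u| < 2 * pi by rewrite ltr_norml.
apply/eqP; rewrite -normr_eq0; apply/eqP.
have [upi|upi] := leP `|u| pi.
  by apply: cos_inj; rewrite ?in_itv /= ?normr_ge0 ?lexx ?pi_ge0 ?upi // h cos0.
move: h; have -> : cos `|u| = cos (pi *+ 2 - `|u|) by rewrite cosB cos2pi sin2pi; ring.
have pi0 := pi_gt0 R.
have v1 : pi *+ 2 - `|u| \in `[0, pi] by rewrite in_itv /=; apply/andP; split; lra.
have v0 : 0 \in `[0, pi : R] by rewrite in_itv /= lexx ltW.
by rewrite -cos0 => /(cos_inj v1 v0); lra.
Qed.

Lemma arc_pt_inj a (s u : R) : 0 <= s <= arc_len a -> 0 <= u <= arc_len a ->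
  arc_pt a s = arc_pt a u -> s = u.
Proof.
move=> /andP[s0 sl] /andP[t0 tl] h; have := arc_pt_dotp a s u; rewrite h arc_pt1.
have l2 := arc_len_lt a; move=> /esym /cos_eq1 h2.
by apply/eqP; rewrite -subr_eq0; apply/eqP; apply: h2; apply/andP; split; lra.
Qed.

Lemma arc_end0 a : arc_end a false = arc_src a.
Proof. by rewrite /arc_end /arc_pt cos0 sin0 scale1r scale0r addr0. Qed.

Lemma arc_end1 a b : dotp (arc_end a b) (arc_end a b) = 1.
Proof. exact: arc_pt1. Qed.

Lemma arc_tangent1 a b : dotp (arc_tangent a b) (arc_tangent a b) = 1.
Proof.
case: b; rewrite /arc_tangent ?arc_dir1 // -scaleNr.
by rewrite frame_dotp ?arc_src1 ?arc_dir1 ?arc_src_dir // sqrrN addrC cos2Dsin2.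
Qed.

Lemma arc_end_tangent a b : dotp (arc_end a b) (arc_tangent a b) = 0.
Proof.
case: b; last by rewrite arc_end0 arc_src_dir.
rewrite /arc_end /arc_tangent /arc_pt -scaleNr dotpDl !dotpDr !dotpZl !dotpZr.
by rewrite (dotpC (arc_dir a)) arc_src1 arc_dir1 arc_src_dir; ring.
Qed.

Lemma arc_set_end a b : arc_set a (arc_end a b).
Proof.
have l0 := arc_len_gt0 a.
by case: b; [exists (arc_len a)|exists 0] => //=; rewrite ?lexx ltW.
Qed.

(** Changing the parameter [u] to [arc_len a - u] exchanges the ends. *)
Lemma arc_setE a b : arc_set a = halfarc (arc_end a b) (arc_tangent a b) (arc_len a).
Proof.
case: b; last by rewrite arc_end0.
have rev (u : R) : arc_pt a (arc_len a - u) =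
    cos u *: arc_end a true + sin u *: arc_tangent a true.
  rewrite /arc_end /arc_tangent /arc_pt cosB sinB; apply/rowP => k.
  by rewrite !mxE; ring.
apply/seteqP; split=> x [u /= /andP[u0 ul] <-].
- exists (arc_len a - u) => /=; first by apply/andP; split; lra.
  by rewrite -rev; congr arc_pt; lra.
- exists (arc_len a - u) => /=; first by apply/andP; split; lra.
  by rewrite rev.
Qed.

(** The two halves of the arc, both parametrized from the point between them. *)
Lemma arc_set_splitE a (s : R) : 0 < s < arc_len a ->
  let t := cos s *: arc_dir a - sin s *: arc_src a in
  arc_set a = halfarc (arc_pt a s) t (arc_len a - s) `|` halfarc (arc_pt a s) (- t) s.
Proof.
move=> /andP[s0 sl] t.
have fwd (u : R) : arc_pt a (s + u) = cos u *: arc_pt a s + sin u *: t.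
  rewrite /arc_pt /t cosD sinD; apply/rowP => k; rewrite !mxE; ring.
have bwd (u : R) : arc_pt a (s - u) = cos u *: arc_pt a s + sin u *: - t.
  by rewrite fwd cosN sinN scaleNr scalerN.
apply/seteqP; split=> x.
- move=> [u /= /andP[u0 ul] <-]; have [su|us] := leP s u.
    left; exists (u - s) => /=; first by apply/andP; split; lra.
    by rewrite -fwd; congr arc_pt; lra.
  right; exists (s - u) => /=; first by apply/andP; split; lra.
  by rewrite -bwd; congr arc_pt; lra.
- move=> [[u /= /andP[u0 ul] <-]|[u /= /andP[u0 ul] <-]].
    by exists (s + u); [rewrite /=; apply/andP; split; lra|exact: fwd].
  by exists (s - u); [rewrite /=; apply/andP; split; lra|exact: bwd].
Qed.

Lemma cont_arc_pt a (A : set R) : cont_on A (arc_pt a).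
Proof.
by apply: cont_on_vecD; apply: cont_onZ; try exact: cont_on_cst;
  apply: continuous_cont_on; [exact: continuous_cos|exact: continuous_sin].
Qed.

(** The inner product with [v] attains its maximum on the arc. *)
Lemma arc_away a v : dotp v v = 1 -> ~ arc_set a v ->
  exists2 k : R, k < 1 & forall y, arc_set a y -> dotp y v <= k.
Proof.
move=> vv nv; have l0 := arc_len_gt0 a.
have c : {within `[0, arc_len a], continuous (fun u => dotp (arc_pt a u) v)}.
  by apply/cont_onP; apply: cont_on_dotp; [exact: cont_arc_pt|exact: cont_on_cst].
have [u uI hu] := EVT_max (ltW l0) c; rewrite in_itv /= in uI.
exists (dotp (arc_pt a u) v); last first.
  by move=> y [s /= sI <-]; apply: hu; rewrite in_itv.
have /andP[_ h] := dotp_unit_bound (arc_pt1 a u) vv.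
rewrite lt_neqAle h andbT; apply/eqP => e; apply: nv.
by rewrite -(unit_eq (arc_pt1 a u) vv e); exists u.
Qed.

End Arcs.

(** * Networks of great circles and arcs *)

Section Circle.
Variables (R : realType) (n : nat).
Local Notation V := 'rV[R]_n.

Lemma plane_span (P : {vspace V}) (a b : V) : \dim P = 2%N ->
  a \in P -> b \in P -> dotp a a = 1 -> dotp b b = 1 -> dotp a b = 0 ->
  forall x, x \in P <-> exists s t : R, x = s *: a + t *: b.
Proof.
move=> dP aP bP aa bb ab.
have a0 : a != 0 by apply/eqP => e; move: aa; rewrite e dotp0l => /eqP; rewrite eq_sym oner_eq0.
have b0 : b != 0 by apply/eqP => e; move: bb; rewrite e dotp0l => /eqP; rewrite eq_sym oner_eq0.
have fr : free [:: a; b].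
  rewrite free_cons span_seq1 seq1_free b0 andbT; apply/negP => /vlineP [k e].
  by move: aa; rewrite {1}e dotpZl (dotpC b) ab mulr0 => /eqP; rewrite eq_sym oner_eq0.
have <- : <<[:: a; b]>>%VS = P.
  apply/eqP; rewrite eqEdim dP (eqP fr) /= leqnn andbT.
  by apply/span_subvP => x; rewrite !inE => /orP[]/eqP ->.
move=> x; rewrite span_cons span_seq1; split.
  move=> /memv_addP [u /vlineP [s ->] [w /vlineP [t ->] ->]]; by exists s, t.
by move=> [s [t ->]]; apply: memv_add; apply/vlineP; [exists s|exists t].
Qed.

Lemma circle_frame (G : set V) (v : V) : is_great_circle G -> G v ->
  exists t : V, [/\ dotp t t = 1, dotp v t = 0 &
    forall y, dotp y y = 1 -> G y <-> exists r s : R, y = r *: v + s *: t].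
Proof.
move=> [P [dP ->]] [/= v1 vP]; have vv := (enorm1P v).1 v1.
have [x xP xv] : exists2 x, x \in P & x \notin <[v]>%VS.
  apply/subvPn; apply/negP => /dimvS; rewrite dP dim_vline.
  by case: (v != 0).
pose w := x - dotp x v *: v.
have w0 : w != 0.
  apply: contra xv; rewrite subr_eq0 => /eqP ->; exact/vlineP/ex_intro.
have wP : w \in P by rewrite memvB // memvZ.
have vw : dotp v w = 0 by rewrite dotpDr dotpNr dotpZr vv (dotpC v) mulr1 subrr.
have wn := enorm_gt0 w0.
pose t := (enorm w)^-1 *: w.
have tP : t \in P by rewrite memvZ.
have tt : dotp t t = 1.
  by rewrite dotpZl dotpZr -enorm_sqr; field; rewrite gt_eqF.
have vt : dotp v t = 0 by rewrite dotpZr vw mulr0.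
exists t; split=> // y yy; have h := plane_span dP vP tP vv tt vt y.
split; first by move=> [_ /h].
by move=> /h yP; split=> //=; apply/enorm1P.
Qed.

End Circle.

Lemma card3P (T : finType) (A : pred T) : #|A| = 3%N ->
  exists e : 'I_3 -> T, injective e /\ forall x, A x <-> exists k, x = e k.
Proof.
move=> cA; exists (fun k => enum_val (cast_ord (esym cA) k)); split.
  by move=> k l /enum_val_inj /cast_ord_inj.
move=> x; split.
  move=> Ax; have Ax' : x \in A by [].
  exists (cast_ord cA (enum_rank_in Ax' x)).
  by rewrite cast_ordK enum_rankK_in.
by move=> [k ->]; exact: (enum_valP (cast_ord (esym cA) k)).
Qed.

(** Distances on the sphere are measured by inner products: an inner product
   above [k], with [k < 1], means proximity. This lemma intersects finitely many
   such neighborhoods. *)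
Lemma finite_bound_lt1 (R : realType) (T : finType) (P : T -> R -> Prop) :
  (forall i k k', P i k -> k <= k' -> P i k') ->
  (forall i, exists2 k : R, k < 1 & P i k) ->
  exists2 k : R, k < 1 & forall i, P i k.
Proof.
move=> mono h.
suff [k k1 hk] : exists2 k : R, k < 1 & forall i, i \in enum T -> P i k.
  by exists k => // i; apply: hk; rewrite mem_enum.
elim: (enum T) => [|i s [k k1 IH]]; first by exists 0.
have [k' k'1 hk'] := h i; exists (Num.max k k'); first by rewrite gt_max k1.
move=> j; rewrite inE => /orP[/eqP ->|/IH hj].
  by apply: mono hk' _; rewrite le_max lexx orbT.
by apply: mono hj _; rewrite le_max lexx.
Qed.

(** The conditions of [is_net120], with arcs and circles indexed by arbitrary
   finite types. The product of two planar stars has its arcs indexed by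
   pairs. *)
Definition net (R : realType) (n : nat) (I J : finType) (G : I -> set 'rV[R]_n)
    (a : J -> great_arc R n) (X : set 'rV[R]_n) : Prop :=
  [/\ (forall i, is_great_circle (G i)) /\
      X = (\bigcup_i G i) `|` (\bigcup_i arc_set (a i)),
      forall i, at_positive_distance (G i) (X `\` G i),
      forall i j, i != j ->
        arc_set (a i) `&` arc_set (a j) `<=` arc_ends (a i) `&` arc_ends (a j),
      forall i b,
        #|[pred e : J * bool | arc_end (a e.1) e.2 == arc_end (a i) b]| = 3%N
    & forall i b j c, (i, b) != (j, c) ->
        arc_end (a i) b = arc_end (a j) c ->
        angle (arc_tangent (a i) b) (arc_tangent (a j) c) = angle120 R].

Lemma small_angle (R : realType) (k L : R) : k < 1 -> 0 < L ->
  exists d : R, [/\ 0 < d, d < pi, d <= L & k < cos d].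
Proof.
move=> k1 L0; have pi0 := pi_gt0 R.
pose c := (1 + Num.max k 0) / 2.
have [k0 kk] : 0 <= Num.max k 0 /\ k <= Num.max k 0 by rewrite !le_max !lexx orbT.
have m1 : Num.max k 0 < 1 by rewrite gt_max k1 ltr01.
have c1 : -1 <= c <= 1 by rewrite /c; apply/andP; split; lra.
have c11 : -1 <= c < 1 by rewrite /c; apply/andP; split; lra.
have c12 : -1 < c <= 1 by rewrite /c; apply/andP; split; lra.
have d0 := acos_gt0 c11; have dpi := acos_ltpi c12.
have cd : cos (acos c) = c by rewrite acosK // in_itv.
have kc : k < c by rewrite /c; lra.
have [dL|Ld] := leP (acos c) L; first by exists (acos c); rewrite cd.
exists L; split=> //; first exact: lt_trans dpi.
have Li : L \in `[0, pi] by rewrite in_itv /= !ltW // (lt_trans Ld).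
have ai : acos c \in `[0, pi] by rewrite in_itv /= !ltW.
by apply: lt_trans kc _; rewrite -{1}cd ltr_cos.
Qed.

Section Net.
Variables (R : realType) (n : nat) (I J : finType).
Variables (G : I -> set 'rV[R]_n) (a : J -> great_arc R n) (X : set 'rV[R]_n).
Hypothesis hX : net G a X.
Local Notation V := 'rV[R]_n.

Let circ i : is_great_circle (G i). Proof. by case: hX => -[]. Qed.
Let XE : X = (\bigcup_i G i) `|` (\bigcup_i arc_set (a i)). Proof. by case: hX => -[]. Qed.

Definition is_end (v : V) := exists j b, arc_end (a j) b = v.
Definition arc_inner j (v : V) := exists2 s : R, 0 < s < arc_len (a j) & v = arc_pt (a j) s.

Lemma circ_unit i y : G i y -> dotp y y = 1.
Proof. by have [P [_ ->]] := circ i; move=> [/= /enorm1P]. Qed.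

Lemma arc_set_unit j y : arc_set (a j) y -> dotp y y = 1.
Proof. by move=> [s _ <-]; exact: arc_pt1. Qed.

Lemma net_unit y : X y -> dotp y y = 1.
Proof.
by rewrite XE => -[[i _ /circ_unit]|[j _ /arc_set_unit]].
Qed.

Lemma arc_in_net j y : arc_set (a j) y -> X y.
Proof. by rewrite XE; right; exists j. Qed.

Lemma circ_in_net i y : G i y -> X y.
Proof. by rewrite XE; left; exists i. Qed.

Lemma end_in_net v : is_end v -> X v.
Proof. by move=> [j [b <-]]; apply: (@arc_in_net j); exact: arc_set_end. Qed.

(** The circle is at positive distance from the rest of the network. *)
Lemma circ_isolated i v : G i v ->
  exists2 k : R, k < 1 & forall y, X y -> k < dotp y v -> G i y.
Proof.
move=> Gv; have [_ /(_ i) [e e0 he] _ _ _] := hX.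
exists (1 - e ^+ 2 / 2); first by have := exprn_gt0 2 e0; lra.
move=> y Xy hy; apply: contrapT => nGy.
have := he v y Gv (conj Xy nGy); apply/negP; rewrite -ltNge enorm_lt_sqr //.
rewrite dotpDl !dotpDr !dotpNl !dotpNr (circ_unit Gv) (net_unit Xy) (dotpC v y); lra.
Qed.

Lemma circ_avoid i v : X v -> ~ G i v ->
  exists2 k : R, k < 1 & forall y, G i y -> dotp y v <= k.
Proof.
move=> Xv nG; have [_ /(_ i) [e e0 he] _ _ _] := hX.
exists (1 - e ^+ 2 / 2); first by have := exprn_gt0 2 e0; lra.
move=> y Gy; have := he y v Gy (conj Xv nG); rewrite leNgt enorm_lt_sqr // -leNgt.
rewrite dotpDl !dotpDr !dotpNl !dotpNr (circ_unit Gy) (net_unit Xv) (dotpC v y); lra.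
Qed.

(** The circle contains all the points of the network that are close to one of
   its points, in particular a second point of the arc, and the two points span
   the plane of the arc. *)
Lemma arc_circ_plane i j v : G i v -> arc_set (a j) v ->
  exists P : {vspace V}, [/\ \dim P = 2%N,
    G i = @unit_sphere R n `&` [set x | x \in P],
    arc_src (a j) \in P & arc_dir (a j) \in P].
Proof.
move=> Gv [s /= s_in sv]; have [P [dP GE]] := circ i.
have [k k1 hk] := circ_isolated Gv.
have vP : arc_pt (a j) s \in P by move: Gv; rewrite sv GE => -[].
(* a nearby point of the arc is on the circle as well *)
have [u [su sin_us uP]] : exists u : R, [/\ 0 <= u <= arc_len (a j),
    sin (u - s) != 0 & arc_pt (a j) u \in P].
  have l0 := arc_len_gt0 (a j); have L0 : 0 < arc_len (a j) / 2 by rewrite divr_gt0.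
  have [d [d0 dpi dL kd]] := small_angle k1 L0.
  have near_in u : 0 <= u <= arc_len (a j) -> cos (u - s) = cos d ->
      arc_pt (a j) u \in P.
    move=> u_in e; have : G i (arc_pt (a j) u).
      by apply: hk; [apply: (@arc_in_net j); exists u|rewrite -sv arc_pt_dotp e].
    by rewrite GE => -[].
  have sd : sin d != 0 by rewrite gt_eqF // sin_gt0_pi // d0.
  have /andP[s0 sl] := s_in.
  have [sL|Ls] := leP s (arc_len (a j) / 2).
    have e : s + d - s = d by rewrite addrAC subrr add0r.
    have u_in : 0 <= s + d <= arc_len (a j) by apply/andP; split; lra.
    by exists (s + d); split=> //; [rewrite e|apply: near_in => //; rewrite e].
  have e : s - d - s = - d by rewrite addrAC subrr add0r.
  have u_in : 0 <= s - d <= arc_len (a j) by apply/andP; split; lra.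
  exists (s - d); split=> //; first by rewrite e sinN oppr_eq0.
  by apply: near_in => //; rewrite e cosN.
have comb (x y : R) (w : V) : sin (u - s) *: w =
    x *: arc_pt (a j) s + y *: arc_pt (a j) u -> w \in P.
  move=> e; rewrite -[w]scale1r -(mulVf sin_us) -scalerA e.
  by rewrite memvZ // memvD // memvZ.
exists P; split=> //.
  apply: (@comb (sin u) (- sin s)); rewrite sinB /arc_pt.
  by apply/rowP => l; rewrite !mxE; ring.
apply: (@comb (- cos u) (cos s)); rewrite sinB /arc_pt.
by apply/rowP => l; rewrite !mxE; ring.
Qed.

Lemma end_star v : is_end v -> exists e : 'I_3 -> J * bool,
  injective e /\ forall j b, arc_end (a j) b = v <-> exists k, (j, b) = e k.
Proof.
move=> [j [b <-]]; have [_ _ _ /(_ j b) /card3P[e [ei he]] _] := hX.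
by exists e; split=> // j' b'; rewrite -he /=; split=> /eqP.
Qed.

Lemma star_tangents v (e : 'I_3 -> J * bool) : injective e ->
  (forall j b, arc_end (a j) b = v <-> exists k, (j, b) = e k) ->
  let t k := arc_tangent (a (e k).1) (e k).2 in
  [/\ forall k, arc_end (a (e k).1) (e k).2 = v, forall k, dotp v (t k) = 0 &
    forall k l, dotp (t k) (t l) = if k == l then 1 else - 2^-1].
Proof.
move=> ei he t.
have ev k : arc_end (a (e k).1) (e k).2 = v.
  by apply/he; exists k; rewrite -surjective_pairing.
split=> // [k|k l]; first by rewrite -(ev k) arc_end_tangent.
case: eqVneq => [->|kl]; first exact: arc_tangent1.
apply: angle120P; try exact: arc_tangent1.
have [_ _ _ _ h] := hX; apply: h; last by rewrite !ev.
by rewrite -!surjective_pairing (inj_eq ei).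
Qed.

(** Otherwise, by [arc_circ_plane], the three arcs that meet at an end of the arc
   would all lie in the plane of the circle; but in this plane only two
   directions are orthogonal to the common end point. *)
Lemma circ_arc_disjoint i j v : G i v -> ~ arc_set (a j) v.
Proof.
move=> Gv av; have [P [dP GE sP dP']] := arc_circ_plane Gv av.
have eP b : arc_end (a j) b \in P by rewrite /arc_end /arc_pt memvD // memvZ.
have Ge : G i (arc_end (a j) false).
  by rewrite GE; split=> //=; apply/enorm1P; exact: arc_pt1.
have end_e : is_end (arc_end (a j) false) by exists j, false.
have [e [ei he]] := end_star end_e.
have [ev vt tt] := star_tangents ei he.
have tP k : arc_tangent (a (e k).1) (e k).2 \in P.
  have [|Q [dQ GQ sQ dQ']] := @arc_circ_plane i (e k).1 (arc_end (a j) false) Ge.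
    by rewrite -(ev k); exact: arc_set_end.
  have PQ x : dotp x x = 1 -> x \in Q -> x \in P.
    move=> xx xQ; have : G i x by rewrite GQ; split=> //=; apply/enorm1P.
    by rewrite GE => -[].
  apply: PQ; first exact: arc_tangent1.
  rewrite /arc_tangent; case: ((e k).2) => //.
  by rewrite memvB // memvZ.
have [/(_ (tP 1)) [r [s E]] _] := plane_span dP (eP false) (tP 0) (arc_pt1 _ _)
  (arc_tangent1 _ _) (vt 0) (arc_tangent (a (e 1).1) (e 1).2).
have r0 : r = 0.
  have := vt 1; rewrite E dotpDr !dotpZr (vt 0) arc_pt1.
  by rewrite mulr1 mulr0 addr0.
have t01 := tt 0 1; have t11 := tt 1 1.
move: t01 t11; rewrite /= E r0 scale0r add0r !dotpZr !dotpZl tt /=.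
by rewrite mulr1 => ->; lra.
Qed.

End Net.

Lemma cos_lt1 (R : realType) (u : R) : 0 < u -> u < 2 * pi -> cos u < 1.
Proof.
move=> u0 u2; rewrite lt_neqAle cos_le1 andbT; apply/eqP => h.
have hu : - (2 * pi) < u < 2 * pi.
  by have := pi_gt0 R => pi0; apply/andP; split; lra.
by move: (cos_eq1 hu h) => e; rewrite e ltxx in u0.
Qed.

(** * Local structure of a network *)

Section NetLocal.
Variables (R : realType) (n : nat) (I J : finType).
Variables (G : I -> set 'rV[R]_n) (a : J -> great_arc R n) (X : set 'rV[R]_n).
Hypothesis hX : net G a X.
Local Notation V := 'rV[R]_n.
Local Notation is_end := (is_end a).
Local Notation arc_inner := (arc_inner a).

Let XE : X = (\bigcup_i G i) `|` (\bigcup_i arc_set (a i)). Proof. by case: hX => -[]. Qed.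

Lemma inner_in_arc j v : arc_inner j v -> arc_set (a j) v.
Proof. by move=> [s /andP[s0 sl] ->]; exists s => //=; rewrite !ltW. Qed.

(** The other arcs meet this one at its ends only, and an arc shorter than a full
   circle is injectively parametrized. *)
Lemma inner_not_end j v : arc_inner j v -> ~ is_end v.
Proof.
move=> [s s_in e] [j' [b eb]].
have l0 := arc_len_gt0 (a j); have /andP[s0 sl] := s_in.
have own b' : arc_end (a j) b' <> v.
  rewrite e => /arc_pt_inj; case: b'; rewrite ?lexx !ltW // => /(_ isT isT) h;
    by rewrite h ltxx in s0 sl.
have [jj|jj] := eqVneq j j'; first by subst j'; exact: own eb.
have [_ _ /(_ j j' jj) h _ _] := hX.
have [|[b' _ hb] _] := h v; last exact: own hb.
by split; [apply: inner_in_arc; exists s|rewrite -eb; exact: arc_set_end].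
Qed.

Lemma arc_set_cases j v : arc_set (a j) v ->
  (exists b, arc_end (a j) b = v) \/ arc_inner j v.
Proof.
move=> [s /= /andP[s0 sl] <-].
have [->|s0'] := eqVneq s 0; first by left; exists false.
have [->|sl'] := eqVneq s (arc_len (a j)); first by left; exists true.
by right; exists s => //; rewrite !lt_neqAle s0 sl sl' eq_sym s0'.
Qed.

Lemma inner_uniq j j' v : arc_inner j v -> arc_set (a j') v -> j = j'.
Proof.
move=> hj /arc_set_cases[[b eb]|hj']; first by case: (inner_not_end hj); exists j', b.
apply/eqP/negPn/negP => jj; have [_ _ /(_ j j' jj) h _ _] := hX.
have [|[b _ hb] _] := h v; first by split; exact: inner_in_arc.
by case: (inner_not_end hj); exists j, b.
Qed.

Lemma net_cases v : X v -> [\/ is_end v, exists j, arc_inner j v | exists i, G i v].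
Proof.
rewrite XE => -[[i _ Gi]|[j _ /arc_set_cases[[b eb]|hj]]].
- by constructor 3; exists i.
- by constructor 1; exists j, b.
- by constructor 2; exists j.
Qed.

Lemma ends_isolated v : dotp v v = 1 -> exists2 k : R, k < 1 &
  forall y, is_end y -> k < dotp y v -> y = v.
Proof.
move=> vv; have [k k1 hk] : exists2 k : R, k < 1 & forall e : J * bool,
    arc_end (a e.1) e.2 = v \/ dotp (arc_end (a e.1) e.2) v <= k.
  apply: finite_bound_lt1 => [e k k' [->|h] kk|e]; [by left|by right; exact: le_trans kk|].
  have [h|h] := eqVneq (arc_end (a e.1) e.2) v; first by exists 0 => //; left.
  exists (dotp (arc_end (a e.1) e.2) v); last by right.
  have /andP[_ h1] := dotp_unit_bound (arc_end1 (a e.1) e.2) vv.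
  rewrite lt_neqAle h1 andbT; apply: contra h => /eqP h2; apply/eqP.
  exact: unit_eq (arc_end1 _ _) vv h2.
exists k => // y [j [b <-]]; have [//|h] := hk (j, b).
by rewrite ltNge h.
Qed.

(** The finitely many arcs and circles that avoid [v] are at positive distance
   from it. *)
Lemma net_through v : X v -> exists2 k : R, k < 1 & forall y, k < dotp y v ->
  (forall j, arc_set (a j) y -> arc_set (a j) v) /\ (forall i, G i y -> G i v).
Proof.
move=> Xv; have vv := net_unit hX Xv.
have [k k1 hk] : exists2 k : R, k < 1 & forall j,
    arc_set (a j) v \/ forall y, arc_set (a j) y -> dotp y v <= k.
  apply: finite_bound_lt1 => [j k k' [h|h] kk|j]; [by left| |].
    by right=> y /h h'; exact: le_trans kk.
  have [h|h] := pselect (arc_set (a j) v); first by exists 0 => //; left.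
  by have [k k1 hk] := arc_away vv h; exists k => //; right.
have [k' k1' hk'] : exists2 k : R, k < 1 & forall i,
    G i v \/ forall y, G i y -> dotp y v <= k.
  apply: finite_bound_lt1 => [i l l' [h|h] kk|i]; [by left| |].
    by right=> y /h h'; exact: le_trans kk.
  have [h|h] := pselect (G i v); first by exists 0 => //; left.
  by have [l l1 hl] := circ_avoid hX Xv h; exists l => //; right.
exists (Num.max k k'); first by rewrite gt_max k1.
move=> y; rewrite gt_max => /andP[yk yk']; split.
- by move=> j hj; have [//|/(_ y hj)] := hk j; rewrite leNgt yk.
- by move=> i hi; have [//|/(_ y hi)] := hk' i; rewrite leNgt yk'.
Qed.

Definition flat_trace (v t y : V) := exists r s : R, y = r *: v + s *: t.

Lemma halfarc_pair_local (v t : V) (l l' : R) : dotp v v = 1 -> dotp t t = 1 ->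
  dotp v t = 0 -> 0 < l < 2 * pi -> 0 < l' < 2 * pi -> exists2 k : R, k < 1 &
  forall y, dotp y y = 1 -> k < dotp y v ->
    (halfarc v t l `|` halfarc v (- t) l') y <-> flat_trace v t y.
Proof.
move=> vv tt vt /andP[l0 l2] /andP[l0' l2'].
exists (Num.max (cos l) (cos l')); first by rewrite gt_max !cos_lt1.
move=> y yy; rewrite gt_max => /andP[hl hl'].
have tt' : dotp (- t) (- t) = 1 by rewrite dotpNl dotpNr opprK.
have vt' : dotp v (- t) = 0 by rewrite dotpNr vt oppr0.
have h := halfarc_local vv tt vt l0 l2 yy hl.
have h' := halfarc_local vv tt' vt' l0' l2' yy hl'.
split=> [[/h|/h'] [r [s [_ ->]]]|[r [s e]]].
- by exists r, s.
- by exists r, (- s); rewrite scalerN scaleNr.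
- have [s0|s0] := leP 0 s; [left; apply/h; exists r, s|right; apply/h'; exists r, (- s)].
    by [].
  by rewrite e scalerN scaleNr opprK oppr_ge0 ltW.
Qed.

(** Near an interior point [v] of an arc, no other arc and no circle passes, and
   the two halves of the arc fill the trace of a plane. *)
Lemma inner_local j v : arc_inner j v -> exists (t : V) (k : R),
  [/\ dotp t t = 1, dotp v t = 0, k < 1 & forall y, dotp y y = 1 -> k < dotp y v ->
    (X y <-> flat_trace v t y) /\ (X y -> arc_inner j y)].
Proof.
move=> hj; have [s s_in e] := hj; have /andP[s0 sl] := s_in.
have l2 := arc_len_lt (a j).
have Xv : X v by apply: (arc_in_net hX); exact: inner_in_arc hj.
have vv := net_unit hX Xv.
pose t := cos s *: arc_dir (a j) - sin s *: arc_src (a j).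
have tt : dotp t t = 1.
  rewrite /t -scaleNr frame_dotp ?arc_dir1 ?arc_src1 ?sqrrN ?cos2Dsin2 //.
  by rewrite dotpC arc_src_dir.
have vt : dotp v t = 0.
  rewrite e /t /arc_pt -scaleNr dotpDl !dotpDr !dotpZl !dotpZr arc_dir1 arc_src1.
  by rewrite (dotpC (arc_dir _)) arc_src_dir; ring.
have [k1 k11 h1] := net_through Xv.
have [k2 k21 h2] := ends_isolated vv.
have [||k3 k31 h3] := @halfarc_pair_local v t (arc_len (a j) - s) s vv tt vt.
- by apply/andP; split; lra.
- by apply/andP; split; lra.
have aE := arc_set_splitE s_in; rewrite -/t -e in aE.
exists t, (Num.max k1 (Num.max k2 k3)); split=> //; first by rewrite !gt_max k11 k21.
move=> y yy; rewrite !gt_max => /and3P[y1 y2 y3].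
have Xa : X y <-> arc_set (a j) y.
  split; last by move/(arc_in_net hX).
  have [ha hg] := h1 y y1; rewrite {1}XE => -[[i _ /hg Gv]|[j' _ hj']].
    by case: (circ_arc_disjoint hX Gv (inner_in_arc hj)).
  by rewrite (inner_uniq hj (ha _ hj')).
rewrite Xa -h3 // -aE; split=> // hy.
have [[b eb]|//] := arc_set_cases hy.
have ev : y = v by apply: h2 => //; exists j, b.
by case: (inner_not_end hj); exists j, b; rewrite eb.
Qed.

(** Near [v] the network is the circle, by [circ_isolated]. *)
Lemma circ_local i v : G i v -> exists (t : V) (k : R),
  [/\ dotp t t = 1, dotp v t = 0, k < 1 & forall y, dotp y y = 1 -> k < dotp y v ->
    (X y <-> flat_trace v t y) /\ (X y -> G i y)].
Proof.
move=> Gv; have [[gc _] _ _ _ _] := hX.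
have [t [tt vt ht]] := circle_frame (gc i) Gv.
have [k k1 hk] := circ_isolated hX Gv.
exists t, k; split=> // y yy yk; have XG : X y <-> G i y.
  by split=> [Xy|]; [exact: hk|by move/(circ_in_net hX)].
by rewrite XG; split=> //; exact: ht.
Qed.

(** The only arcs near a vertex are the three arcs that end there, and each one is
   the trace of a half-plane by [halfarc_local]. *)
Lemma end_local v : is_end v -> exists (t : 'I_3 -> V) (k : R),
  [/\ forall l, dotp v (t l) = 0,
      forall l l', dotp (t l) (t l') = if l == l' then 1 else - 2^-1, k < 1 &
  forall y, dotp y y = 1 -> k < dotp y v ->
    X y <-> exists l (r s : R), 0 <= s /\ y = r *: v + s *: t l].
Proof.
move=> hv; have Xv := end_in_net hX hv; have vv := net_unit hX Xv.
have [e [ei he]] := end_star hX hv.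
have [ev vt tt] := star_tangents hX ei he.
pose t k := arc_tangent (a (e k).1) (e k).2.
have [k1 k11 h1] := net_through Xv.
have [k2 k21 h2] : exists2 k : R, k < 1 & forall j, cos (arc_len (a j)) <= k.
  apply: finite_bound_lt1 => [j k k'|j]; first exact: le_trans.
  exists (cos (arc_len (a j))) => //.
  by apply: cos_lt1; [exact: arc_len_gt0|exact: arc_len_lt].
exists t, (Num.max k1 k2); split=> //; first by rewrite gt_max k11.
move=> y yy; rewrite gt_max => /andP[y1 y2].
have loc l : arc_set (a (e l).1) y <-> exists r s : R, 0 <= s /\ y = r *: v + s *: t l.
  rewrite (arc_setE _ (e l).2) ev; apply: halfarc_local => //.
  - exact: arc_tangent1.
  - exact: arc_len_gt0.
  - exact: arc_len_lt.
  - exact: le_lt_trans (h2 _) y2.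
split.
- have [ha hg] := h1 y y1; rewrite {1}XE => -[[i _ /hg Gv]|[j _ hj]].
    have [j [b eb]] := hv; case: (circ_arc_disjoint hX Gv (j := j)).
    by rewrite -eb; exact: arc_set_end.
  have [[b eb]|hi] := arc_set_cases (ha _ hj); last by case: (inner_not_end hi).
  have [l el] := (he j b).1 eb; exists l; apply/loc; by rewrite -el.
- by move=> [l /loc /(arc_in_net hX)].
Qed.

End NetLocal.

(** * Local structure of the cone over a network *)

Section Direction.
Variables (R : realType) (n : nat).
Local Notation V := 'rV[R]_n.
Implicit Types (x y v : V).

Definition dir x : V := (enorm x)^-1 *: x.

Lemma dirK x : x != 0 -> enorm x *: dir x = x.
Proof. by move=> x0; rewrite scalerA divff ?scale1r // gt_eqF // enorm_gt0. Qed.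

Lemma dir_unit x : x != 0 -> dotp (dir x) (dir x) = 1.
Proof.
by move=> x0; rewrite dotpZl dotpZr -enorm_sqr; field; rewrite gt_eqF ?enorm_gt0.
Qed.

Lemma unit_neq0 v : dotp v v = 1 -> v != 0.
Proof. by move=> vv; apply/eqP => e; move: vv; rewrite e dotp0l => /esym/eqP; rewrite oner_eq0. Qed.

Lemma scale_unit_neq0 (t : R) v : 0 < t -> dotp v v = 1 -> t *: v != 0.
Proof. by move=> t0 /unit_neq0 v0; rewrite scaler_eq0 negb_or v0 gt_eqF. Qed.

Lemma dir_scale (t : R) v : 0 < t -> dotp v v = 1 -> dir (t *: v) = v.
Proof.
move=> t0 vv; rewrite /dir enormZ (enorm1P v).2 // mulr1 gtr0_norm //.
by rewrite scalerA mulVf ?scale1r // gt_eqF.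
Qed.

(** Continuity of [dir], in the form used for sets that are described on the
   sphere by inner products. *)
Lemma dir_near x (k : R) : x != 0 -> k < 1 -> exists2 d : R, 0 < d &
  forall y, enorm (y - x) < d -> y != 0 /\ k < dotp (dir y) (dir x).
Proof.
move=> x0 k1; have xn := enorm_gt0 x0; have dx := dir_unit x0.
pose k' := Num.max k 0.
have [k0 kk] : 0 <= k' /\ k <= k' by rewrite !le_max !lexx orbT.
have k'1 : k' < 1 by rewrite gt_max k1 ltr01.
pose d := enorm x * (1 - k') / 4.
have d0 : 0 < d by rewrite /d !mulr_gt0 ?invr_gt0 //; lra.
exists d => // y hy.
have n1 : enorm y <= enorm x + d.
  have := enormD x (y - x); rewrite addrC subrK => h; apply: le_trans h _.
  by rewrite lerD2l ltW.
have p1 : enorm x - d < dotp y (dir x).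
  have -> : dotp y (dir x) = dotp (y - x) (dir x) + enorm x.
    have e : dotp x (dir x) = enorm x by rewrite -{1}(dirK x0) dotpZl dx mulr1.
    by rewrite dotpDl dotpNl e subrK.
  have := cauchy_schwarz (- (y - x)) (dir x); rewrite dotpNl enormN.
  rewrite (enorm1P (dir x)).2 // mulr1; lra.
have kx : 0 <= k' * enorm x by rewrite mulr_ge0 // ltW.
have main : k' * enorm y < dotp y (dir x).
  apply: le_lt_trans p1; apply: le_trans (_ : k' * (enorm x + d) <= _).
    by rewrite ler_wpM2l.
  by move: d0; rewrite /d => d0; nra.
have y0 : y != 0.
  apply/eqP => e; move: main; rewrite e dotp0l enorm0 mulr0 ltxx //.
split=> //; rewrite /dir dotpZl mulrC ltr_pdivlMr ?enorm_gt0 //.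
by apply: le_lt_trans main; rewrite ler_wpM2r ?enorm_ge0.
Qed.

Lemma dir_frame x y (t : V) (r s : R) : x != 0 -> y != 0 ->
  dir y = r *: dir x + s *: t ->
  y = x + ((enorm y * r - enorm x) *: dir x + (enorm y * s) *: t).
Proof.
move=> x0 y0; move: (enorm x) (dir x) (dirK x0) => N u <-.
move: (enorm y) (dir y) (dirK y0) => M w <- ->.
by apply/rowP => k; rewrite !mxE; ring.
Qed.

Lemma frame_dir x y (t : V) (r s : R) : x != 0 -> y = x + (r *: dir x + s *: t) ->
  dir y = ((enorm y)^-1 * (enorm x + r)) *: dir x + ((enorm y)^-1 * s) *: t.
Proof.
move=> x0 e; have -> : dir y = (enorm y)^-1 *: (x + (r *: dir x + s *: t)).
  by rewrite -e.
move: ((enorm y)^-1) => M; clear e; move: (enorm x) (dir x) (dirK x0) => N u <-.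
by apply/rowP => k; rewrite !mxE; ring.
Qed.

End Direction.

Section Cone.
Variables (R : realType) (n : nat) (I J : finType).
Variables (G : I -> set 'rV[R]_n) (a : J -> great_arc R n) (X C : set 'rV[R]_n).
Hypothesis hX : net G a X.
Hypothesis C_cone : is_cone C.
Hypothesis CX : C `&` @unit_sphere R n = X.
Local Notation V := 'rV[R]_n.
Local Notation is_end := (is_end a).
Local Notation arc_inner := (arc_inner a).

Lemma cone_dir x : x != 0 -> C x <-> X (dir x).
Proof.
move=> x0; rewrite -CX; have xn := enorm_gt0 x0; split.
  move=> Cx; split; last exact/enorm1P/dir_unit.
  by apply: C_cone => //; rewrite invr_gt0.
by move=> [Cd _]; rewrite -(dirK x0); exact: C_cone.
Qed.

Lemma end_triple x : x != 0 -> is_end (dir x) -> triple_at C x.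
Proof.
move=> x0 hv; have [t [k [vt tt k1 hk]]] := end_local hX hv.
have [d d0 hd] := dir_near x0 k1.
exists (dir x), t, d; split=> //; first exact: dir_unit.
move=> y /hd [y0 yk]; rewrite cone_dir // hk ?dir_unit //.
have yn := enorm_gt0 y0; split=> [[l [r [s [s0 e]]]]|[l [r [s [s0 e]]]]]; exists l.
- exists (enorm y * r - enorm x), (enorm y * s); split; first by rewrite mulr_ge0 // ltW.
  exact: dir_frame.
- exists ((enorm y)^-1 * (enorm x + r)), ((enorm y)^-1 * s).
  split; first by rewrite mulr_ge0 // invr_ge0 ltW.
  exact: frame_dir.
Qed.

Lemma flat_planar x (t : V) (k : R) : x != 0 -> dotp t t = 1 ->
  dotp (dir x) t = 0 -> k < 1 -> (forall y, dotp y y = 1 -> k < dotp y (dir x) ->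
    (X y <-> flat_trace (dir x) t y)) -> planar_at C x.
Proof.
move=> x0 tt vt k1 hk; have [d d0 hd] := dir_near x0 k1.
exists (dir x), t, d; split=> //; first exact: dir_unit.
move=> y /hd [y0 yk]; rewrite cone_dir // hk ?dir_unit //.
have yn := enorm_gt0 y0; split=> [[r [s e]]|[r [s e]]].
- exists (enorm y * r - enorm x), (enorm y * s).
  exact: dir_frame.
- exists ((enorm y)^-1 * (enorm x + r)), ((enorm y)^-1 * s).
  exact: frame_dir.
Qed.

Lemma regular_planar x : x != 0 -> C x -> ~ is_end (dir x) -> planar_at C x.
Proof.
move=> x0 /(cone_dir x0) /(net_cases hX)[//|[j hj]|[i hi]] _.
  have [t [k [tt vt k1 hk]]] := inner_local hX hj.
  by apply: (flat_planar x0 tt vt k1) => y yy /(hk y yy)[].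
have [t [k [tt vt k1 hk]]] := circ_local hX hi.
by apply: (flat_planar x0 tt vt k1) => y yy /(hk y yy)[].
Qed.

Lemma sector_open j x : x != 0 -> arc_inner j (dir x) -> exists2 d : R, 0 < d &
  forall y, C y -> enorm (y - x) < d -> arc_inner j (dir y).
Proof.
move=> x0 hj; have [t [k [tt vt k1 hk]]] := inner_local hX hj.
have [d d0 hd] := dir_near x0 k1; exists d => // y Cy /hd [y0 yk].
by have [_] := hk _ (dir_unit y0) yk; apply; exact/cone_dir.
Qed.

Lemma circ_open i x : x != 0 -> G i (dir x) -> exists2 d : R, 0 < d &
  forall y, C y -> enorm (y - x) < d -> G i (dir y).
Proof.
move=> x0 hi; have [t [k [tt vt k1 hk]]] := circ_local hX hi.
have [d d0 hd] := dir_near x0 k1; exists d => // y Cy /hd [y0 yk].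
by have [_] := hk _ (dir_unit y0) yk; apply; exact/cone_dir.
Qed.

Lemma end_open x : x != 0 -> exists2 d : R, 0 < d & forall y,
  enorm (y - x) < d -> y != 0 /\ (is_end (dir y) -> dir y = dir x).
Proof.
move=> x0; have [k k1 hk] := ends_isolated a (dir_unit x0).
have [d d0 hd] := dir_near x0 k1; exists d => // y /hd [y0 yk].
by split=> // hy; exact: hk.
Qed.

(** The closed arcs and the circles span closed cones. *)
Lemma pieces_closed x : x != 0 -> C x -> exists2 d : R, 0 < d & forall y,
  enorm (y - x) < d -> (forall j, arc_set (a j) (dir y) -> arc_set (a j) (dir x)) /\
                       (forall i, G i (dir y) -> G i (dir x)).
Proof.
move=> x0 /(cone_dir x0) Xx; have [k k1 hk] := net_through hX Xx.
have [d d0 hd] := dir_near x0 k1; exists d => // y /hd [y0 yk].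
by have [] := hk _ yk.
Qed.

End Cone.

Lemma dist_unit (R : realType) n (x y : 'rV[R]_n) : dotp x x = 1 -> dotp y y = 1 ->
  dotp (x - y) (x - y) = 2 - 2 * dotp x y.
Proof.
by move=> xx yy; rewrite dotpDl !dotpDr !dotpNl !dotpNr xx yy (dotpC y x); ring.
Qed.

Lemma arc_inner_near_end (R : realType) n (J : finType) (a : J -> great_arc R n) j b (d : R) :
  0 < d -> exists q, arc_inner a j q /\ enorm (q - arc_end (a j) b) < d.
Proof.
move=> d0; have l0 := arc_len_gt0 (a j).
have L0 : 0 < arc_len (a j) / 2 by rewrite divr_gt0.
have k1 : 1 - d ^+ 2 / 2 < 1 by have := exprn_gt0 2 d0; lra.
have [u [u0 upi uL hu]] := small_angle k1 L0.
pose s := if b then arc_len (a j) - u else u.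
exists (arc_pt (a j) s); split.
  by exists s => //; rewrite /s; case: b {s}; apply/andP; split; lra.
have h : dotp (arc_pt (a j) s) (arc_end (a j) b) = cos u.
  by rewrite arc_pt_dotp /s; case: b {s}; rewrite ?subr0 // addrAC subrr add0r cosN.
by rewrite enorm_lt_sqr // dist_unit ?arc_pt1 // h; lra.
Qed.

(** * Images of the strata under a homeomorphism *)

Section Paths.
Variable R : realType.

(** Apply the intermediate value theorem to the function that is 1 where [P]
   holds and -1 elsewhere. *)
Lemma locally_constant (P : R -> Prop) :
  (forall s, 0 <= s <= 1 -> exists2 d : R, 0 < d &
    forall s', 0 <= s' <= 1 -> `|s' - s| < d -> (P s' <-> P s)) ->
  P 0 -> P 1.
Proof.
move=> h P0; pose g s : R := if `[< P s >] then 1 else -1.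
have gc : cont_on [set s : R | 0 <= s <= 1] g.
  move=> s s_in; have [d d0 hd] := h s s_in.
  apply: cvg_near_cst; rewrite near_withinE; apply/nbhs_ballP; exists d => //.
  move=> s' /= ss s'_in; rewrite /g; congr (if _ then _ else _).
  by apply: asbool_equiv_eq; apply: hd => //; rewrite distrC.
have := ivt_sign ler01 gc; rewrite /g (asboolT P0) mul1r => h2.
have : 0 < g 1.
  by apply: h2 => s _; case: ifP; rewrite ?oppr_eq0 oner_eq0.
by rewrite /g; case: asboolP => // _; rewrite ltr0N1.
Qed.

Lemma segment_bound (s0 s1 l s : R) : 0 < s0 < l -> 0 < s1 < l -> 0 <= s <= 1 ->
  0 < (1 - s) * s0 + s * s1 < l.
Proof.
move=> /andP[h1 h2] /andP[h3 h4] /andP[h5 h6].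
have h7 : 0 <= 1 - s by lra.
have [d|d] := leP s0 s1.
- have e1 : 0 <= s * (s1 - s0) by rewrite mulr_ge0 // subr_ge0.
  have e2 : 0 <= (1 - s) * (s1 - s0) by rewrite mulr_ge0 // subr_ge0.
  by apply/andP; split; lra.
- have d' := ltW d.
  have e1 : 0 <= s * (s0 - s1) by rewrite mulr_ge0 // subr_ge0.
  have e2 : 0 <= (1 - s) * (s0 - s1) by rewrite mulr_ge0 // subr_ge0.
  by apply/andP; split; lra.
Qed.

Lemma cont_on_segment (A : set R) (s0 s1 : R) : cont_on A (fun s => (1 - s) * s0 + s * s1).
Proof.
apply: cont_onD; apply: cont_onM; try exact: cont_on_cst; last exact: cont_on_id.
by apply: cont_onB; [exact: cont_on_cst|exact: cont_on_id].
Qed.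

End Paths.

Section Pieces.
Variables (R : realType) (m n : nat) (I J I' J' : finType).
Variables (G : I -> set 'rV[R]_m) (a : J -> great_arc R m) (X C : set 'rV[R]_m).
Variables (G' : I' -> set 'rV[R]_n) (a' : J' -> great_arc R n) (X' C' : set 'rV[R]_n).
Variables (f : 'rV[R]_m -> 'rV[R]_n) (g : 'rV[R]_n -> 'rV[R]_m).
Hypotheses (hX : net G a X) (hX' : net G' a' X').
Hypotheses (C_cone : is_cone C) (C'_cone : is_cone C').
Hypotheses (CX : C `&` @unit_sphere R m = X) (CX' : C' `&` @unit_sphere R n = X').
Hypothesis fg : homeo_on C C' f g.

Lemma homeo_on_sym : homeo_on C' C g f.
Proof. by have [? ? ? ?] := fg; split. Qed.

(** Away from the singular rays the cone is a surface: apply [planar_not_triple]. *)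
Lemma end_of_image x : C x -> x != 0 -> f x != 0 ->
  is_end a' (dir (f x)) -> is_end a (dir x).
Proof.
move=> Cx x0 fx0 h; apply: contrapT => nh.
apply: (planar_not_triple fg Cx); first exact: (regular_planar hX C_cone CX).
exact: (end_triple hX' C'_cone CX').
Qed.

Section Path.
Variable p : R -> 'rV[R]_m.
Hypothesis p_cont : cont_on [set s : R | 0 <= s <= 1] p.
Hypothesis p_in : forall s, 0 <= s <= 1 -> [/\ C (p s), p s != 0 & f (p s) != 0].

Let near_image s (d : R) : 0 <= s <= 1 -> 0 < d -> exists2 e : R, 0 < e &
  forall s', 0 <= s' <= 1 -> `|s' - s| < e ->
    C' (f (p s')) /\ enorm (f (p s') - f (p s)) < d.
Proof.
move=> s_in d0; have [cf _ hf _] := fg.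
have cfp : cont_on [set s : R | 0 <= s <= 1] (f \o p).
  by apply: cont_on_comp p_cont cf => u /p_in[].
have : nbhs (f (p s)) [set z | enorm (z - f (p s)) < d] by apply/near_enormP; exists d.
move=> /(cfp s s_in); rewrite /= !nbhs_simpl /within /= => /nbhs_ballP [e e0 he].
exists e => // s' s'_in ss; split; first by have [/hf[]] := p_in s'_in.
by apply: he => //; rewrite /ball /= distrC.
Qed.

(** The open sectors over the arcs are open and closed in the regular part of the
   cone. *)
Lemma path_in_sector j : (forall s, 0 <= s <= 1 -> ~ is_end a' (dir (f (p s)))) ->
  arc_inner a' j (dir (f (p 0))) -> arc_inner a' j (dir (f (p 1))).
Proof.
move=> reg; apply: (@locally_constant R (fun s => arc_inner a' j (dir (f (p s))))).
move=> s s_in; have [Cp p0 fp0] := p_in s_in; have [cf _ hf _] := fg.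
have Cfp : C' (f (p s)) by have [] := hf _ Cp.
have [/(reg s s_in)//|[j0 hj0]|[i hi]] := net_cases hX' ((cone_dir C'_cone CX' fp0).1 Cfp).
- have [d d0 hd] := sector_open hX' C'_cone CX' fp0 hj0.
  have [e e0 he] := near_image s_in d0; exists e => // s' s'_in ss.
  have [h1 h2] := he s' s'_in ss; have hj' := hd _ h1 h2.
  split=> h; first by rewrite (inner_uniq hX' h (inner_in_arc hj')).
  by rewrite (inner_uniq hX' h (inner_in_arc hj0)).
- have [d d0 hd] := circ_open hX' C'_cone CX' fp0 hi.
  have [e e0 he] := near_image s_in d0; exists e => // s' s'_in ss.
  have [h1 h2] := he s' s'_in ss; have hi' := hd _ h1 h2.
  by split=> /inner_in_arc h; [case: (circ_arc_disjoint hX' hi' h)|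
    case: (circ_arc_disjoint hX' hi h)].
Qed.

Lemma path_in_circ i : (forall s, 0 <= s <= 1 -> ~ is_end a' (dir (f (p s)))) ->
  G' i (dir (f (p 0))) -> G' i (dir (f (p 1))).
Proof.
move=> reg; apply: (@locally_constant R (fun s => G' i (dir (f (p s))))).
move=> s s_in; have [Cp p0 fp0] := p_in s_in; have [cf _ hf _] := fg.
have Cfp : C' (f (p s)) by have [] := hf _ Cp.
have [d1 d10 hd1] := pieces_closed hX' C'_cone CX' fp0 Cfp.
have [h|h] := pselect (G' i (dir (f (p s)))).
  have [d d0 hd] := circ_open hX' C'_cone CX' fp0 h.
  have [e e0 he] := near_image s_in d0; exists e => // s' s'_in ss.
  by have [h1 h2] := he s' s'_in ss; split=> // _; exact: hd.
have [e e0 he] := near_image s_in d10; exists e => // s' s'_in ss.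
by have [h1 h2] := he s' s'_in ss; split=> // /((hd1 _ h2).2 i).
Qed.

Lemma path_in_ray : (forall s, 0 <= s <= 1 -> is_end a' (dir (f (p s)))) ->
  dir (f (p 1)) = dir (f (p 0)).
Proof.
move=> sing; apply: (@locally_constant R (fun s => dir (f (p s)) = dir (f (p 0)))) => //.
move=> s s_in; have [Cp p0 fp0] := p_in s_in.
have [d d0 hd] := end_open a' fp0.
have [e e0 he] := near_image s_in d0; exists e => // s' s'_in ss.
have [h1 h2] := he s' s'_in ss; have [_ h3] := hd _ h2.
by rewrite h3 //; exact: sing.
Qed.

End Path.
End Pieces.

(** * The vertex of the cone *)

Section Origin.
Variables (R : realType) (m n : nat) (I J I' J' : finType).
Variables (G : I -> set 'rV[R]_m) (a : J -> great_arc R m) (X C : set 'rV[R]_m).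
Variables (G' : I' -> set 'rV[R]_n) (a' : J' -> great_arc R n) (X' C' : set 'rV[R]_n).
Variables (f : 'rV[R]_m -> 'rV[R]_n) (g : 'rV[R]_n -> 'rV[R]_m).
Hypotheses (hX : net G a X) (hX' : net G' a' X').
Hypotheses (C_cone : is_cone C) (C'_cone : is_cone C').
Hypotheses (CX : C `&` @unit_sphere R m = X) (CX' : C' `&` @unit_sphere R n = X').
Hypothesis fg : homeo_on C C' f g.

(** Two of the three values [t i e] are on the same side of [z]; by the
   intermediate value theorem the function that goes farther takes the other
   value as well. *)
Lemma tripod_not_in_line (t : 'I_3 -> R -> R) (z e : R) : 0 < e ->
  (forall i, cont_on [set s | 0 <= s <= e] (t i)) -> (forall i, t i 0 = z) ->
  (forall i j s, i != j -> 0 <= s <= e -> t j s <> t i e) -> False.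
Proof.
move=> e0 ct t0 inj.
have between i j : i != j -> ~ (Num.min z (t j e) <= t i e <= Num.max z (t j e)).
  move=> ij h; have c : {within `[0, e], continuous (t j)}.
    by apply/cont_onP; apply: cont_on_sub (ct j) => s /=; rewrite in_itv.
  have [|s s_in hs] := @IVT _ (t j) 0 e (t i e) (ltW e0) c; first by rewrite t0.
  by apply: (inj i j s ij) hs; rewrite in_itv in s_in.
have low i j : i != j -> t i e <= z -> t j e <= z -> False.
  move=> ij hi hj; have [h|h] := leP (t i e) (t j e).
    by apply: (between j i); rewrite 1?eq_sym // ge_min le_max h hj orbT.
  by apply: (between i j) => //; rewrite ge_min le_max hi (ltW h) orbT.
have high i j : i != j -> z <= t i e -> z <= t j e -> False.
  move=> ij hi hj; have [h|h] := leP (t i e) (t j e).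
    by apply: (between i j) => //; rewrite ge_min le_max hi h orbT.
  by apply: (between j i); rewrite 1?eq_sym // ge_min le_max hj (ltW h) orbT.
have [h0|/ltW h0] := leP (t 0 e) z; have [h1|/ltW h1] := leP (t 1 e) z;
  have [h2|/ltW h2] := leP (t 2 e) z.
- exact: (low 0 1).
- exact: (low 0 1).
- exact: (low 0 2).
- exact: (high 1 2).
- exact: (low 1 2).
- exact: (high 0 2).
- exact: (high 0 1).
- exact: (high 0 1).
Qed.

(** Three singular rays meet at the origin of [C']; by [end_of_image] the map [g]
   sends their points to singular points. Near a point other than the origin, the
   singular set of [C] is contained in a line, where a tripod does not embed. *)
Lemma origin_fixed (v : 'I_3 -> 'rV[R]_n) : injective v ->
  (forall i, is_end a' (v i)) -> C' 0 -> g 0 = 0.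
Proof.
move=> vi vend C'0; apply/eqP/negPn/negP => z0.
have [cf cg hf hg] := fg.
have vv i := net_unit hX' (end_in_net hX' (vend i)).
have [d d0 hd] := end_open a z0.
have [r r0 hr] := cont_on_epsP cg C'0 d0.
pose e := r / 2; have e0 : 0 < e by rewrite divr_gt0.
have C'v i s : 0 <= s <= e -> C' (s *: v i).
  move=> /andP[s0 se]; have [->|sn] := eqVneq s 0; first by rewrite scale0r.
  apply: C'_cone; first by rewrite lt0r sn.
  by have := end_in_net hX' (vend i); rewrite -CX' => -[].
have gs i s : 0 <= s <= e -> enorm (g (s *: v i) - g 0) < d.
  move=> s_in; apply: hr; first exact: C'v.
  have /andP[s0 se] := s_in.
  by rewrite subr0 enormZ (enorm1P (v i)).2 // mulr1 ger0_norm // /e in se *; lra.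
have line i s : 0 <= s <= e -> g (s *: v i) = enorm (g (s *: v i)) *: dir (g 0).
  move=> s_in; have [->|sn] := eqVneq s 0; first by rewrite scale0r dirK.
  have /andP[s0 se] := s_in.
  have sp : 0 < s by rewrite lt0r sn.
  have [gn hdir] := hd _ (gs i s s_in).
  have [Cg fgE] := hg _ (C'v i s s_in).
  rewrite -hdir ?dirK //; apply: (end_of_image hX hX' C_cone C'_cone CX CX' fg Cg gn).
    by rewrite fgE scale_unit_neq0.
  by rewrite fgE dir_scale.
apply: (@tripod_not_in_line (fun i s => enorm (g (s *: v i))) (enorm (g 0)) e e0).
- move=> i; apply: cont_on_enorm.
  apply: (@cont_on_comp R _ _ _ C' (fun s : R => s *: v i) g) => //; first exact: C'v.
  by apply: cont_onZ; [exact: cont_on_id|exact: cont_on_cst].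
- by move=> i; rewrite scale0r.
- move=> i j s ij s_in h; have e_in : 0 <= e <= e by rewrite lexx ltW.
  have : g (s *: v j) = g (e *: v i) by rewrite line // (line i) // h.
  move=> /(congr1 f).
  rewrite (hg _ (C'v j s s_in)).2 (hg _ (C'v i e e_in)).2 => E.
  have [sz|sn] := eqVneq s 0.
    have := scale_unit_neq0 e0 (vv i).
    by rewrite -E sz scale0r eqxx.
  have /andP[s0 _] := s_in; have sp : 0 < s by rewrite lt0r sn.
  have := congr1 (@dir R n) E; rewrite !dir_scale // => /vi ji.
  by rewrite ji eqxx in ij.
Qed.
End Origin.

(** * Incidence of arcs and vertices *)

Section Incidence.
Variables (R : realType) (m n : nat) (I J I' J' : finType).
Variables (G : I -> set 'rV[R]_m) (a : J -> great_arc R m) (X C : set 'rV[R]_m).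
Variables (G' : I' -> set 'rV[R]_n) (a' : J' -> great_arc R n) (X' C' : set 'rV[R]_n).
Variables (f : 'rV[R]_m -> 'rV[R]_n) (g : 'rV[R]_n -> 'rV[R]_m).
Hypotheses (hX : net G a X) (hX' : net G' a' X').
Hypotheses (C_cone : is_cone C) (C'_cone : is_cone C').
Hypotheses (CX : C `&` @unit_sphere R m = X) (CX' : C' `&` @unit_sphere R n = X').
Hypothesis fg : homeo_on C C' f g.
Hypothesis f0 : forall x, C x -> x != 0 -> f x != 0.

Let gf := homeo_on_sym fg.

Let XC y : X y -> C y. Proof. by rewrite -CX => -[]. Qed.

Lemma dirK_net x : x != 0 -> X (dir x) -> C x.
Proof. by move=> x0; rewrite -(cone_dir C_cone CX). Qed.

Lemma image_end x : C x -> x != 0 -> is_end a (dir x) -> is_end a' (dir (f x)).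
Proof.
move=> Cx x0 h; have [_ _ hf _] := fg; have [C'f gfx] := hf x Cx.
apply: (end_of_image hX' hX C'_cone C_cone CX' CX gf C'f (f0 Cx x0)).
  by rewrite gfx.
by rewrite gfx.
Qed.

(** Rays over vertices are the connected components of the singular set without
   the origin. *)
Lemma ray_image v (t : R) : is_end a v -> 0 < t -> dir (f (t *: v)) = dir (f v).
Proof.
move=> hv t0; have Xv := end_in_net hX hv; have vv := net_unit hX Xv.
have pos s : 0 <= s <= 1 -> 0 < (1 - s) * 1 + s * t.
  move=> s_in; have h1 : 0 < (1 : R) < t + 2 by apply/andP; split; lra.
  have h2 : 0 < t < t + 2 by apply/andP; split; lra.
  by have /andP[] := segment_bound h1 h2 s_in.
pose p (s : R) := ((1 - s) * 1 + s * t) *: v.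
have p_in s : 0 <= s <= 1 -> [/\ C (p s), p s != 0 & f (p s) != 0].
  move=> s_in; have ps0 : p s != 0 by exact: scale_unit_neq0 (pos s s_in) vv.
  have Cps : C (p s) by apply: C_cone (pos s s_in) (XC Xv).
  by split=> //; exact: f0.
have pc : cont_on [set s : R | 0 <= s <= 1] p.
  by apply: cont_onZ; [exact: cont_on_segment|exact: cont_on_cst].
have := path_in_ray fg pc p_in; rewrite /p subrr subr0 !mul0r !mul1r add0r addr0 scale1r.
apply=> s s_in; have [h1 h2 h3] := p_in s s_in; apply: image_end => //.
by rewrite dir_scale //; exact: pos.
Qed.

Let in_sector j x := [/\ C x, x != 0 & arc_inner a j (dir x)].

Lemma sector_regular j x : in_sector j x -> ~ is_end a' (dir (f x)).
Proof.
move=> [Cx x0 hj] h.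
have := end_of_image hX hX' C_cone C'_cone CX CX' fg Cx x0 (f0 Cx x0) h.
exact (inner_not_end hX hj).
Qed.

Lemma sector_path j x y : in_sector j x -> in_sector j y -> exists p : R -> 'rV[R]_m,
  [/\ cont_on [set s : R | 0 <= s <= 1] p, p 0 = x, p 1 = y &
    forall s, 0 <= s <= 1 -> in_sector j (p s)].
Proof.
move=> [Cx x0 [s0 s0_in e0]] [Cy y0 [s1 s1_in e1]].
have nx := enorm_gt0 x0; have ny := enorm_gt0 y0.
pose p s := ((1 - s) * enorm x + s * enorm y) *: arc_pt (a j) ((1 - s) * s0 + s * s1).
exists p; split.
- apply: cont_onZ; first exact: cont_on_segment.
  apply: (@cont_on_comp _ _ _ _ setT _ (arc_pt (a j))) => //.
    exact: cont_on_segment.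
  exact: cont_arc_pt.
- by rewrite /p subr0 !mul0r !mul1r !addr0 -e0 dirK.
- by rewrite /p subrr !mul0r !mul1r !add0r -e1 dirK.
- move=> s s_in; have h1 : 0 < enorm x < enorm x + enorm y by rewrite nx ltrDl.
  have h2 : 0 < enorm y < enorm x + enorm y by rewrite ny ltrDr.
  have /andP[t0 _] := segment_bound h1 h2 s_in.
  have hs := segment_bound s0_in s1_in s_in.
  have ps0 : p s != 0 by apply: scale_unit_neq0 t0 (arc_pt1 _ _).
  have hd : arc_inner a j (dir (p s)).
    by rewrite dir_scale ?arc_pt1 //; exists ((1 - s) * s0 + s * s1).
  split=> //; apply: dirK_net => //; apply: (arc_in_net hX); exact: inner_in_arc hd.
Qed.

Lemma arc_end_sector j b (d : R) : 0 < d -> exists q, in_sector j q /\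
  enorm (q - arc_end (a j) b) < d.
Proof.
move=> d0; have [q [hq qd]] := arc_inner_near_end a j b d0.
exists q; split=> //; have qq : dotp q q = 1 by case: hq => s _ ->; exact: arc_pt1.
split; first by apply: XC; apply: (arc_in_net hX); exact: inner_in_arc hq.
  exact: unit_neq0.
by rewrite -[q]scale1r dir_scale.
Qed.

(** The ray over an end of an arc is in the closure of the sector over the arc. *)
Lemma end_limit j b (P : 'rV[R]_n -> Prop) :
  (forall x, in_sector j x -> P (f x)) -> forall d : R, 0 < d ->
  exists y, P y /\ enorm (y - f (arc_end (a j) b)) < d.
Proof.
move=> h d d0; have [cf _ _ _] := fg.
have Xe : X (arc_end (a j) b) by apply: (arc_in_net hX); exact: arc_set_end.
have [e e0 he] := cont_on_epsP cf (XC Xe) d0.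
have [q [hq qe]] := @arc_end_sector j b e e0.
by exists (f q); split; [exact: h|apply: he => //; case: hq].
Qed.

Let end_facts j b : [/\ C (arc_end (a j) b), arc_end (a j) b != 0,
  f (arc_end (a j) b) != 0, C' (f (arc_end (a j) b)) &
  is_end a' (dir (f (arc_end (a j) b)))].
Proof.
have Xe : X (arc_end (a j) b) by apply: (arc_in_net hX); exact: arc_set_end.
have Ce := XC Xe; have e0 : arc_end (a j) b != 0 by apply: unit_neq0; exact: arc_end1.
have [_ _ hf _] := fg.
split=> //; [exact: f0|by have [] := hf _ Ce|apply: image_end => //].
by rewrite -[arc_end _ _]scale1r dir_scale ?arc_end1 //; exists j, b.
Qed.

(** The image of a sector is connected and regular, so it lies over one arc or
   over one circle. It cannot lie over a circle, since the ray over an end of the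
   arc is in the closure of the sector and has a singular image, while circles
   are away from vertices. *)
Lemma sector_image j : exists j', forall x, in_sector j x -> arc_inner a' j' (dir (f x)).
Proof.
have [q [hq _]] := @arc_end_sector j false 1 ltr01.
have [Cq q0 _] := hq; have fq0 := f0 Cq q0; have [_ _ hf _] := fg.
have C'fq : C' (f q) by have [] := hf _ Cq.
have [Ce e0 fe0 C'e ee] := end_facts j false.
have along x : in_sector j x -> exists p : R -> 'rV[R]_m,
    [/\ cont_on [set s : R | 0 <= s <= 1] p, p 0 = q, p 1 = x,
    forall s, 0 <= s <= 1 -> [/\ C (p s), p s != 0 & f (p s) != 0] &
    forall s, 0 <= s <= 1 -> ~ is_end a' (dir (f (p s)))].
  move=> hx; have [p [pc p0 p1 p_in]] := sector_path hq hx.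
  exists p; split=> // s /p_in hs; last exact: sector_regular hs.
  by have [h1 h2 _] := hs; split=> //; exact: f0.
have [/(sector_regular hq)//|[j' hj']|[i' hi']] :=
  net_cases hX' ((cone_dir C'_cone CX' fq0).1 C'fq).
- exists j' => x /along[p [pc p0 p1 p_in reg]].
  have := path_in_sector hX' C'_cone CX' fg pc p_in (j := j') reg.
  by rewrite p0 p1; apply.
(* a circle does not reach the image of an end of the arc *)
- have all_circ x : in_sector j x -> G' i' (dir (f x)).
    move=> /along[p [pc p0 p1 p_in reg]].
    have := path_in_circ hX' C'_cone CX' fg pc p_in (i := i') reg.
    by rewrite p0 p1; apply.
  have [d d0 hd] := pieces_closed hX' C'_cone CX' fe0 C'e.
  have [y [Gy yd]] := @end_limit j false (fun z => G' i' (dir z)) all_circ d d0.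
  have [_ /(_ i' Gy) Ge] := hd y yd.
  have [j1 [b1 e1]] := ee; case: (circ_arc_disjoint hX' Ge (j := j1)).
  by rewrite -e1; exact: arc_set_end.
Qed.

(** A homeomorphism respects closures, and the vertices in the closure of an arc
   are its ends. *)
Lemma incidence j j' b : (forall x, in_sector j x -> arc_inner a' j' (dir (f x))) ->
  exists b', arc_end (a' j') b' = dir (f (arc_end (a j) b)).
Proof.
move=> h; have [Ce e0 fe0 C'e ee] := end_facts j b.
have [d d0 hd] := pieces_closed hX' C'_cone CX' fe0 C'e.
have [y [Gy yd]] := @end_limit j b (fun z => arc_inner a' j' (dir z)) h d d0.
have [/(_ j' (inner_in_arc Gy)) ha _] := hd y yd.
have [[b' eb]|hi] := arc_set_cases ha; first by exists b'.
by case: (inner_not_end hX' hi).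
Qed.

(** The map [g] sends the singular ray over [dir (f u)] into the ray over [u]. *)
Lemma vertex_inj u v : is_end a u -> is_end a v -> dir (f u) = dir (f v) ->
  (forall y, C' y -> y != 0 -> g y != 0) ->
  (forall w (t : R), is_end a' w -> 0 < t -> dir (g (t *: w)) = dir (g w)) -> u = v.
Proof.
move=> hu hv e g0 ray'.
have Xu := end_in_net hX hu; have Xv := end_in_net hX hv.
have uu := net_unit hX Xu; have vv := net_unit hX Xv.
have [_ _ hf _] := fg.
have back w : is_end a w -> X w -> dotp w w = 1 -> dir (g (dir (f w))) = w.
  move=> hw Xw ww; have [C'w gfw] := hf _ (XC Xw).
  have fw0 := f0 (XC Xw) (unit_neq0 ww).
  have dw : dir w = w by rewrite -{1}[w]scale1r dir_scale.
  have endw : is_end a' (dir (f w)).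
    by apply: image_end; rewrite ?dw //; [exact: XC|exact: unit_neq0].
  by rewrite -(ray' _ _ endw (enorm_gt0 fw0)) dirK // gfw.
by rewrite -(back u) // e back.
Qed.

End Incidence.

Section K33.
Variables (R : realType) (m n : nat) (I J I' : finType).
Variables (G : I -> set 'rV[R]_m) (a : J -> great_arc R m) (X C : set 'rV[R]_m).
Variables (G' : I' -> set 'rV[R]_n) (a' : 'I_3 * 'I_3 -> great_arc R n).
Variables (X' C' : set 'rV[R]_n).
Variables (f : 'rV[R]_m -> 'rV[R]_n) (g : 'rV[R]_n -> 'rV[R]_m).
Hypotheses (hX : net G a X) (hX' : net G' a' X').
Hypotheses (C_cone : is_cone C) (C'_cone : is_cone C').
Hypotheses (CX : C `&` @unit_sphere R m = X) (CX' : C' `&` @unit_sphere R n = X').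
Hypothesis fg : homeo_on C C' f g.
Hypothesis C'0 : C' 0.
Hypothesis noG' : forall i : I', False.
Variables (A' B' : 'I_3 -> 'rV[R]_n).
Hypothesis A'_inj : injective A'.
Hypothesis B'_inj : injective B'.
Hypothesis AB' : forall i k, A' i <> B' k.
Hypothesis a'A : forall i k, arc_end (a' (i, k)) false = A' i.
Hypothesis a'B : forall i k, arc_end (a' (i, k)) true = B' k.

(** By [sector_image] and [ray_image], applied to [f] and to [g], the homeomorphism
   induces mutually inverse bijections between arcs, and injects the vertices of
   [X'] into those of [X]; [incidence] says that these maps respect ends. A
   point of a circle would be mapped to a regular point, over some arc, and [g]
   sends the sector over this arc into a sector of [C], away from the circles. *)
Lemma K33_structure : exists (A B : 'I_3 -> 'rV[R]_m) (Psi : 'I_3 * 'I_3 -> J),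
  [/\ injective A, injective B,
    forall i k, exists b, arc_end (a (Psi (i, k))) b = A i /\
                          arc_end (a (Psi (i, k))) (~~ b) = B k,
    injective Psi &
    forall x, X x -> exists e, arc_set (a (Psi e)) x].
Proof.
have gf := homeo_on_sym fg; have [_ _ hf hg] := fg.
have endA i : is_end a' (A' i) by exists (i, 0), false.
have endB k : is_end a' (B' k) by exists (0, k), true.
have g00 : g 0 = 0.
  exact: (origin_fixed hX hX' C_cone C'_cone CX CX' fg A'_inj endA C'0).
have f00 : f 0 = 0 by rewrite -g00; have [] := hg 0 C'0.
have f0 x : C x -> x != 0 -> f x != 0.
  move=> Cx; apply: contra => /eqP e; have [_ gfx] := hf x Cx.
  by rewrite -gfx e g00.
have g0 y : C' y -> y != 0 -> g y != 0.
  move=> Cy; apply: contra => /eqP e; have [_ fgy] := hg y Cy.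
  by rewrite -fgy e f00.
have [Phi hPhi] := choice (sector_image hX hX' C_cone C'_cone CX CX' fg f0).
have [Psi hPsi] := choice (sector_image hX' hX C'_cone C_cone CX' CX gf g0).
have PhiPsi e : Phi (Psi e) = e.
  have [q [hq _]] := arc_end_sector hX' CX' e false ltr01.
  have [C'q q0 hi] := hq; have [Cgq fgq] := hg q C'q.
  have := hPhi (Psi e) (g q); rewrite fgq => h.
  have hi' : arc_inner a' (Phi (Psi e)) (dir q).
    by apply: h; split=> //; [exact: g0|exact: hPsi].
  exact (inner_uniq hX' hi' (inner_in_arc hi)).
have PsiPhi j : Psi (Phi j) = j.
  have [q [hq _]] := arc_end_sector hX CX j false ltr01.
  have [Cq q0 hi] := hq; have [C'fq gfq] := hf q Cq.
  have := hPsi (Phi j) (f q); rewrite gfq => h.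
  have hi' : arc_inner a (Psi (Phi j)) (dir q).
    by apply: h; split=> //; [exact: f0|exact: hPhi].
  exact (inner_uniq hX hi' (inner_in_arc hi)).
have ray_f w (t : R) : is_end a w -> 0 < t -> dir (f (t *: w)) = dir (f w).
  exact: (ray_image hX hX' C_cone C'_cone CX CX' fg f0).
have g_inj u v : is_end a' u -> is_end a' v -> dir (g u) = dir (g v) -> u = v.
  move=> hu hv e.
  exact: (vertex_inj hX' hX C'_cone C_cone CX' CX gf g0 hu hv e f0 ray_f).
have inc e b : exists b', arc_end (a (Psi e)) b' = dir (g (arc_end (a' e) b)).
  exact: (incidence hX' hX C'_cone C_cone CX' CX gf g0 b (hPsi e)).
exists (fun i => dir (g (A' i))), (fun k => dir (g (B' k))), Psi.
split.
- by move=> i i' /g_inj => /(_ (endA i) (endA i')) /A'_inj.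
- by move=> k k' /g_inj => /(_ (endB k) (endB k')) /B'_inj.
- move=> i k; have [b hb] := inc (i, k) false; have [b' hb'] := inc (i, k) true.
  rewrite a'A in hb; rewrite a'B in hb'.
  exists b; split=> //; rewrite -hb'; congr (arc_end _ _).
  case: b b' hb hb' => -[] // hb hb'; exfalso;
    by apply: (AB' (g_inj _ _ (endA i) (endB k) _)); rewrite -hb -hb'.
- by move=> e e' h; rewrite -(PhiPsi e) h PhiPsi.
move=> x Xx; have xx := net_unit hX Xx; have x0 := unit_neq0 xx.
have dx : dir x = x by rewrite -{1}[x]scale1r dir_scale.
have Cx : C x by move: Xx; rewrite -CX => -[].
suff [j hj] : exists j, arc_set (a j) x by exists (Phi j); rewrite PsiPhi.
have [[j [b <-]]|[j hj]|[i Gi]] := net_cases hX Xx.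
- by exists j; exact: arc_set_end.
- by exists j; exact: inner_in_arc hj.
have [C'f gfx] := hf x Cx; have fx0 := f0 x Cx x0; exfalso.
have [h|[e he]|[i' _]] := net_cases hX' ((cone_dir C'_cone CX' fx0).1 C'f).
- have := end_of_image hX hX' C_cone C'_cone CX CX' fg Cx x0 fx0 h.
  rewrite dx => -[j [b eb]]; apply: (circ_arc_disjoint hX Gi (j := j)).
  by rewrite -eb; exact: arc_set_end.
- have := hPsi e (f x); rewrite gfx dx => /(_ (And3 C'f fx0 he)) hi.
  exact: (circ_arc_disjoint hX Gi (inner_in_arc hi)).
- exact: noG'.
Qed.
End K33.

(** * The product of two planar stars *)

Section StandardCone.
Variable R : realType.

Definition star120 n (e : 'I_3 -> 'rV[R]_n) :=
  forall i j, dotp (e i) (e j) = if i == j then 1 else - 2^-1.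

Lemma star120_inj n (e : 'I_3 -> 'rV[R]_n) : star120 e -> injective e.
Proof.
move=> he i j eij; apply/eqP/negPn/negP => ij.
have := he i j; rewrite (negPf ij) eij he eqxx => h.
by have : (0 : R) < 1 by []; rewrite h oppr_gt0 invr_lt0 ltNge ler0n.
Qed.

Lemma Yset_star n (Y : set 'rV[R]_n) : is_Yset 0 Y ->
  exists e : 'I_3 -> 'rV[R]_n, star120 e /\
    forall y, Y y <-> exists i (s : R), 0 <= s /\ y = s *: e i.
Proof.
move=> [u [u0 hu ->]]; exists (fun i => dir (u i)); split.
  move=> i j; case: eqVneq => [->|ij]; first exact: dir_unit.
  apply: angle120P; try exact: dir_unit.
  have d1 l : enorm (dir (u l)) = 1 by apply/enorm1P; exact: dir_unit.
  rewrite -(hu i j ij) /angle !d1 mulr1 divr1; congr acos.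
  by rewrite /dir dotpZl dotpZr mulrA mulrC invfM.
move=> y; split.
- move=> [i _ [s /= s0 <-]]; exists i, (s * enorm (u i)).
  by rewrite mulr_ge0 ?enorm_ge0 // -scalerA dirK // add0r.
- move=> [i [s [s0 ->]]]; exists i => //; exists (s / enorm (u i)) => /=.
    by rewrite divr_ge0 ?enorm_ge0.
  by rewrite add0r /dir scalerA.
Qed.

Lemma dotp_row_mx n1 n2 (x1 y1 : 'rV[R]_n1) (x2 y2 : 'rV[R]_n2) :
  dotp (row_mx x1 x2) (row_mx y1 y2) = dotp x1 y1 + dotp x2 y2.
Proof.
rewrite /dotp big_split_ord; congr (_ + _); apply: eq_bigr => i _.
  by rewrite !row_mxEl.
by rewrite !row_mxEr.
Qed.

Variables (e1 e2 : 'I_3 -> 'rV[R]_2).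
Hypothesis he1 : star120 e1.
Hypothesis he2 : star120 e2.

Definition stdA (i : 'I_3) : 'rV[R]_4 := @row_mx R 1 2 2 (e1 i) 0.
Definition stdB (k : 'I_3) : 'rV[R]_4 := @row_mx R 1 2 2 0 (e2 k).

Lemma stdAA : star120 stdA.
Proof. by move=> i j; rewrite /stdA (@dotp_row_mx 2 2) dotp0l addr0. Qed.

Lemma stdBB : star120 stdB.
Proof. by move=> i j; rewrite /stdB (@dotp_row_mx 2 2) dotp0l add0r. Qed.

Lemma stdAB i k : dotp (stdA i) (stdB k) = 0.
Proof. by rewrite /stdA /stdB (@dotp_row_mx 2 2) dotp0l dotp0r addr0. Qed.

Let A1 i : enorm (stdA i) = 1. Proof. by apply/enorm1P; rewrite stdAA eqxx. Qed.
Let B1 i : enorm (stdB i) = 1. Proof. by apply/enorm1P; rewrite stdBB eqxx. Qed.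

Let pihalf_gt0 : 0 < pi / 2 :> R. Proof. by rewrite divr_gt0 ?pi_gt0. Qed.
Let pihalf_lt : pi / 2 < 2 * pi :> R. Proof. by have := pi_gt0 R; lra. Qed.

Definition std_arc (e : 'I_3 * 'I_3) : great_arc R 4 :=
  GreatArc (A1 e.1) (B1 e.2) (stdAB e.1 e.2) pihalf_gt0 pihalf_lt.

Lemma std_arc_end e b : arc_end (std_arc e) b = if b then stdB e.2 else stdA e.1.
Proof.
case: b; rewrite /arc_end /arc_pt /=.
  by rewrite cos_pihalf sin_pihalf scale0r scale1r add0r.
by rewrite cos0 sin0 scale0r scale1r addr0.
Qed.

Lemma std_arc_tangent e b : arc_tangent (std_arc e) b = if b then stdA e.1 else stdB e.2.
Proof.
by case: b => //=; rewrite cos_pihalf sin_pihalf scale0r scale1r subr0.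
Qed.

Lemma stdAB_neq i k : stdA i <> stdB k.
Proof.
move=> h; have := stdAB i k; rewrite h stdBB eqxx => /eqP.
by rewrite oner_eq0.
Qed.

Lemma quarter_arc n (u v y : 'rV[R]_n) : dotp u u = 1 -> dotp v v = 1 -> dotp u v = 0 ->
  halfarc u v (pi / 2) y <->
  exists s t : R, [/\ 0 <= s, 0 <= t, s ^+ 2 + t ^+ 2 = 1 & y = s *: u + t *: v].
Proof.
move=> uu vv uv; have pi0 := pi_gt0 R; split.
- move=> [w /= /andP[w0 wpi] <-]; exists (cos w), (sin w); split=> //.
  + by apply: cos_ge0_pihalf; rewrite wpi andbT; lra.
  + by apply: sin_ge0_pi; apply/andP; split; lra.
  + exact: cos2Dsin2.
- move=> [s [t [s0 t0 st ->]]].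
  have hs : -1 <= s <= 1 by have := sqr_ge0 t => ?; apply/andP; split; nra.
  have cs : cos (acos s) = s by rewrite acosK // in_itv.
  exists (acos s) => /=; last first.
    rewrite cs sin_acos // (_ : 1 - s ^+ 2 = t ^+ 2); last by lra.
    by rewrite sqrtr_sqr ger0_norm.
  rewrite acos_ge0 //= leNgt; apply/negP => h.
  have h1 : pi / 2 \in `[0 : R, pi] by rewrite in_itv /=; apply/andP; split; lra.
  have h2 : acos s \in `[0, pi] by rewrite in_itv /= acos_ge0 //= acos_lepi.
  by move: h; rewrite -ltr_cos // cos_pihalf cs ltNge s0.
Qed.

Lemma std_arc_set e y : arc_set (std_arc e) y <-> exists s t : R,
  [/\ 0 <= s, 0 <= t, s ^+ 2 + t ^+ 2 = 1 & y = s *: stdA e.1 + t *: stdB e.2].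
Proof.
rewrite (arc_setE _ false) std_arc_end std_arc_tangent.
by apply: quarter_arc; rewrite ?stdAA ?stdBB ?eqxx ?stdAB.
Qed.

Definition std_cone : set 'rV[R]_4 := [set x | exists i k (s t : R),
  [/\ 0 <= s, 0 <= t & x = s *: stdA i + t *: stdB k]].

Lemma std_cone_net :
  net (fun i : 'I_0 => set0) std_arc (std_cone `&` @unit_sphere R 4).
Proof.
split.
- split; first by case.
  apply/seteqP; split=> x.
    move=> [[i [k [s [t [s0 t0 e]]]]] /enorm1P xx]; right; exists (i, k) => //.
    apply/std_arc_set; exists s, t; split=> //.
    by rewrite -xx e frame_dotp ?stdAA ?stdBB ?eqxx // stdAB.
  move=> [[[]] //|[[i k] _ /std_arc_set [s [t [s0 t0 st ->]]]]].
  split; first by exists i, k, s, t.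
  by apply/enorm1P; rewrite frame_dotp ?stdAA ?stdBB ?eqxx // stdAB.
- by case.
- move=> [i k] [j l] ne x [/std_arc_set [s [t [s0 t0 st ex]]]].
  move=> /std_arc_set [s' [t' [s'0 t'0 st' ex']]] /=.
  rewrite /= in ex ex'.
  have cA r : dotp x (stdA r) = s * (if i == r then 1 else - 2^-1).
    by rewrite ex dotpDl !dotpZl stdAA (dotpC (stdB k)) stdAB mulr0 addr0.
  have cA' r : dotp x (stdA r) = s' * (if j == r then 1 else - 2^-1).
    by rewrite ex' dotpDl !dotpZl stdAA (dotpC (stdB l)) stdAB mulr0 addr0.
  have cB r : dotp x (stdB r) = t * (if k == r then 1 else - 2^-1).
    by rewrite ex dotpDl !dotpZl stdBB stdAB mulr0 add0r.
  have cB' r : dotp x (stdB r) = t' * (if l == r then 1 else - 2^-1).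
    by rewrite ex' dotpDl !dotpZl stdBB stdAB mulr0 add0r.
  have ends b e : x = (if b then stdB e.2 else stdA e.1) -> arc_ends (std_arc e) x.
    by move=> ->; exists b => //; exact: std_arc_end.
  have one (r r' : R) : 0 <= r' -> r = 0 -> r ^+ 2 + r' ^+ 2 = 1 -> r' = 1.
    move=> r0 -> /eqP; rewrite expr0n add0r sqrf_eq1 => /orP[]/eqP // h.
    by move: r0; rewrite h ler0N1.
  have [ij|ij] := eqVneq i j; last first.
    have h1 := cA i; have h2 := cA' i; rewrite h1 eqxx eq_sym (negPf ij) in h2.
    have sz : s = 0 by lra.
    have s'z : s' = 0 by lra.
    split; apply: (ends true); rewrite /=.
      by rewrite ex sz (one s t) // scale0r scale1r add0r.
    by rewrite ex' s'z (one s' t') // scale0r scale1r add0r.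
  have kl : k != l by apply: contra ne => /eqP ->; rewrite ij.
  have h1 := cB k; have h2 := cB' k; rewrite h1 eqxx eq_sym (negPf kl) in h2.
  have tz : t = 0 by lra.
  have t'z : t' = 0 by lra.
  split; apply: (ends false); rewrite /=.
    by rewrite ex tz (one t s) // ?scale0r ?scale1r ?addr0 // addrC.
  by rewrite ex' t'z (one t' s') // ?scale0r ?scale1r ?addr0 // addrC.
- move=> [i k] b; rewrite std_arc_end /=.
  pose h (r : 'I_3) : ('I_3 * 'I_3) * bool := if b then ((r, k), true) else ((i, r), false).
  have hinj : injective h by rewrite /h => r r'; case: (b) => -[].
  rewrite -[RHS](card_ord 3) -(card_codom hinj); apply: eq_card => -[[j l] c].
  rewrite !inE std_arc_end /=; apply/eqP/codomP => [|[r]]; rewrite /h.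
    case: (b) (c) => -[] /=.
    + by move/(star120_inj stdBB) => ->; exists j.
    + by move/stdAB_neq.
    + by move/esym/stdAB_neq.
    + by move/(star120_inj stdAA) => ->; exists l.
  by case: (b) => -[] -> -> ->.
- move=> [i k] b [j l] c ne; rewrite !std_arc_end !std_arc_tangent /=.
  case: b c ne => -[] ne /=.
  + move=> /(star120_inj stdBB) kl; have ij : i != j by apply: contra ne => /eqP ->; rewrite kl.
    by apply: angle120_sym; rewrite ?stdAA ?eqxx // (negPf ij).
  + by move/esym/stdAB_neq.
  + by move/stdAB_neq.
  + move=> /(star120_inj stdAA) ij; have kl : k != l by apply: contra ne => /eqP ->; rewrite ij.
    by apply: angle120_sym; rewrite ?stdBB ?eqxx // (negPf kl).
Qed.

Lemma std_cone_is_cone : is_cone std_cone.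
Proof.
move=> r x r0 [i [k [s [t [s0 t0 ->]]]]]; exists i, k, (r * s), (r * t).
by split; rewrite ?mulr_ge0 ?(ltW r0) // scalerDr !scalerA.
Qed.

Lemma std_cone0 : std_cone 0.
Proof. by exists 0, 0, 0, 0; rewrite !scale0r addr0. Qed.

Lemma prod_set_std_cone (Y1 Y2 : set 'rV[R]_2) :
  (forall y, Y1 y <-> exists i (s : R), 0 <= s /\ y = s *: e1 i) ->
  (forall y, Y2 y <-> exists i (s : R), 0 <= s /\ y = s *: e2 i) ->
  prod_set Y1 Y2 = std_cone.
Proof.
move=> h1 h2.
have comb i k (s t : R) : s *: stdA i + t *: stdB k =
    @row_mx R 1 2 2 (s *: e1 i) (t *: e2 k).
  rewrite -[LHS]/((s *: row_mx (e1 i) 0 + t *: row_mx 0 (e2 k)) : 'rV[R]_(2 + 2)).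
  by rewrite !scale_row_mx !scaler0 add_row_mx addr0 add0r.
apply/seteqP; split=> x.
  move=> [y1 [y2 [/h1[i [s [s0 ->]]] /h2[k [t [t0 ->]]] ->]]].
  by exists i, k, s, t; rewrite comb.
move=> [i [k [s [t [s0 t0 ->]]]]]; exists (s *: e1 i), (t *: e2 k).
split; [by apply/h1; exists i, s|by apply/h2; exists k, t|exact: comb].
Qed.

Lemma dotp2 (x y : 'rV[R]_2) : dotp x y = x 0 0 * y 0 0 + x 0 1 * y 0 1.
Proof.
rewrite /dotp !big_ord_recl big_ord0 addr0; congr (_ + x 0 _ * y 0 _);
  exact: val_inj.
Qed.

(** The last two vectors have opposite components orthogonal to the first one, of
   square [3 / 4]; the identity is then that of Parseval. *)
Lemma star120_frame (e : 'I_3 -> 'rV[R]_2) (x : 'rV[R]_2) : star120 e ->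
  dotp x (e 0) ^+ 2 + dotp x (e 1) ^+ 2 + dotp x (e 2) ^+ 2 = 3 / 2 * dotp x x.
Proof.
move=> he.
have h00 := he 0 0; have h11 := he 1 1; have h01 := he 0 1; rewrite /= in h00 h11 h01.
have e20 : e 2 = - (e 0 + e 1) by apply: sum0_third; apply: sum120; rewrite he.
rewrite e20 dotpNr dotpDr !dotp2; move: h00 h11 h01; rewrite !dotp2.
move: (x 0 0) (x 0 1) (e 0 0 0) (e 0 0 1) (e 1 0 0) (e 1 0 1) => X Y a b p q.
move=> h00 h11 h01.
(* the component of the second vector orthogonal to the first one *)
pose r := a * q - b * p.
have ep : p = - 2^-1 * a - r * b.
  have : p * (a * a + b * b) = (a * p + b * q) * a - r * b by rewrite /r; ring.
  by rewrite h00 h01 mulr1.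
have eq : q = - 2^-1 * b + r * a.
  have : q * (a * a + b * b) = (a * p + b * q) * b + r * a by rewrite /r; ring.
  by rewrite h00 h01 mulr1.
have rr : r ^+ 2 = 3 / 4.
  have : r ^+ 2 = (a * a + b * b) * (p * p + q * q) - (a * p + b * q) ^+ 2.
    by rewrite /r; ring.
  by rewrite h00 h11 h01; lra.
clearbody r; subst p q.
have -> : (X * a + Y * b) ^+ 2 +
  (X * (- 2^-1 * a - r * b) + Y * (- 2^-1 * b + r * a)) ^+ 2 +
  (- (X * a + Y * b + (X * (- 2^-1 * a - r * b) + Y * (- 2^-1 * b + r * a)))) ^+ 2
  = 3 / 2 * (X * a + Y * b) ^+ 2 + 2 * r ^+ 2 * (Y * a - X * b) ^+ 2 by field.
have -> : X * X + Y * Y = (X * X + Y * Y) * (a * a + b * b) by rewrite h00 mulr1.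
by rewrite rr; field.
Qed.

End StandardCone.

(** * All arcs are quarters of great circles *)

Section OtherEnd.
Variables (R : realType) (n : nat).
Implicit Types a : great_arc R n.

Lemma arc_other_end a b : arc_end a (~~ b) =
  cos (arc_len a) *: arc_end a b + sin (arc_len a) *: arc_tangent a b.
Proof.
case: b; last by rewrite arc_end0.
rewrite arc_end0 /arc_end /arc_tangent /arc_pt; apply/rowP => k; rewrite !mxE.
move: (cos2Dsin2 (arc_len a)); set c := cos _; set s := sin _ => h.
transitivity ((c ^+ 2 + s ^+ 2) * arc_src a 0 k); first by rewrite h mul1r.
by ring.
Qed.

Lemma arc_other_tangent a b : arc_tangent a (~~ b) =
  sin (arc_len a) *: arc_end a b - cos (arc_len a) *: arc_tangent a b.
Proof.
case: b; last by rewrite arc_end0.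
rewrite /arc_end /arc_tangent /arc_pt; apply/rowP => k; rewrite !mxE.
move: (cos2Dsin2 (arc_len a)); set c := cos _; set s := sin _ => h.
transitivity ((c ^+ 2 + s ^+ 2) * arc_dir a 0 k); first by rewrite h mul1r.
by ring.
Qed.

End OtherEnd.

Lemma ord3_others (j : 'I_3) : exists k l, [/\ k != j, l != j & k != l].
Proof. by move: j; apply: ord3_ind; [exists 1, 2|exists 0, 2|exists 0, 1]. Qed.

Section Quarters.
Variables (R : realType) (I J : finType).
Variables (G : I -> set 'rV[R]_4) (a : J -> great_arc R 4) (X : set 'rV[R]_4).
Hypothesis hX : net G a X.
Variables (A B : 'I_3 -> 'rV[R]_4) (Psi : 'I_3 * 'I_3 -> J) (o : 'I_3 -> 'I_3 -> bool).
Hypothesis A_inj : injective A.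
Hypothesis Psi_inj : injective Psi.
Hypothesis endA : forall i k, arc_end (a (Psi (i, k))) (o i k) = A i.
Hypothesis endB : forall i k, arc_end (a (Psi (i, k))) (~~ o i k) = B k.

Let len i k := arc_len (a (Psi (i, k))).
Let t i k := arc_tangent (a (Psi (i, k))) (o i k).
Let s i k := arc_tangent (a (Psi (i, k))) (~~ o i k).

Let AA i : dotp (A i) (A i) = 1. Proof. by rewrite -(endA i 0) arc_end1. Qed.
Let BB k : dotp (B k) (B k) = 1. Proof. by rewrite -(endB 0 k) arc_end1. Qed.
Let tt i k : dotp (t i k) (t i k) = 1. Proof. exact: arc_tangent1. Qed.
Let At i k : dotp (A i) (t i k) = 0. Proof. by rewrite -(endA i k) arc_end_tangent. Qed.

Let BE i k : B k = cos (len i k) *: A i + sin (len i k) *: t i k.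
Proof. by rewrite -(endB i k) -(endA i k); exact: arc_other_end. Qed.

Let sE i k : s i k = sin (len i k) *: A i - cos (len i k) *: t i k.
Proof. by rewrite /s -(endA i k); exact: arc_other_tangent. Qed.

Let t120 i k l : k != l -> dotp (t i k) (t i l) = - 2^-1.
Proof.
move=> kl; apply: angle120P => //; have [_ _ _ _ h] := hX; apply: h; last by rewrite !endA.
by apply: contra kl => /eqP [/Psi_inj[->]].
Qed.

Let s120 i j k : i != j -> dotp (s i k) (s j k) = - 2^-1.
Proof.
move=> ij; apply: angle120P; try exact: arc_tangent1.
have [_ _ _ _ h] := hX; apply: h; last by rewrite !endB.
by apply: contra ij => /eqP [/Psi_inj[->]].
Qed.

Lemma quarters_AB i k : dotp (A i) (B k) = 0.
Proof.
apply: (@net_orthogonal R A B t s (fun i k => cos (len i k)) (fun i k => sin (len i k)))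
  => // j l; exact: cos2Dsin2.
Qed.

Let cos0_len i k : cos (len i k) = 0.
Proof.
have := quarters_AB i k; rewrite (BE i k) dotpDr !dotpZr AA At; lra.
Qed.

Let sin2_len i k : sin (len i k) ^+ 2 = 1.
Proof. by have := cos2Dsin2 (len i k); rewrite cos0_len; lra. Qed.

Let BtE i k : B k = sin (len i k) *: t i k.
Proof. by rewrite (BE i k) cos0_len scale0r add0r. Qed.

Let tBE i k : t i k = sin (len i k) *: B k.
Proof. by rewrite (BtE i k) scalerA -expr2 sin2_len scale1r. Qed.

Let sAE i k : s i k = sin (len i k) *: A i.
Proof. by rewrite sE cos0_len scale0r subr0. Qed.

Let sin_pm i k : sin (len i k) = 1 \/ sin (len i k) = -1.
Proof. by have /eqP := sin2_len i k; rewrite sqrf_eq1 => /orP[]/eqP; [left|right]. Qed.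

(** An arc with [sin len = -1] is three quarters of a great circle: it runs
   through the antipodes of both its ends. *)
Let long_arc (v w : 'rV[R]_4) i k : sin (len i k) = -1 ->
  arc_set (a (Psi (i, k))) = halfarc v w (len i k) -> arc_set (a (Psi (i, k))) (- v).
Proof.
move=> h ->; exists pi => /=; last by rewrite cospi sinpi scaleN1r scale0r addr0.
rewrite pi_ge0 /= leNgt; apply/negP => lpi.
have : 0 <= sin (len i k) by apply: sin_ge0_pi; rewrite !ltW // arc_len_gt0.
by rewrite h ler0N1.
Qed.

Let opp_neq (v : 'rV[R]_4) : dotp v v = 1 -> - v <> v.
Proof.
move=> vv h; have := dotpNl v v; rewrite h vv => e.
have /eqP : (1 : R) = 0 by lra.
by rewrite oner_eq0.
Qed.

Let opp_orth (v w : 'rV[R]_4) : dotp v v = 1 -> dotp v w = 0 -> - v <> w.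
Proof.
move=> vv vw h; have := dotpNr v v; rewrite h vv vw => e.
have /eqP : (1 : R) = 0 by lra.
by rewrite oner_eq0.
Qed.

Let arc_endsE i k x : arc_ends (a (Psi (i, k))) x -> x = A i \/ x = B k.
Proof.
move=> [b _ <-]; have := endA i k; have := endB i k.
by case: b (o i k) => -[] /= ? ?; [left|right|right|left].
Qed.

(** Two arcs that both run through the antipode of a vertex meet at a point that
   is not an end of the first one, by [quarters_AB]. *)
Let antipode_clash i k j l v : (i, k) != (j, l) -> v = A i \/ v = B k ->
  arc_set (a (Psi (i, k))) (- v) -> arc_set (a (Psi (j, l))) (- v) -> False.
Proof.
move=> ne hv h1 h2; have [_ _ /(_ (Psi (i, k)) (Psi (j, l))) h _ _] := hX.
have [|/arc_endsE he _] := h _ (- v) (conj h1 h2).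
  by rewrite (inj_eq Psi_inj).
case: hv he => -> [].
- exact: opp_neq.
- exact: opp_orth (AA i) (quarters_AB i k).
- by apply: opp_orth (BB k) _; rewrite dotpC quarters_AB.
- exact: opp_neq.
Qed.

Let row_clash i k l : k != l -> sin (len i k) = -1 -> sin (len i l) = -1 -> False.
Proof.
move=> kl hk hl; apply: (@antipode_clash i k i l (A i)); last 2 first.
- by apply: (long_arc hk); rewrite -(endA i k); exact: arc_setE.
- by apply: (long_arc hl); rewrite -(endA i l); exact: arc_setE.
- by apply: contra kl => /eqP [->].
- by left.
Qed.

Let col_clash i j k : i != j -> sin (len i k) = -1 -> sin (len j k) = -1 -> False.
Proof.
move=> ij hi hj; apply: (@antipode_clash i k j k (B k)); last 2 first.
- by apply: (long_arc hi); rewrite -(endB i k); exact: arc_setE.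
- by apply: (long_arc hj); rewrite -(endB j k); exact: arc_setE.
- by apply: contra ij => /eqP [->].
- by right.
Qed.

Let BBE i k l : k != l -> sin (len i k) * sin (len i l) * dotp (B k) (B l) = - 2^-1.
Proof.
by move=> kl; rewrite -(t120 i kl) (tBE i k) (tBE i l) dotpZl dotpZr mulrA.
Qed.

Let BB_neq0 k l : k != l -> dotp (B k) (B l) != 0.
Proof.
move=> kl; apply/eqP => h; have := BBE 0 kl; rewrite h mulr0 => e.
have /eqP : (1 : R) = 0 by lra.
by rewrite oner_eq0.
Qed.

(** By orthogonality all the sines are 1 or -1. Two long arcs from the same
   vertex would meet at its antipode, so each row and each column contains at
   most one [-1]. But [BBE] says that the product of two sines of a row depends
   only on the two columns, so that one [-1] forces two in every other row. *)
Lemma sin_len i k : sin (len i k) = 1.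
Proof.
have [//|h] := sin_pm i k; exfalso.
have [l [l' [lk l'k ll']]] := ord3_others k; have [j [_ [ji _ _]]] := ord3_others i.
have other_row r : r != k -> sin (len j r) = -1.
  move=> rk; have kr : k != r by rewrite eq_sym.
  have hr : sin (len i r) = 1 by have [//|/(row_clash kr h)] := sin_pm i r.
  have hj : sin (len j k) = 1.
    by have [//|h2] := sin_pm j k; case: (col_clash ji h2 h).
  have := BBE i kr; rewrite -(BBE j kr) => /(mulIf (BB_neq0 kr)).
  by rewrite h hr hj mul1r mulr1 => <-.
exact: row_clash ll' (other_row l lk) (other_row l' l'k).
Qed.

Lemma quarters_A : star120 A.
Proof.
move=> i j; case: eqVneq => [->|ij]; first exact: AA.
by rewrite -(s120 0 ij) !sAE !sin_len !scale1r.
Qed.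

Lemma quarters_B : star120 B.
Proof.
move=> k l; case: eqVneq => [->|kl]; first exact: BB.
by rewrite -(t120 0 kl) !tBE !sin_len !scale1r.
Qed.

Lemma quarters_arc i k y : arc_set (a (Psi (i, k))) y <-> exists s t : R,
  [/\ 0 <= s, 0 <= t, s ^+ 2 + t ^+ 2 = 1 & y = s *: A i + t *: B k].
Proof.
have l0 := arc_len_gt0 (a (Psi (i, k))); have l2 := arc_len_lt (a (Psi (i, k))).
have lE : len i k = pi / 2.
  apply/eqP; rewrite -subr_eq0; apply/eqP; apply: cos_eq1.
    by have := pi_gt0 R => pi0; rewrite /len; apply/andP; split; lra.
  by rewrite cosBpihalf sin_len.
rewrite (arc_setE _ (o i k)) endA -/(t i k) tBE sin_len scale1r -/(len i k) lE.
by apply: quarter_arc => //; exact: quarters_AB.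
Qed.

End Quarters.

(** * The isometry *)

Section Frame.
Variable R : realType.

Lemma star120_sum n (e : 'I_3 -> 'rV[R]_n) : star120 e -> e 0 + e 1 + e 2 = 0.
Proof. by move=> he; apply: sum120; rewrite he. Qed.

Lemma big3 (V : nmodType) (F : 'I_3 -> V) : \sum_i F i = F 0 + F 1 + F 2.
Proof.
rewrite !big_ord_recl big_ord0 addr0 addrA.
by congr (_ + F _ + F _); exact: val_inj.
Qed.

(** The linear map that sends each [e i] to [A i] when both are 120 degree stars
   and [e] spans the space: in a plane such a star is a tight frame, with
   constant [3 / 2]. *)
Definition star_map n m (e : 'I_3 -> 'rV[R]_n) (A : 'I_3 -> 'rV[R]_m) (x : 'rV[R]_n) :=
  (2 / 3) *: \sum_i dotp x (e i) *: A i.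

Lemma star_map_linear n m (e : 'I_3 -> 'rV[R]_n) (A : 'I_3 -> 'rV[R]_m) :
  linear (star_map e A).
Proof.
move=> c x y; rewrite /star_map.
have -> : \sum_i dotp (c *: x + y) (e i) *: A i =
    c *: (\sum_i dotp x (e i) *: A i) + \sum_i dotp y (e i) *: A i.
  rewrite scaler_sumr -big_split; apply: eq_bigr => i _ /=.
  by rewrite dotpDl dotpZl scalerDl scalerA.
by rewrite scalerDr !scalerA mulrC.
Qed.

Lemma star_map_point n m (e : 'I_3 -> 'rV[R]_n) (A : 'I_3 -> 'rV[R]_m) i :
  star120 e -> star120 A -> star_map e A (e i) = A i.
Proof.
move=> he /star120_sum sA; rewrite /star_map big3 !he.
have E k := congr1 (fun v : 'rV[R]_m => v 0 k) sA.
by move: i; apply: ord3_ind; apply/rowP => k; have := E k; rewrite !mxE /=; lra.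
Qed.

Lemma star_map_orth n m (e : 'I_3 -> 'rV[R]_n) (A : 'I_3 -> 'rV[R]_m) x :
  (forall i, dotp x (e i) = 0) -> star_map e A x = 0.
Proof.
by move=> h; rewrite /star_map big1 ?scaler0 // => i _; rewrite h scale0r.
Qed.

Lemma dotp_star_map n m (e : 'I_3 -> 'rV[R]_n) (A : 'I_3 -> 'rV[R]_m) x :
  star120 e -> star120 A -> dotp (star_map e A x) (star_map e A x) =
  2 / 3 * (dotp x (e 0) ^+ 2 + dotp x (e 1) ^+ 2 + dotp x (e 2) ^+ 2).
Proof.
move=> he hA; have h : dotp x (e 0) + dotp x (e 1) + dotp x (e 2) = 0.
  by rewrite -!dotpDr star120_sum // dotp0r.
have h2 : dotp x (e 2) = - (dotp x (e 0) + dotp x (e 1)) by lra.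
rewrite /star_map big3 dotpZl dotpZr !dotpDl !dotpDr !dotpZl !dotpZr !hA /= h2.
by field.
Qed.

Lemma star_map_cross n m (e e' : 'I_3 -> 'rV[R]_n) (A B : 'I_3 -> 'rV[R]_m) x :
  (forall i k, dotp (A i) (B k) = 0) -> dotp (star_map e A x) (star_map e' B x) = 0.
Proof.
move=> AB; rewrite /star_map dotpZl dotpZr dotp_suml big1 ?mulr0 // => i _.
by rewrite dotp_sumr big1 // => k _; rewrite dotpZl dotpZr AB !mulr0.
Qed.

(** Apply [star120_frame] in the two planes. *)
Lemma std_frame (e1 e2 : 'I_3 -> 'rV[R]_2) (x : 'rV[R]_4) : star120 e1 -> star120 e2 ->
  2 / 3 * (dotp x (stdA e1 0) ^+ 2 + dotp x (stdA e1 1) ^+ 2 + dotp x (stdA e1 2) ^+ 2)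
  + 2 / 3 * (dotp x (stdB e2 0) ^+ 2 + dotp x (stdB e2 1) ^+ 2 + dotp x (stdB e2 2) ^+ 2)
  = dotp x x.
Proof.
move=> h1 h2; rewrite -[x](@hsubmxK R 1 2 2) /stdA /stdB !(@dotp_row_mx R 2 2).
rewrite !dotp0r !addr0 !add0r !star120_frame //.
by lra.
Qed.

End Frame.

Lemma cone_quadrants (R : realType) n (C : set 'rV[R]_n) (A B : 'I_3 -> 'rV[R]_n) :
  is_cone C -> C 0 -> star120 A -> star120 B -> (forall i k, dotp (A i) (B k) = 0) ->
  (forall y, (C `&` @unit_sphere R n) y <-> exists i k (s t : R),
    [/\ 0 <= s, 0 <= t, s ^+ 2 + t ^+ 2 = 1 & y = s *: A i + t *: B k]) ->
  forall x, C x <-> exists i k (s t : R), [/\ 0 <= s, 0 <= t & x = s *: A i + t *: B k].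
Proof.
move=> C_cone C0 hA hB AB hX x.
have [->|x0] := eqVneq x 0.
  by split=> // _; exists 0, 0, 0, 0; rewrite !scale0r addr0.
have nx := enorm_gt0 x0; rewrite (cone_dir C_cone erefl x0) hX; split.
- move=> [i [k [s [t [s0 t0 _ e]]]]]; exists i, k, (enorm x * s), (enorm x * t).
  split; [by rewrite mulr_ge0 // ltW|by rewrite mulr_ge0 // ltW|].
  by rewrite -[LHS](dirK x0) e scalerDr !scalerA.
- move=> [i [k [s [t [s0 t0 e]]]]].
  have e' : dir x = ((enorm x)^-1 * s) *: A i + ((enorm x)^-1 * t) *: B k.
    by rewrite -!scalerA -scalerDr -e.
  exists i, k, ((enorm x)^-1 * s), ((enorm x)^-1 * t).
  have := dir_unit x0; rewrite {1 2}e' frame_dotp ?hA ?hB ?eqxx // => st.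
  by split; rewrite // mulr_ge0 // invr_ge0 ltW.
Qed.

(** [t *: x] tends to 0 with [t]. *)
Lemma closed_cone0 (R : realType) n (C : set 'rV[R]_n) x :
  closed C -> is_cone C -> C x -> C 0.
Proof.
move=> C_closed C_cone Cx; apply: C_closed => P /near_enormP [d d0 hd].
pose s := d / (2 * (1 + enorm x)); have x1 : 0 < 1 + enorm x by have := enorm_ge0 x; lra.
have s0 : 0 < s by rewrite divr_gt0 // mulr_gt0.
exists (s *: x); split; first exact: C_cone.
apply: hd; rewrite subr0 enormZ gtr0_norm // /s mulrAC ltr_pdivrMr ?mulr_gt0 //.
by rewrite ltr_pM2l //; have := enorm_ge0 x; lra.
Qed.

Theorem theorem6p3 (R : realType) (Y1 Y2 : set 'rV[R]_2) (C : set 'rV[R]_4)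
    (hY1 : is_Yset 0 Y1) (hY2 : is_Yset 0 Y2)
    (hclosed : closed C) (hcone : is_cone C)
    (htop : homeomorphic C (prod_set Y1 Y2))
    (hnet : is_net120 (C `&` @unit_sphere R 4)) :
  exists f : 'rV[R]_4 -> 'rV[R]_4,
    is_linear_isometry f /\ C = f @` prod_set Y1 Y2.
Proof.
have [e1 [he1 hY1']] := Yset_star hY1; have [e2 [he2 hY2']] := Yset_star hY2.
move: htop; rewrite (prod_set_std_cone hY1' hY2') => -[f [g [[cf cg] fC gD fK gK]]].
have fg : homeo_on C (std_cone e1 e2) f g.
  split; [exact/cont_onP|exact/cont_onP| |].
  - by move=> x Cx; split; [apply: fC; exists x|apply: fK; rewrite inE].
  - by move=> y Dy; split; [apply: gD; exists y|apply: gK; rewrite inE].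
have C0 : C 0.
  by apply: (closed_cone0 hclosed hcone (x := g 0)); apply: gD; exists 0 => //;
    exact: std_cone0.
have [k [m [G [a hX]]]] := hnet.
change (net G a (C `&` @unit_sphere R 4)) in hX.
have [A [B [Psi [A_inj B_inj hends Psi_inj hXa]]]] :=
  K33_structure hX (std_cone_net he1 he2) hcone (@std_cone_is_cone R e1 e2) erefl erefl
  fg (std_cone0 e1 e2) (fun i : 'I_0 => match i with Ordinal _ p => notF p end)
  (star120_inj (stdAA he1)) (star120_inj (stdBB he2)) (stdAB_neq he2)
  (fun i k => std_arc_end he1 he2 (i, k) false) (fun i k => std_arc_end he1 he2 (i, k) true).
have [ori hori] := choice (fun e : 'I_3 * 'I_3 => hends e.1 e.2).
pose ori' i k := ori (i, k).
have hA i l : arc_end (a (Psi (i, l))) (ori' i l) = A i by have [] := hori (i, l).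
have hB i l : arc_end (a (Psi (i, l))) (~~ ori' i l) = B l by have [] := hori (i, l).
have sA := quarters_A hX A_inj Psi_inj hA hB; have sB := quarters_B hX A_inj Psi_inj hA hB.
have AB := quarters_AB hX A_inj Psi_inj hA hB.
have CE : forall x, C x <->
    exists i k (s t : R), [/\ 0 <= s, 0 <= t & x = s *: A i + t *: B k].
  apply: cone_quadrants => // y; split.
    move=> /hXa [[i l] /(quarters_arc hX A_inj Psi_inj hA hB) [s [t h]]].
    by exists i, l, s, t.
  move=> [i [l [s [t h]]]]; apply: (arc_in_net hX (j := Psi (i, l))).
  by apply/(quarters_arc hX A_inj Psi_inj hA hB); exists s, t.
pose F x := star_map (stdA e1) A x + star_map (stdB e2) B x.
have F_lin : linear F.
  move=> c x y; rewrite /F !star_map_linear scalerDr.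
  by rewrite -!addrA; congr (_ + _); rewrite addrCA.
have F_point i l s t : F (s *: stdA e1 i + t *: stdB e2 l) = s *: A i + t *: B l.
  have FA r : F (stdA e1 r) = A r.
    have h1 : star_map (stdA e1) A (stdA e1 r) = A r.
      by apply: star_map_point => //; exact: stdAA.
    have h2 : star_map (stdB e2) B (stdA e1 r) = 0.
      by apply: star_map_orth => q; exact: stdAB.
    by rewrite /F h1 h2 addr0.
  have FB r : F (stdB e2 r) = B r.
    have h1 : star_map (stdA e1) A (stdB e2 r) = 0.
      by apply: star_map_orth => q; rewrite dotpC stdAB.
    have h2 : star_map (stdB e2) B (stdB e2 r) = B r.
      by apply: star_map_point => //; exact: stdBB.
    by rewrite /F h1 h2 add0r.
  have F0 : F 0 = 0 by have := F_lin (-1) 0 0; rewrite scaler0 addr0 scaleN1r addNr.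
  by rewrite F_lin -[t *: stdB e2 l]addr0 F_lin FA FB F0 addr0.
exists F; split.
  split=> // x; rewrite /enorm; congr Num.sqrt.
  have h12 := star_map_cross (stdA e1) (stdB e2) x AB.
  rewrite /F dotpDl !dotpDr (dotpC (star_map (stdB e2) B x)) h12.
  have h1 := dotp_star_map x (stdAA he1) sA; have h2 := dotp_star_map x (stdBB he2) sB.
  by rewrite addr0 add0r h1 h2 std_frame.
apply/seteqP; split=> x.
  move=> /CE [i [l [s [t [s0 t0 ->]]]]].
  by exists (s *: stdA e1 i + t *: stdB e2 l); [exists i, l, s, t|exact: F_point].
move=> [y [i [l [s [t [s0 t0 ->]]]]] <-]; apply/CE; exists i, l, s, t.
by split=> //; exact: F_point.
Qed.
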